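(* Let $p\in[1,+\infty)$ and $(s_n)_n\subset(0,1)$ with $s_n\to0^+$ as $n\to+\infty$. (1) Compactness: assume $p\neq1$ and let $(u_n)_n\subset L^p(\mathbb{T}_T^d)$ satisfy $\sup_{n} s_n\mathcal{F}_p^{s_n}(u_n)\le C$ for some $C\in\mathbb{R}$. Then, up to a subsequence, $u_n-\fint u_n\rightharpoonup u$ weakly in $L^p(\mathbb{T}_T^d)$ for some $u\in L^p(\mathbb{T}_T^d)$ with $\fint u=0$. (2) $\Gamma$-liminf: for every $u\in L^p(\mathbb{T}_T^d)$ and every $(u_n)_n\subset L^p(\mathbb{T}_T^d)$ with $u_n\rightharpoonup u$ weakly in $L^p(\mathbb{T}_T^d)$, \[ \liminf_{n\to+\infty} s_n\mathcal{F}_p^{s_n}(u_n)\ge\frac{d\,\omega_d}{p\,T^d}\mathcal{F}_p^0(u). \] (3) $\Gamma$-limsup: for every $u\in L^p(\mathbb{T}_T^d)$ there exists $(u_n)_n\subset L^p(\mathbb{T}_T^d)$ with $u_n\rightharpoonup u$ weakly in $L^p(\mathbb{T}_T^d)$ and \[ \limsup_{n\to+\infty} s_n\mathcal{F}_p^{s_n}(u_n)\le\frac{d\,\omega_d}{p\,T^d}\mathcal{F}_p^0(u). \]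
   Context: $T>0$, $Q_T=[0,T]^d$. $L^p(\mathbb{T}_T^d)$ is the space of measurable $u:\mathbb{R}^d\to\mathbb{R}$ which are $T$-periodic in each coordinate direction (a.e.) with $u|_{Q_T}\in L^p(Q_T)$, normed by $\|u\|=(\int_{Q_T}|u|^p)^{1/p}$; weak convergence in $L^p(\mathbb{T}_T^d)$ means weak convergence in this Banach space. $\fint u=T^{-d}\int_{Q_T}u$. For $s\in(0,1)$, $\mathcal{F}_p^s(u)=\int_{Q_T}\int_{\mathbb{R}^d}\frac{|u(x)-u(y)|^p}{|x-y|^{d+sp}}\,\mathrm{d}y\,\mathrm{d}x\in[0,+\infty]$ and $\mathcal{F}_p^0(u)=\int_{Q_T}\int_{Q_T}|u(x)-u(y)|^p\,\mathrm{d}y\,\mathrm{d}x$. $\omega_d$ is the Lebesgue measure of the unit ball of $\mathbb{R}^d$ (so $d\omega_d=\mathcal{H}^{d-1}(\mathbb{S}^{d-1})$). *)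

(* Defs.v *)
From HB Require Import structures.
From mathcomp Require Import all_boot all_order all_algebra.
From mathcomp Require Import all_classical all_reals all_analysis.
Set Implicit Arguments. Unset Strict Implicit. Unset Printing Implicit Defensive.
Import Order.TTheory GRing.Theory Num.Theory.
Import numFieldNormedType.Exports.
Local Open Scope classical_set_scope.
Local Open Scope ring_scope.

(* R^d is represented by d.-tuple R, which carries MathComp-Analysis's
   product (Borel) sigma-algebra generated by the coordinate projections. *)
Section Defs.
Variable R : realType.

Definition enorm (d : nat) (x : d.-tuple R) : R :=
  Num.sqrt (\sum_(i < d) (tnth x i) ^+ 2).

Definition vsub (d : nat) (x y : d.-tuple R) : d.-tuple R :=
  [tuple tnth x i - tnth y i | i < d].

Definition shift (d : nat) (T : R) (i : 'I_d) (x : d.-tuple R) : d.-tuple R :=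
  [tuple tnth x j + (if j == i then T else 0) | j < d].

(* Lebesgue integral over A^n (A a subset of R), computed as the iterated
   one-dimensional Lebesgue integral (Tonelli/Fubini).  Used only for
   nonnegative integrands and for integrable ones. *)
Fixpoint iint (n : nat) (A : set R) : (n.-tuple R -> \bar R) -> \bar R :=
  match n return (n.-tuple R -> \bar R) -> \bar R with
  | 0 => fun f => f [tuple]
  | n'.+1 => fun f =>
      (\int[@lebesgue_measure R]_(x in A) iint A (fun t => f (cons_tuple x t)))%E
  end.

Definition side (T : R) : set R := `[0, T]%classic.

(* L^p(T_T^d): measurable, a.e. T-periodic in each coordinate direction,
   with finite p-th power integral over Q_T *)
Definition inLp (d : nat) (T p : R) (u : d.-tuple R -> R) : Prop :=
  measurable_fun setT u /\
  (forall i : 'I_d,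
      iint setT (fun x => ((u (shift T i x) != u x)%:R)%:E) = 0%E) /\
  (iint (side T) (fun x => (`|u x| `^ p)%:E) < +oo)%E.

Definition Lpnorm (d : nat) (T p : R) (u : d.-tuple R -> R) : R :=
  (fine (iint (side T) (fun x => (`|u x| `^ p)%:E))) `^ p^-1.

Definition Lp_dual (d : nat) (T p : R) (L : (d.-tuple R -> R) -> R) : Prop :=
  (forall (a : R) (f g : d.-tuple R -> R), inLp T p f -> inLp T p g ->
      L (fun x => a * f x + g x) = a * L f + L g) /\
  exists C : R, forall f, inLp T p f -> `|L f| <= C * Lpnorm T p f.

Definition weak_conv (d : nat) (T p : R) (un : nat -> d.-tuple R -> R)
    (u : d.-tuple R -> R) : Prop :=
  forall L, Lp_dual T p L -> (fun n => L (un n)) @ \oo --> L u.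

Definition avg (d : nat) (T : R) (u : d.-tuple R -> R) : R :=
  fine (iint (side T) (fun x => (u x)%:E)) / T ^+ d.

Definition Fs (d : nat) (T p s : R) (u : d.-tuple R -> R) : \bar R :=
  iint (side T) (fun x => iint setT (fun y =>
    ((`|u x - u y| `^ p) / (enorm (vsub x y)) `^ (d%:R + s * p))%:E)).

Definition F0 (d : nat) (T p : R) (u : d.-tuple R -> R) : \bar R :=
  iint (side T) (fun x => iint (side T) (fun y => (`|u x - u y| `^ p)%:E)).

Definition omega (d : nat) : R :=
  fine (iint setT (fun x : d.-tuple R => (((enorm x <= 1)%R)%:R)%:E)).

End Defs.

(* Main.v *)
From HB Require Import structures.
From mathcomp Require Import all_boot all_order all_algebra.
From mathcomp Require Import all_classical all_reals all_analysis.
From mathcomp Require Import measurable_realfun ring lra.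
Require Import Defs.
Set Implicit Arguments. Unset Strict Implicit. Unset Printing Implicit Defensive.
Import Order.TTheory GRing.Theory Num.Theory.
Import numFieldNormedType.Exports.
Local Open Scope classical_set_scope.
Local Open Scope ring_scope.

(** Averaging the kernel [|x - y|^(-d - sp)] over translates of [Q_T] replaces the far part
    [|x - y| > r] of the inner integral, up to factors [(1 +- diam Q_T / r)^(-d - sp)], by
    [T^-d] times the inner integral of [F0] times the integral of [|h|^(-d - sp)] over [|h| > r],
    which is [d omega_d r^(-sp) / (sp)].  Letting [s -> 0] and then [r -> oo], this bounds
    [s Fs(u)] from below by nearly [c F0(u)], with [c = d omega_d / (p T^d)] and uniformly in [u];
    the matching upper bound holds when the near part of [Fs(u)] stays bounded as [s -> 0], e.g.
    for Lipschitz [u].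
    (1) The lower bound controls [F0(u_n)], which bounds [||u_n - avg u_n||^p] up to a
    constant.  Weak compactness of bounded sequences is obtained without duality theory: by uniform convexity, suitable means of
    a tail of any subsequence form a Cauchy sequence, and along a subsequence that is generic for
    the sets of such limits every functional converges.
    (2) [F0] is weakly lower semicontinuous: by the subgradient inequality for [|.|^p], truncated
    where [|u x - u y| > M], [F0] lies above affine functionals that are bounded on [L^p] and whose
    values at [u] increase to [F0(u)].
    (3) Bounded periodic Lipschitz functions are dense, since the measurable sets whose indicator
    they approximate form a sigma-algebra containing the half-spaces [x_i > a], and [F0] is
    continuous in norm; a diagonal sequence of such functions recovers [c F0(u)]. *)
(** * Lebesgue measure on tuples *)

Section tuple_measure.
Context {R : realType}.
Local Notation leb := (@lebesgue_measure R).

(** The functionals are iterated one-dimensional integrals, so [mu n] is built on tuples by the same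
    recursion; it agrees with [iint] on nonnegative and on integrable functions, which gives access
    to Tonelli, Fatou and the convergence theorems. In the comparison, the factor [s] cancels the
    [1 / (s p)] of the radial integral. For fixed [r] the factor [r^(-sp)] tends to 1 as [s -> 0],
    and the only remaining loss is [(1 +- diam / r)^(-d)]; this dictates the order of the two
    limits. Discarding the near part costs nothing in a lower bound, so no regularity of [u] enters
    there. Elements of the space are functions rather than classes, and the p-th power of the norm
    replaces the norm, so weak compactness is proved for a gauge that satisfies a quasi-triangle
    inequality. Means are indexed by lists of natural numbers, hence countable in number; this lets
    one diagonal subsequence serve all functionals at once. The condition [p > 1] enters through
    uniform convexity. *)

Definition consT n (p : measurableTypeR R * n.-tuple R) : n.+1.-tuple R :=
  cons_tuple p.1 p.2.

Lemma measurable_consT n : measurable_fun setT (@consT n).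
Proof.
apply: (@measurable_cons _ _ _ (measurableTypeR R) fst n snd) => //.
Qed.

Lemma measurable_unconsT n :
  measurable_fun setT
    (fun z : n.+1.-tuple R => ((thead z : measurableTypeR R), [tuple of behead z])).
Proof.
apply/measurable_fun_pairP; split => /=.
- exact: (@measurable_tnth _ (measurableTypeR R) n.+1 ord0).
- exact: (@measurable_behead _ (measurableTypeR R) n).
Qed.

Section step.
Variables (n : nat) (m : {sigma_finite_measure set (n.-tuple R) -> \bar R}).
Let mcons := mfun_Sub (mem_set (@measurable_consT n)).

(** Transporting the product measure along [consT] turns Tonelli's theorem into the recursion that
    defines [iint]. *)
Definition mu_step : set (n.+1.-tuple R) -> \bar R :=
  pushforward (leb \x m)%E mcons.

Let mu_step0 : mu_step set0 = 0%E.
Proof. by rewrite /mu_step /pushforward preimage_set0 measure0. Qed.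

Let mu_step_ge0 A : (0 <= mu_step A)%E.
Proof. exact: measure_ge0. Qed.

Let mu_step_semi_sigma_additive : semi_sigma_additive mu_step.
Proof.
move=> F mF tF mUF; rewrite /mu_step /pushforward preimage_bigcup.
have mp (B : set (n.+1.-tuple R)) : measurable B -> measurable (mcons @^-1` B).
  by move=> mB; rewrite -[X in measurable X]setTI; exact: measurable_consT.
apply: measure_semi_sigma_additive.
- by move=> i; exact: mp.
- apply/trivIsetP => /= i j _ _ ij; rewrite -preimage_setI.
  by move/trivIsetP : tF => /(_ i j Logic.I Logic.I ij) ->; rewrite preimage_set0.
- by rewrite -preimage_bigcup; exact: mp.
Qed.

HB.instance Definition _ := isMeasure.Build _ _ _ mu_step
  mu_step0 mu_step_ge0 mu_step_semi_sigma_additive.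

Lemma mu_step_sigma_finite : sigma_finite setT mu_step.
Proof.
have /sigma_finiteP[F [TF ndF Foo]] := sigma_finiteT leb.
have /sigma_finiteP[G [TG ndG Goo]] := sigma_finiteT m.
pose un (z : n.+1.-tuple R) := ((thead z : measurableTypeR R), [tuple of behead z] : n.-tuple R).
have uncons x : un (mcons x) = x.
  by case: x => a b; congr pair; apply: val_inj.
exists (fun k => un @^-1` (F k `*` G k)).
  rewrite -preimage_bigcup [X in _ @^-1` X](_ : _ = setT) ?preimage_setT//.
  rewrite -subTset => -[x y] _.
  have [k _ Fk] : (\bigcup_i F i) x by rewrite -TF.
  have [l _ Gl] : (\bigcup_i G i) y by rewrite -TG.
  exists (maxn k l) => //; split.
    by move: x Fk; exact/subsetPset/ndF/leq_maxl.
  by move: y Gl; exact/subsetPset/ndG/leq_maxr.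
move=> k; have [? ?] := Foo k; have [? ?] := Goo k; split.
  by rewrite -[X in measurable X]setTI; apply: measurable_unconsT => //; exact: measurableX.
rewrite /mu_step /pushforward -comp_preimage.
rewrite (_ : un \o _ = id); last by apply/funext => x; exact: uncons.
by rewrite product_measure1E// lte_mul_pinfty// ge0_fin_numE.
Qed.

HB.instance Definition _ := Measure_isSigmaFinite.Build _ _ _ mu_step mu_step_sigma_finite.
End step.

(** The Dirac mass at the empty tuple matches [iint] at length 0, which evaluates its integrand. *)
Fixpoint mu n : {sigma_finite_measure set (n.-tuple R) -> \bar R} :=
  match n return {sigma_finite_measure set (n.-tuple R) -> \bar R} with
  | 0 => \d_([tuple] : 0.-tuple R)
  | n'.+1 => mu_step (mu n')
  end.


Definition cube (n : nat) (A : set R) : set (n.-tuple R) :=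
  [set x | forall i, A (tnth x i)].

Arguments cube : clear implicits.

Lemma measurable_cube n (A : set R) : measurable A -> measurable (cube n A).
Proof.
move=> mA; rewrite (_ : cube n A = \bigcap_(i in [set: 'I_n]) ((fun x : n.-tuple R => tnth x i) @^-1` A)).
  apply: fin_bigcap_measurable => // i _; rewrite -[X in measurable X]setTI.
  exact: (@measurable_tnth _ (measurableTypeR R)).
by apply/seteqP; split => x Hx => [i _|i]; exact: Hx.
Qed.

Lemma cube_consT n (A : set R) (t : R) (x : n.-tuple R) :
  cube n.+1 A (cons_tuple t x) <-> A t /\ cube n A x.
Proof.
split=> [H|[At Ax] i].
  split; first by have := H ord0; rewrite tnth0.
  by move=> i; have := H (lift ord0 i); rewrite tnthS.
by case: (unliftP ord0 i) => [j ->|->]; [rewrite tnthS; exact: Ax|rewrite tnth0].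
Qed.

Lemma iint0 n (A : set R) : iint A (fun _ : n.-tuple R => 0%E) = 0%E.
Proof. by elim: n => //= n ->; rewrite integral0. Qed.

Lemma iint_mkcond n (A : set R) (f : n.-tuple R -> \bar R) :
  iint A f = iint setT (f \_ (cube n A)).
Proof.
elim: n f => [|n IH] f /=.
  by rewrite patchE mem_set// => -[].
rewrite integral_mkcond; apply: eq_integral => t _; rewrite patchE.
case: ifPn => tA; last first.
  rewrite -[LHS](iint0 n setT); congr iint; apply/funext => x.
  rewrite patchE memNset// => /cube_consT[At _].
  by move: tA; rewrite notin_setE; exact.
rewrite IH; congr iint; apply/funext => x; rewrite !patchE.
move/set_mem : tA => tA.
case: ifPn => xA; first by rewrite mem_set//; apply/cube_consT; split=> //; exact/set_mem.
by rewrite memNset// => /cube_consT[_ Ax]; move: xA; rewrite notin_setE; exact.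
Qed.

(** The parameter space is arbitrary because the induction moves one coordinate of the tuple into
    the parameter. The integrand is signed, so Tonelli is applied to positive and negative parts. *)
Lemma measurable_iintT n d (X : measurableType d) (F : X * n.-tuple R -> \bar R) :
  measurable_fun setT F -> measurable_fun setT (fun x => iint setT (fun t => F (x, t))).
Proof.
elim: n d X F => [|n IH] d X F mF /=.
  by apply: measurableT_comp => //; exact: measurable_fun_pair.
pose G (p : X * measurableTypeR R) := iint setT (fun z => F (p.1, cons_tuple p.2 z)).
have mG : measurable_fun setT G.
  apply: (IH _ _ (fun q : X * measurableTypeR R * n.-tuple R => F (q.1.1, cons_tuple q.1.2 q.2))).
  apply: (measurableT_comp mF); apply: measurable_fun_pair => /=.
    exact: measurableT_comp.
  apply: (@measurable_cons _ _ _ (measurableTypeR R) (snd \o fst) n snd) => //.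
  exact: measurableT_comp.
have mp := measurable_fun_fubini_tonelli_F (m2 := leb) _ (measurable_funepos mG).
have mn := measurable_fun_fubini_tonelli_F (m2 := leb) _ (measurable_funeneg mG).
apply: eq_measurable_fun (emeasurable_funB (mp _) (mn _)) => //= x _.
rewrite /fubini_F -[RHS]/(\int[leb]_t (G (x, t)))%E [RHS]integralE.
congr (_ - _)%E.
  by apply: eq_integral => t _; rewrite !funeposE.
by apply: eq_integral => t _; rewrite !funenegE.
Qed.

Lemma measurable_iint n d (X : measurableType d) (A : set R) (F : X * n.-tuple R -> \bar R) :
  measurable A ->
  measurable_fun setT F -> measurable_fun setT (fun x => iint A (fun t => F (x, t))).
Proof.
move=> mA mF.
rewrite (_ : (fun x => _) = (fun x => iint setT (fun t => (F \_ (setT `*` cube n A)) (x, t)))).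
  apply: measurable_iintT; apply/(measurable_restrictT _ _).1; last exact: measurable_funTS mF.
  by apply: measurableX => //; exact: measurable_cube.
apply/funext => x; rewrite iint_mkcond; congr iint; apply/funext => t.
by rewrite !patchE in_setX in_setT.
Qed.

Lemma ge0_integral_muS n (f : n.+1.-tuple R -> \bar R) : measurable_fun setT f ->
  (forall x, 0 <= f x)%E ->
  (\int[mu n.+1]_x f x = \int[leb]_t \int[mu n]_x f (cons_tuple t x))%E.
Proof.
move=> mf f0.
have -> : (\int[mu n.+1]_x f x = \int[pushforward (leb \x mu n)%E (mfun_Sub (mem_set (@measurable_consT n)))]_x f x)%E by [].
rewrite ge0_integral_pushforward//.
rewrite preimage_setT fubini_tonelli1//; last by move=> x; exact: f0.
by apply: (measurableT_comp mf); exact: measurable_consT.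
Qed.

Lemma iintTE n (f : n.-tuple R -> \bar R) : measurable_fun setT f ->
  (forall x, 0 <= f x)%E -> (iint setT f = \int[mu n]_x f x)%E.
Proof.
elim: n f => [|n IH] f mf f0.
  by rewrite /= integral_dirac//= diracT mul1e.
rewrite ge0_integral_muS//=; apply: eq_integral => t _; apply: IH => //.
apply: measurableT_comp mf _.
exact: (@measurable_cons _ _ _ (measurableTypeR R) (cst t) n id).
Qed.

Lemma iintE n (A : set R) (f : n.-tuple R -> \bar R) : measurable A -> measurable_fun setT f ->
  (forall x, 0 <= f x)%E -> (iint A f = \int[mu n]_(x in cube n A) f x)%E.
Proof.
move=> mA mf f0; rewrite iint_mkcond [RHS]integral_mkcond iintTE//.
  apply/(measurable_restrictT _ _).1; last exact: measurable_funTS mf.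
  exact: measurable_cube.
by move=> x; rewrite patchE; case: ifP.
Qed.

Lemma integrable_iintTE n (f : n.-tuple R -> \bar R) : (mu n).-integrable setT f ->
  (iint setT f = \int[mu n]_x f x)%E.
Proof.
elim: n f => [|n IH] f If.
  by have mf := measurable_int _ If; rewrite /= integral_dirac//= diracT mul1e.
have mf := measurable_int _ If.
have mf2 : measurable_fun setT (f \o @consT n) by exact: measurableT_comp mf (@measurable_consT n).
have If2 : (leb \x mu n)%E.-integrable setT (f \o @consT n).
  apply/integrableP; split => //.
  rewrite fubini_tonelli1//; last exact: measurableT_comp.
  have /integrableP[_] := If; rewrite ge0_integral_muS//.
  exact: measurableT_comp.
rewrite [RHS](_ : _ = \int[pushforward (leb \x mu n)%E (mfun_Sub (mem_set (@measurable_consT n)))]_x f x)%E//.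
rewrite integral_pushforward//.
rewrite preimage_setT -(integral12_prod_meas1 If2) /=.
(* Only almost every slice is integrable, so the induction hypothesis yields equality almost
   everywhere. *)
apply: ae_eq_integral => //.
- apply: (@measurable_iintT n _ (measurableTypeR R) (f \o @consT n)) => //.
- exact: (measurable_fubini_F If2).
- have := ae_integrable1 If2; apply: filterS => t It _.
  exact: IH.
Qed.

Lemma integrable_iintE n (A : set R) (f : n.-tuple R -> \bar R) : measurable A ->
  (mu n).-integrable (cube n A) f ->
  (iint A f = \int[mu n]_(x in cube n A) f x)%E.
Proof.
move=> mA If; rewrite iint_mkcond [RHS]integral_mkcond integrable_iintTE//.
by apply: (integrable_mkcond _ _).1 => //; exact: measurable_cube.
Qed.

Lemma mu_cube n (A : set R) : measurable A -> (mu n (cube n A) = (leb A) ^+ n)%E.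
Proof.
move=> mA; elim: n => [|n IH].
  by rewrite /= diracE mem_set// => -[].
rewrite -[LHS]/(pushforward (leb \x mu n)%E _ _) /pushforward.
rewrite (_ : _ @^-1` _ = A `*` cube n A).
  by rewrite product_measure1E ?IH ?expeS//; exact: measurable_cube.
by apply/seteqP; split => -[t x] /cube_consT.
Qed.

End tuple_measure.
Arguments cube {R}.

(** * Translations and dilations *)

Section change_of_variables.
Context {R : realType}.
Local Notation leb := (@lebesgue_measure R).

Lemma measurable_affine (l c : R) : measurable_fun setT (fun t : measurableTypeR R => l * t + c : measurableTypeR R).
Proof.
by apply: (@measurable_funD _ (measurableTypeR R)).
Qed.

Lemma ge0_integral_affine (l c : R) (f : R -> \bar R) : 0 < l ->
  measurable_fun setT f -> (forall t, 0 <= f t)%E ->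
  (\int[leb]_t f t = l%:E * \int[leb]_t f (l * t + c)%R)%E.
Proof.
move=> l0 mf f0.
pose ma := mfun_Sub (mem_set (measurable_affine l c)).
pose k : {nonneg R} := NngNum (ltW l0).
have mma : measurable_fun setT ma by exact: measurable_affine.
pose m0 : {measure set _ -> \bar R} := mscale k (pushforward leb ma).
pose m1 := m0 mma.
(* Lebesgue measure is determined by its values on the intervals []a, b]], where the rescaled image
   measure agrees with it. *)
have E : forall A, measurable A -> leb A = m1 A.
  apply: lebesgue_measure_unique => X [[a b] _ <-] /=.
  rewrite /m1 /m0 /mscale/= /pushforward.
  rewrite (_ : ma @^-1` _ = `](a - c) / l, (b - c) / l]%classic); last first.
    apply/seteqP; split => t /=; rewrite !in_itv/= ltr_pdivrMr// ler_pdivlMr//;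
    by rewrite ltrBlDr lerBrDr (mulrC t).
  rewrite !lebesgue_measure_itv/= !lte_fin ltr_pM2r ?invr_gt0// ltrD2r.
  case: ifPn => _; last by rewrite mule0.
  by rewrite -EFinB -EFinM -mulrBl mulrCA divff ?gt_eqF// mulr1 opprB addrA subrK EFinB.
rewrite (@eq_measure_integral _ _ _ setT m1); last first.
  by move=> A mA _; exact: E.
rewrite /m1 /m0 ge0_integral_mscale//; congr (_ * _)%E.
by rewrite ge0_integral_pushforward.
Qed.

(** Dilation and translation in one map, so that a single induction on the dimension covers both. *)
Definition aff n (l : R) (h x : n.-tuple R) : n.-tuple R :=
  [tuple l * tnth x i + tnth h i | i < n].

Lemma aff_cons n (l h0 t : R) (h x : n.-tuple R) :
  aff l (cons_tuple h0 h) (cons_tuple t x) = cons_tuple (l * t + h0) (aff l h x).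
Proof.
apply: eq_from_tnth => i; rewrite tnth_mktuple.
by case: (unliftP ord0 i) => [j ->|->]; rewrite ?tnthS ?tnth0 ?tnth_mktuple.
Qed.

Lemma measurable_tnthR n (i : 'I_n) : measurable_fun setT (fun x : n.-tuple R => tnth x i).
Proof. exact: (@measurable_tnth _ (measurableTypeR R)). Qed.

Lemma measurable_mktuple d (X : measurableType d) n (F : 'I_n -> X -> R) :
  (forall i, measurable_fun setT (F i)) ->
  measurable_fun setT (fun x => [tuple F i x | i < n]).
Proof.
move=> mF; apply/(@measurable_fun_tnthP _ _ _ (measurableTypeR R)) => i.
by apply: eq_measurable_fun (mF i) => x _; rewrite /= tnth_mktuple.
Qed.

Lemma measurable_aff n (l : R) (h : n.-tuple R) : measurable_fun setT (aff l h).
Proof.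
apply: measurable_mktuple => i.
apply: measurable_funD => //; apply: measurable_funM => //.
exact: measurable_tnthR.
Qed.

Lemma measurable_cons_tuple n (t : R) : measurable_fun setT (fun x : n.-tuple R => cons_tuple t x).
Proof. exact: (@measurable_cons _ _ _ (measurableTypeR R) (cst t) n id). Qed.

Lemma tuple_ind_cons n (h : n.+1.-tuple R) : exists h0 h', h = cons_tuple h0 h'.
Proof. by exists (thead h), [tuple of behead h]; rewrite [LHS]tuple_eta; apply: val_inj. Qed.

Lemma measurable_slice n (f : n.+1.-tuple R -> \bar R) (t : R) : measurable_fun setT f ->
  measurable_fun setT (fun x => f (cons_tuple t x)).
Proof. by move=> mf; apply: (measurableT_comp mf); exact: measurable_cons_tuple. Qed.

Lemma measurable_int_slice n (D : set (n.-tuple R)) (f : n.+1.-tuple R -> \bar R) :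
  measurable D -> measurable_fun setT f -> (forall x, 0 <= f x)%E ->
  measurable_fun setT (fun t : R => \int[mu n]_(x in D) f (cons_tuple t x))%E.
Proof.
move=> mD mf f0.
pose g (p : measurableTypeR R * n.-tuple R) := ((f \o @consT R n) \_ (setT `*` D)) p.
have mg : measurable_fun setT g.
  apply/(measurable_restrictT _ _).1; first exact: measurableX.
  by apply: measurable_funTS; apply: (measurableT_comp mf); exact: measurable_consT.
have g0 p : (0 <= g p)%E by rewrite /g patchE; case: ifP => // _; exact: f0.
have := measurable_fun_fubini_tonelli_F (m2 := mu n) g mg g0.
apply: eq_measurable_fun => t _; rewrite /fubini_F [RHS]integral_mkcond.
by apply: eq_integral => x _; rewrite /g !patchE in_setX in_setT.
Qed.

Lemma ge0_integral_aff n (l : R) (h : n.-tuple R) (f : n.-tuple R -> \bar R) : 0 < l ->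
  measurable_fun setT f -> (forall x, 0 <= f x)%E ->
  (\int[mu n]_x f x = (l ^+ n)%:E * \int[mu n]_x f (aff l h x))%E.
Proof.
move=> l0; elim: n h f => [|n IH] h f mf f0.
  rewrite expr0 mul1e; apply: eq_integral => x _; congr f.
  by rewrite [LHS]tuple0 [RHS]tuple0.
have [h0 [h' ->]] := tuple_ind_cons h.
have mfa : measurable_fun setT (fun x => f (aff l (cons_tuple h0 h') x)).
  by apply: (measurableT_comp mf); exact: measurable_aff.
rewrite ge0_integral_muS// ge0_integral_muS//.
rewrite (@ge0_integral_affine l h0)//; last 2 first.
- by apply: measurable_int_slice.
- by move=> t; exact: integral_ge0.
rewrite exprS EFinM -muleA; congr (_ * _)%E.
rewrite -ge0_integralZl//; last 3 first.
- exact: (measurable_int_slice measurableT mfa).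
- by move=> t _; exact: integral_ge0.
- by rewrite lee_fin exprn_ge0// ltW.
apply: eq_integral => t _; rewrite (IH h')//; last exact: measurable_slice.
by congr (_ * _)%E; apply: eq_integral => x _; rewrite aff_cons.
Qed.

Definition vadd n (x h : n.-tuple R) : n.-tuple R := [tuple tnth x i + tnth h i | i < n].
Definition vscale n (l : R) (x : n.-tuple R) : n.-tuple R := [tuple l * tnth x i | i < n].

Lemma measurable_vadd n (h : n.-tuple R) : measurable_fun setT (fun x => vadd x h).
Proof.
apply: measurable_mktuple => i; apply: measurable_funD => //; exact: measurable_tnthR.
Qed.

Lemma ge0_integral_vadd n (h : n.-tuple R) (f : n.-tuple R -> \bar R) :
  measurable_fun setT f -> (forall x, 0 <= f x)%E ->
  (\int[mu n]_x f (vadd x h) = \int[mu n]_x f x)%E.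
Proof.
move=> mf f0; rewrite [RHS](@ge0_integral_aff n 1 h)// expr1n mul1e.
apply: eq_integral => x _; congr f.
by apply: eq_from_tnth => i; rewrite !tnth_mktuple mul1r.
Qed.

Lemma ge0_integral_vscale n (l : R) (f : n.-tuple R -> \bar R) : 0 < l ->
  measurable_fun setT f -> (forall x, 0 <= f x)%E ->
  (\int[mu n]_x f x = (l ^+ n)%:E * \int[mu n]_x f (vscale l x))%E.
Proof.
move=> l0 mf f0; rewrite (@ge0_integral_aff n l [tuple 0 | i < n])//; congr (_ * _)%E.
apply: eq_integral => x _; congr f.
by apply: eq_from_tnth => i; rewrite !tnth_mktuple addr0.
Qed.

End change_of_variables.

(** * Periodic functions *)

Section periodic.
Context {R : realType}.
Local Notation leb := (@lebesgue_measure R).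

Lemma integral_indicT d (X : measurableType d) (m : {measure set X -> \bar R}) (E : set X) :
  measurable E -> m E = (\int[m]_x (\1_E x)%:E)%E.
Proof. by move=> mE; rewrite integral_indic// setIT. Qed.

Lemma ae_imp d (X : measurableType d) (m : {measure set X -> \bar R}) (P Q : X -> Prop) :
  (forall x, P x -> Q x) -> {ae m, forall x, P x} -> {ae m, forall x, Q x}.
Proof. by move=> PQ; apply: filterS. Qed.

Lemma ae_and d (X : measurableType d) (m : {measure set X -> \bar R}) (P Q : X -> Prop) :
  {ae m, forall x, P x} -> {ae m, forall x, Q x} -> {ae m, forall x, P x /\ Q x}.
Proof. by move=> aP aQ; apply: filterS2 aP aQ => x. Qed.

Lemma ae_fin_forall d (X : measurableType d) (m : {measure set X -> \bar R}) (I : finType)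
    (P : I -> X -> Prop) :
  (forall i, {ae m, forall x, P i x}) -> {ae m, forall x, forall i, P i x}.
Proof. by move=> aP; exact: filter_forall. Qed.

(** Tonelli for the indicator of the exceptional set: its integral vanishes, so almost all of its
    slices are null. *)
Lemma ae_mu_cons n (P : n.+1.-tuple R -> Prop) :
  {ae mu n.+1, forall z, P z} ->
  {ae leb, forall t, {ae mu n, forall x, P (cons_tuple t x)}}.
Proof.
move=> [N [mN N0 sN]].
have mI : measurable_fun setT (EFin \o (\1_N : n.+1.-tuple R -> R)).
  by apply/measurable_EFinP.
have I0 x : (0 <= (EFin \o (\1_N : n.+1.-tuple R -> R)) x)%E by rewrite lee_fin.
have E0 : (\int[leb]_t `|\int[mu n]_x (EFin \o \1_N) (cons_tuple t x)| = 0)%E.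
  under eq_integral do rewrite gee0_abs ?integral_ge0//.
  by rewrite -ge0_integral_muS// integral_indic// setIT.
have mS := measurable_int_slice (@measurableT _ (n.-tuple R)) mI I0.
have /(ae_eq_integral_abs leb measurableT mS) := E0.
apply: filterS => t /(_ I) /= St.
have mNt : measurable ((fun x : n.-tuple R => cons_tuple t x) @^-1` N).
  by rewrite -[X in measurable X]setTI; exact: measurable_cons_tuple.
exists ((fun x => cons_tuple t x) @^-1` N); split => //.
  by rewrite integral_indicT// -St; apply: eq_integral => x _; rewrite !indicE.
by move=> x /= nP; exact: sN.
Qed.

Lemma ae_shift1 (c : R) (P : R -> Prop) :
  {ae leb, forall t, P t} -> {ae leb, forall t, P (t + c)}.
Proof.
move=> [N [mN N0 sN]].
have mI : measurable_fun setT (EFin \o (\1_N : R -> R)) by apply/measurable_EFinP.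
have mNt : measurable ((fun t : R => t + c) @^-1` N).
  by rewrite -[X in measurable X]setTI; apply: measurable_funD.
exists ((fun t => t + c) @^-1` N); split => //; last by move=> x /= nP; exact: sN.
rewrite integral_indicT// -[RHS]N0 [RHS]integral_indicT//.
rewrite (@ge0_integral_affine R 1 c (EFin \o \1_N))//; last by move=> t; rewrite lee_fin.
rewrite mul1e; apply: eq_integral => t _ /=; rewrite mul1r !indicE.
by congr (_%:R%:E); apply/idP/idP; rewrite !inE.
Qed.

Lemma ge0_integral_itv_shift (f : R -> \bar R) (a b c : R) :
  measurable_fun setT f -> (forall t, 0 <= f t)%E ->
  (\int[leb]_(t in `[a, b[) f (t + c)%R = \int[leb]_(t in `[(a + c)%R, (b + c)%R[) f t)%E.
Proof.
move=> mf f0; rewrite integral_mkcond [RHS]integral_mkcond.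
rewrite (@ge0_integral_affine R 1 c (f \_ _))//; last 2 first.
- by apply/(measurable_restrictT _ _).1 => //; exact: measurable_funTS.
- by move=> t; rewrite patchE; case: ifP.
rewrite mul1e; apply: eq_integral => t _; rewrite mul1r !patchE.
congr (if _ then _ else _).
by apply/idP/idP; rewrite !inE/= !in_itv/= lerD2r ltrD2r.
Qed.

Lemma ge0_integral_itv_split (f : R -> \bar R) (a b c : R) :
  measurable_fun setT f -> (forall t, 0 <= f t)%E -> a <= b -> b <= c ->
  (\int[leb]_(t in `[a, c[) f t =
   \int[leb]_(t in `[a, b[) f t + \int[leb]_(t in `[b, c[) f t)%E.
Proof.
move=> mf f0 ab bc; rewrite (@itv_bndbnd_setU _ _ (BLeft a) (BLeft b) (BLeft c)) ?bnd_simp//.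
rewrite ge0_integral_setU//; first exact: measurable_funTS.
rewrite disj_set2E; apply/eqP/seteqP; split => t //= [].
by rewrite !in_itv/= => /andP[_ tb] /andP[bt _]; have := lt_le_trans tb bt; rewrite ltxx.
Qed.

Section one_dim.
Variables (T : R) (f : R -> \bar R).
Hypotheses (T0 : 0 < T) (mf : measurable_fun setT f) (f0 : forall t, (0 <= f t)%E).
Hypothesis pf : {ae leb, forall t, f (t + T) = f t}.

Let shiftT a b : (\int[leb]_(t in `[(a + T)%R, (b + T)%R[) f t = \int[leb]_(t in `[a, b[) f t)%E.
Proof.
rewrite -ge0_integral_itv_shift//; apply: ge0_ae_eq_integral => //.
- by apply: measurable_funTS; apply: (measurableT_comp mf); exact: measurable_funD.
- exact: measurable_funTS.
- by apply: ae_imp pf => t H _.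
Qed.

(** Half-open periods split into disjoint pieces; the closed [side T] differs from one by a single
    point. *)
Let Phi h := (\int[leb]_(t in `[h, (h + T)%R[) f t)%E.

Let Phi_nat h n : Phi (h + n%:R * T) = Phi h.
Proof.
elim: n => [|n <-]; first by rewrite mul0r addr0.
by rewrite -addn1 natrD mulrDl mul1r addrA /Phi shiftT.
Qed.

(** The period [[r, r + T[] is [[r, T[] followed by the translate by [T] of [[0, r[]. *)
Let Phi_small r : 0 <= r <= T -> Phi r = Phi 0.
Proof.
move=> /andP[r0 rT]; rewrite /Phi (@ge0_integral_itv_split f r T)//; last first.
  by rewrite lerDr.
rewrite -{2}(add0r T) shiftT addeC add0r -ge0_integral_itv_split//.
Qed.

Let Phi_pos h : 0 <= h -> Phi h = Phi 0.
Proof.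
move=> h0; pose n := Num.truncn (h / T).
have /andP[n1 n2] := truncn_itv (divr_ge0 h0 (ltW T0)).
rewrite -(subrK (n%:R * T) h) Phi_nat Phi_small//.
rewrite subr_ge0 -ler_pdivlMr// n1/=.
by move: n2; rewrite ltr_pdivrMr// -natr1 mulrDl mul1r -/n; lra.
Qed.

Let Phi_cst h : Phi h = Phi 0.
Proof.
have [h0|h0] := leP 0 h; first exact: Phi_pos.
pose n := (Num.truncn (- h / T)).+1.
rewrite -(Phi_nat h n) Phi_pos// -lerBlDl sub0r -ler_pdivrMr// ltW//.
have nh0 : 0 <= - h by rewrite oppr_ge0 ltW.
by have /andP[] := truncn_itv (divr_ge0 nh0 (ltW T0)).
Qed.

Lemma ge0_integral_periodic1 h :
  (\int[leb]_(t in side T) f (t + h)%R = \int[leb]_(t in side T) f t)%E.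
Proof.
rewrite /side -integral_itv_bndo_bndc; last first.
  by apply: measurable_funTS; apply: (measurableT_comp mf); exact: measurable_funD.
rewrite -[RHS]integral_itv_bndo_bndc; last exact: measurable_funTS.
rewrite ge0_integral_itv_shift// add0r addrC; have := Phi_cst h.
by rewrite /Phi add0r.
Qed.
End one_dim.

Lemma shift_cons0 n (T : R) t (x : n.-tuple R) :
  shift T ord0 (cons_tuple t x) = cons_tuple (t + T) x.
Proof.
apply: eq_from_tnth => i; rewrite tnth_mktuple.
case: (unliftP ord0 i) => [j ->|->]; rewrite ?tnthS ?tnth0 ?eqxx//.
by rewrite eq_sym (negbTE (neq_lift _ _)) addr0.
Qed.

Lemma shift_consS n (T : R) (i : 'I_n) t (x : n.-tuple R) :
  shift T (lift ord0 i) (cons_tuple t x) = cons_tuple t (shift T i x).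
Proof.
apply: eq_from_tnth => k; rewrite tnth_mktuple.
case: (unliftP ord0 k) => [j ->|->]; rewrite ?tnthS ?tnth0 ?tnth_mktuple.
  by rewrite (inj_eq lift_inj).
by rewrite (negbTE (neq_lift _ _)) addr0.
Qed.

Lemma vadd_cons n t (x : n.-tuple R) h0 h :
  vadd (cons_tuple t x) (cons_tuple h0 h) = cons_tuple (t + h0) (vadd x h).
Proof.
apply: eq_from_tnth => i; rewrite tnth_mktuple.
by case: (unliftP ord0 i) => [j ->|->]; rewrite ?tnthS ?tnth0 ?tnth_mktuple.
Qed.

Lemma measurable_shift n (T : R) (i : 'I_n) : measurable_fun setT (shift T i).
Proof.
apply: measurable_mktuple => j; apply: measurable_funD => //; exact: measurable_tnthR.
Qed.

Lemma measurable_side (T : R) : measurable (side T).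
Proof. exact: measurable_itv. Qed.

Lemma ge0_integral_cube_muS n (A : set R) (f : n.+1.-tuple R -> \bar R) :
  measurable A -> measurable_fun setT f -> (forall x, 0 <= f x)%E ->
  (\int[mu n.+1]_(x in cube n.+1 A) f x =
   \int[leb]_(t in A) \int[mu n]_(x in cube n A) f (cons_tuple t x))%E.
Proof.
move=> mA mf f0; rewrite -iintE//=; apply: eq_integral => t _.
by rewrite iintE//; exact: measurable_slice.
Qed.

(** The codomain is left free to cover real functions as well as the extended real integrands made
    from them. *)
Definition ae_periodic n (T : R) U (f : n.-tuple R -> U) :=
  forall i : 'I_n, {ae mu n, forall x, f (shift T i x) = f x}.

(** Induction on the dimension: the integral [Psi] over the remaining coordinates is almost
    everywhere periodic in the first one, and almost every slice is almost everywhere periodic in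
    the others. *)
Lemma ge0_integral_periodic n (T : R) (f : n.-tuple R -> \bar R) (h : n.-tuple R) :
  0 < T -> measurable_fun setT f -> (forall x, 0 <= f x)%E -> ae_periodic T f ->
  (\int[mu n]_(x in cube n (side T)) f (vadd x h) =
   \int[mu n]_(x in cube n (side T)) f x)%E.
Proof.
move=> T0; elim: n f h => [|n IH] f h mf f0 pf.
  by apply: eq_integral => x _; congr f; rewrite [LHS]tuple0 [RHS]tuple0.
have [h0 [h' ->]] := tuple_ind_cons h.
have mc := measurable_cube (n := n) (measurable_side T).
have ms := measurable_side T.
have mfh : measurable_fun setT (fun x => f (vadd x (cons_tuple h0 h'))).
  by apply: (measurableT_comp mf); exact: measurable_vadd.
rewrite !ge0_integral_cube_muS//.
pose Psi t := (\int[mu n]_(x in cube n (side T)) f (cons_tuple t x))%E.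
have mPsi : measurable_fun setT Psi by exact: measurable_int_slice.
have Psi0 t : (0 <= Psi t)%E by exact: integral_ge0.
rewrite -[RHS](@ge0_integral_periodic1 T Psi T0 mPsi Psi0 _ h0); last first.
  apply: ae_imp (ae_mu_cons (pf ord0)) => t Ht.
  apply: ge0_ae_eq_integral => //.
  - by apply: measurable_funTS; exact: measurable_slice.
  - by apply: measurable_funTS; exact: measurable_slice.
  - by apply: ae_imp Ht => x + _; rewrite shift_cons0.
apply: ge0_ae_eq_integral => //.
- by apply: measurable_funTS; exact: measurable_int_slice mfh _.
- by apply: measurable_funTS; apply: (measurableT_comp mPsi); exact: measurable_funD.
- by move=> t _; exact: integral_ge0.
have pfl (i : 'I_n) : {ae leb, forall t, {ae mu n, forall x,
    f (cons_tuple t (shift T i x)) = f (cons_tuple t x)}}.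
  apply: ae_imp (ae_mu_cons (pf (lift ord0 i))) => t; apply: ae_imp => x.
  by rewrite shift_consS.
have pfA : {ae leb, forall t, forall i : 'I_n, {ae mu n, forall x,
    f (cons_tuple t (shift T i x)) = f (cons_tuple t x)}}.
  exact: ae_fin_forall.
(* The slice in use sits at [t + h0], so the almost everywhere statement has to be translated
   too. *)
apply: ae_imp (ae_shift1 h0 pfA) => t Ht _.
rewrite /Psi -(IH (fun x => f (cons_tuple (t + h0) x)) h')//; last first.
  exact: measurable_slice.
by apply: eq_integral => x _; rewrite vadd_cons.
Qed.

End periodic.

(** * Radial integrals *)

Section euclid.
Context {R : realType}.

Lemma sumsq_ge0 d (x : d.-tuple R) : 0 <= \sum_(i < d) tnth x i ^+ 2.
Proof. by apply: sumr_ge0 => i _; exact: sqr_ge0. Qed.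

Lemma enorm_ge0 d (x : d.-tuple R) : 0 <= enorm x.
Proof. exact: sqrtr_ge0. Qed.

Lemma enorm_sqr d (x : d.-tuple R) : enorm x ^+ 2 = \sum_(i < d) tnth x i ^+ 2.
Proof. by rewrite sqr_sqrtr// sumsq_ge0. Qed.

Lemma enorm0_eq0 d (x : d.-tuple R) : enorm x = 0 -> forall i, tnth x i = 0.
Proof.
move=> x0 i; have := enorm_sqr x; rewrite x0 expr0n/= => /esym H.
have /(_ i isT)/eqP := psumr_eq0P (fun i _ => sqr_ge0 (tnth x i)) H.
by rewrite sqrf_eq0 => /eqP.
Qed.

Lemma enorm_vscale d (l : R) (x : d.-tuple R) : 0 <= l -> enorm (vscale l x) = l * enorm x.
Proof.
move=> l0; rewrite /enorm -[X in _ = X * _]ger0_norm//.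
rewrite -sqrtr_sqr -sqrtrM ?sqr_ge0// mulr_sumr; congr Num.sqrt.
by apply: eq_bigr => i _; rewrite tnth_mktuple exprMn.
Qed.

Lemma ler_enorm_coord d (x : d.-tuple R) i : `|tnth x i| <= enorm x.
Proof.
rewrite -ler_sqr ?nnegrE ?enorm_ge0// enorm_sqr real_normK ?num_real//.
by rewrite (bigD1 i)//= lerDl; apply: sumr_ge0 => j _; exact: sqr_ge0.
Qed.

(* [(1 + e) A^2 + (1 + 1/e) B^2] equals [(A + B)^2] at [e = B / A]. *)
Lemma ler_enormD d (x y : d.-tuple R) : enorm (vadd x y) <= enorm x + enorm y.
Proof.
have [x0|x0] := eqVneq (enorm x) 0.
  rewrite x0 add0r (_ : vadd x y = y)//.
  by apply: eq_from_tnth => i; rewrite tnth_mktuple (enorm0_eq0 x0) add0r.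
have [y0|y0] := eqVneq (enorm y) 0.
  rewrite y0 addr0 (_ : vadd x y = x)//.
  by apply: eq_from_tnth => i; rewrite tnth_mktuple (enorm0_eq0 y0) addr0.
have xp : 0 < enorm x by rewrite lt_neqAle eq_sym x0 enorm_ge0.
have yp : 0 < enorm y by rewrite lt_neqAle eq_sym y0 enorm_ge0.
rewrite -ler_sqr ?nnegrE ?addr_ge0 ?enorm_ge0// enorm_sqr.
set A := enorm x in xp x0 *; set B := enorm y in yp y0 *.
have -> : (A + B) ^+ 2 = (1 + B / A) * A ^+ 2 + (1 + A / B) * B ^+ 2 by field; rewrite x0 y0.
rewrite {2}/A {3}/B !enorm_sqr !mulr_sumr -big_split/=; apply: ler_sum => i _.
rewrite tnth_mktuple; set a := tnth x i; set b := tnth y i.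
rewrite -subr_ge0.
have -> : (1 + B / A) * a ^+ 2 + (1 + A / B) * b ^+ 2 - (a + b) ^+ 2 =
   (B * a - A * b) ^+ 2 / (A * B) by field; rewrite x0 y0.
by rewrite mulr_ge0 ?sqr_ge0// invr_ge0 mulr_ge0// ltW.
Qed.

Lemma measurable_enorm d : measurable_fun setT (@enorm R d).
Proof.
apply: (@eq_measurable_fun _ _ _ _ _ (fun x : d.-tuple R => (\sum_(i < d) tnth x i ^+ 2) `^ 2^-1)).
  by move=> x _; rewrite /enorm powR12_sqrt// sumsq_ge0.
apply: (measurableT_comp (measurable_powR _)).
apply: measurable_sum => i; apply: measurable_funX; exact: measurable_tnthR.
Qed.

Lemma measurable_vsub d (x : d.-tuple R) : measurable_fun setT (vsub x).
Proof.
apply: measurable_mktuple => i; apply: measurable_funB => //; exact: measurable_tnthR.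
Qed.

Lemma powR_nonpos_le (x y e : R) : e <= 0 -> 0 < x -> x <= y -> y `^ e <= x `^ e.
Proof.
move=> e0 x0 xy; rewrite -(opprK e) 2!(powRN _ (- e)).
have y0 : 0 < y by exact: lt_le_trans xy.
rewrite lef_pV2 ?posrE ?powR_gt0//; apply: ge0_ler_powR; rewrite ?nnegrE ?oppr_ge0// ltW//.
Qed.

End euclid.

Lemma one_powR (R : realType) (e : R) : 1 `^ e = 1. Proof. by rewrite powR1. Qed.

Section shells.
Context {R : realType} (d : nat).
Hypothesis d0 : (0 < d)%N.
Local Notation m := (@mu R d).

Definition annulus (r1 r2 : R) : set (d.-tuple R) := [set x | r1 < enorm x <= r2].
Definition outside (r : R) : set (d.-tuple R) := [set x | r < enorm x].

Lemma measurable_annulus r1 r2 : measurable (annulus r1 r2).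
Proof.
rewrite (_ : annulus r1 r2 = @enorm R d @^-1` `]r1, r2]).
  by rewrite -[X in measurable X]setTI; apply: measurable_enorm.
by apply/seteqP; split => x; rewrite /annulus/= in_itv.
Qed.

Lemma measurable_outside r : measurable (outside r).
Proof.
rewrite (_ : outside r = @enorm R d @^-1` `]r, +oo[).
  by rewrite -[X in measurable X]setTI; apply: measurable_enorm.
by apply/seteqP; split => x; rewrite /outside/= in_itv/= andbT.
Qed.

(** For nonzero [e] the value at the origin is 0, in agreement with the division by zero on the
    diagonal of [Fs]. *)
Definition rk (e : R) (x : d.-tuple R) : \bar R := (enorm x `^ e)%:E.

Lemma measurable_rk e : measurable_fun setT (rk e).
Proof.
apply/measurable_EFinP; apply: (measurableT_comp (measurable_powR _)).
exact: measurable_enorm.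
Qed.

Lemma rk_ge0 e x : (0 <= rk e x)%E.
Proof. by rewrite lee_fin powR_ge0. Qed.

Lemma ge0_integral_vscale_set (l : R) (A : set (d.-tuple R)) (f : d.-tuple R -> \bar R) :
  0 < l -> measurable A -> measurable_fun setT f -> (forall x, 0 <= f x)%E ->
  (\int[m]_(x in A) f x = (l ^+ d)%:E * \int[m]_(x in vscale l @^-1` A) f (vscale l x))%E.
Proof.
move=> l0 mA mf f0; rewrite integral_mkcond (@ge0_integral_vscale R d l)//; last 2 first.
- by apply/(measurable_restrictT _ _).1 => //; exact: measurable_funTS.
- by move=> x; rewrite patchE; case: ifP.
congr (_ * _)%E; rewrite [RHS]integral_mkcond; apply: eq_integral => x _.
by rewrite !patchE; congr (if _ then _ else _); apply/idP/idP; rewrite !inE.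
Qed.

Lemma rk_vscale e (l : R) x : 0 <= l -> rk e (vscale l x) = ((l `^ e)%:E * rk e x)%E.
Proof. by move=> l0; rewrite /rk enorm_vscale// powRM ?enorm_ge0// EFinM. Qed.

(** With the exponent written as [b - d], the Jacobian [l ^+ d] and the homogeneity of the kernel
    combine into [l^b]. *)
Lemma int_rk_scale (l b : R) (A B : set (d.-tuple R)) : 0 < l -> measurable A -> measurable B ->
  vscale l @^-1` A = B ->
  (\int[m]_(x in A) rk (b - d%:R) x = (l `^ b)%:E * \int[m]_(x in B) rk (b - d%:R) x)%E.
Proof.
move=> l0 mA mB AB.
rewrite (ge0_integral_vscale_set l0 mA (measurable_rk _) (rk_ge0 _)) AB.
under eq_integral do rewrite (rk_vscale _ _ (ltW l0)).
rewrite (@ge0_integralZl_EFin _ _ _ m B mB (rk (b - d%:R)) (fun x _ => rk_ge0 _ x) (measurable_funTS (measurable_rk _)) _ (powR_ge0 _ _)).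
rewrite muleA -EFinM; congr (_%:E * _)%E.
rewrite -powR_mulrn ?(ltW l0)// -powRD; first by rewrite addrC subrK.
by apply/implyP => _; rewrite gt_eqF.
Qed.

Definition ball_vol : R := fine (m [set x | enorm x <= 1]).

Lemma measurable_cball r : measurable [set x : d.-tuple R | enorm x <= r].
Proof.
rewrite (_ : [set _ | _] = @enorm R d @^-1` `]-oo, r]).
  by rewrite -[X in measurable X]setTI; apply: measurable_enorm.
by apply/seteqP; split => x; rewrite /= in_itv.
Qed.

Lemma mu_cube_side (a b : R) : a <= b -> m (cube d `[a, b]) = ((b - a) ^+ d)%:E.
Proof.
move=> ab; rewrite mu_cube// lebesgue_measure_itv/= lte_fin.
case: ltgtP ab => // [ab _|-> _]; first by rewrite -EFinB EFin_expe.
by rewrite subrr -EFin_expe.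
Qed.

Lemma cball1_lty : (m [set x : d.-tuple R | (enorm x <= 1)%R] < +oo)%E.
Proof.
apply: (@le_lt_trans _ _ (m (cube d `[-1, 1]))).
  apply: le_measure; rewrite ?inE.
  - exact: measurable_cball.
  - exact: measurable_cube.
  - by move=> x /= x1 i; rewrite /= in_itv/= -ler_norml (le_trans (ler_enorm_coord _ _)).
by rewrite mu_cube_side ?ltry//; lra.
Qed.

Lemma ball_volE : m [set x : d.-tuple R | enorm x <= 1] = ball_vol%:E.
Proof. by rewrite fineK// ge0_fin_numE// cball1_lty. Qed.

Lemma omegaE : omega R d = ball_vol.
Proof.
rewrite /omega iintTE//; last first.
  apply/measurable_EFinP.
  rewrite (_ : (fun x => _) = \1_[set x : d.-tuple R | enorm x <= 1]).
    exact: measurable_indic (measurable_cball _).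
  by apply/funext => x; rewrite indicE; congr (nat_of_bool _)%:R; apply/idP/idP; rewrite inE.
rewrite /ball_vol; congr fine; rewrite [RHS]integral_indicT; last exact: measurable_cball.
apply: eq_integral => x _; rewrite indicE.
by congr (nat_of_bool _)%:R%:E; apply/idP/idP; rewrite inE.
Qed.

Lemma ball_vol_gt0 : 0 < ball_vol.
Proof.
have dR : 0 < d%:R :> R by rewrite ltr0n.
rewrite -lte_fin -ball_volE.
(* On the cube of side [1/d] each squared coordinate is at most [1/d], so this cube lies in the unit
   ball. *)
apply: (@lt_le_trans _ _ (m (cube d `[0, d%:R^-1]))).
  by rewrite mu_cube_side ?invr_ge0 ?ltW// subr0 lte_fin exprn_gt0// invr_gt0.
apply: le_measure; rewrite ?inE.
- exact: measurable_cube.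
- exact: measurable_cball.
- move=> x /= Hx; rewrite -(@ler_sqr R) ?nnegrE ?enorm_ge0// enorm_sqr expr1n.
  apply: (@le_trans _ _ (\sum_(i < d) d%:R^-1)); last first.
    by rewrite sumr_const card_ord -[X in X <= _]mulr_natr mulVf ?gt_eqF.
  apply: ler_sum => i _; have := Hx i; rewrite /= in_itv/= => /andP[x0 x1].
  have d1 : d%:R^-1 <= 1 :> R by rewrite invf_le1// ler1n.
  by rewrite expr2 (le_trans (ler_wpM2l x0 (le_trans x1 d1)))// mulr1.
Qed.

Lemma mu_cball r : 0 < r -> m [set x : d.-tuple R | enorm x <= r] = (r ^+ d * ball_vol)%:E.
Proof.
move=> r0; have mI (A : set (d.-tuple R)) : measurable A -> measurable_fun setT (EFin \o (\1_A : d.-tuple R -> R)).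
  by move=> mA; exact/measurable_EFinP/measurable_indicP.
rewrite integral_indicT; last exact: measurable_cball.
rewrite (@ge0_integral_vscale R d r _ r0 (mI _ (measurable_cball r))); last first.
  by move=> x; rewrite lee_fin.
rewrite EFinM -ball_volE; congr (_ * _)%E.
rewrite [RHS]integral_indicT; last exact: measurable_cball.
apply: eq_integral => x _; rewrite /= !indicE; congr (nat_of_bool _)%:R%:E.
apply/idP/idP; rewrite !inE/= enorm_vscale ?(ltW r0)//.
  by rewrite -{2}[r]mulr1 ler_pM2l.
by rewrite -{2}[r]mulr1 ler_pM2l.
Qed.

Lemma mu_annulus (l : R) : 1 < l -> m (annulus 1 l) = (ball_vol * (l ^+ d - 1))%:E.
Proof.
move=> l1; have l0 : 0 < l by exact: lt_trans l1.
have E : m [set x | enorm x <= l] = (m [set x : d.-tuple R | (enorm x <= 1)%R] + m (annulus 1 l))%E.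
  rewrite -measureU; [|exact: measurable_cball|exact: measurable_annulus|]; last first.
    apply/seteqP; split => x //= -[x1 /andP[]]; by rewrite ltNge x1.
  congr (m _); apply/seteqP; split => x /=.
    by move=> xl; rewrite /annulus/= xl andbT; have [|] := leP (enorm x) 1; [left|right].
  by move=> [x1|/andP[]//]; exact: le_trans (ltW l1).
move: E; rewrite mu_cball// ball_volE => E.
have Afin : m (annulus 1 l) \is a fin_num.
  rewrite ge0_fin_numE//; apply: (@le_lt_trans _ _ (m [set x | enorm x <= l])).
    apply: le_measure; rewrite ?inE; [exact: measurable_annulus|exact: measurable_cball|].
    by move=> x /andP[].
  by rewrite mu_cball// ltry.
move: E; rewrite -(fineK Afin) -EFinD => -[E]; congr _%:E.
by rewrite mulrBr mulr1 [ball_vol * _]mulrC E addrAC subrr add0r.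
Qed.

Lemma annulus_rk_le (e l : R) : e <= 0 -> 1 < l ->
  (\int[m]_(x in annulus 1 l) rk e x <= (ball_vol * (l ^+ d - 1))%:E)%E.
Proof.
move=> e0 l1; rewrite -mu_annulus//.
rewrite -[leRHS]mul1e -integral_cst; last exact: measurable_annulus.
apply: ge0_le_integral => //.
- exact: measurable_annulus.
- by move=> x _; exact: rk_ge0.
- by apply: measurable_funTS; exact: measurable_rk.
- by move=> x /andP[x1 _]; rewrite lee_fin -[leRHS](@one_powR R e) powR_nonpos_le// ltW.
Qed.

Lemma annulus_rk_ge (e l : R) : e <= 0 -> 1 < l ->
  ((l `^ e * (ball_vol * (l ^+ d - 1)))%:E <= \int[m]_(x in annulus 1 l) rk e x)%E.
Proof.
move=> e0 l1; rewrite EFinM -mu_annulus// -integral_cst; last exact: measurable_annulus.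
apply: ge0_le_integral => //.
- exact: measurable_annulus.
- by move=> x _; rewrite lee_fin powR_ge0.
- by apply: measurable_funTS; exact: measurable_rk.
- move=> x /andP[x1 xl]; rewrite lee_fin powR_nonpos_le//.
  by rewrite (lt_trans _ x1).
Qed.

End shells.
Arguments annulus {R} d.
Arguments outside {R} d.
Arguments rk {R} d.
Arguments ball_vol {R} d.

Section radial.
Context {R : realType} (d : nat).
Hypothesis d0 : (0 < d)%N.
Local Notation m := (@mu R d).
Local Notation annulus := (@annulus R d).
Local Notation outside := (@outside R d).
Local Notation rk := (@rk R d).

Lemma annulus_split (f : d.-tuple R -> \bar R) r1 r2 r3 : measurable_fun setT f ->
  (forall x, 0 <= f x)%E -> r1 <= r2 -> r2 <= r3 ->
  (\int[m]_(x in annulus r1 r3) f x =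
   \int[m]_(x in annulus r1 r2) f x + \int[m]_(x in annulus r2 r3) f x)%E.
Proof.
move=> mf f0 r12 r23.
have -> : annulus r1 r3 = annulus r1 r2 `|` annulus r2 r3.
  apply/seteqP; split => x.
    move=> /andP[x1 x3]; have [x2|x2] := leP (enorm x) r2.
      by left; rewrite /annulus/= x1.
    by right; rewrite /annulus/= x2.
  move=> [/andP[x1 x2]|/andP[x2 x3]]; rewrite /annulus/=.
    by rewrite x1 (le_trans x2).
  by rewrite x3 (le_lt_trans r12).
rewrite ge0_integral_setU//.
- exact: measurable_annulus.
- exact: measurable_annulus.
- exact: measurable_funTS.
- rewrite disj_set2E; apply/eqP/seteqP; split => x //= -[/andP[_ x2] /andP[]].
  by rewrite ltNge x2.
Qed.

Lemma outside_split (f : d.-tuple R -> \bar R) r1 r2 : measurable_fun setT f ->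
  (forall x, 0 <= f x)%E -> r1 <= r2 ->
  (\int[m]_(x in outside r1) f x =
   \int[m]_(x in annulus r1 r2) f x + \int[m]_(x in outside r2) f x)%E.
Proof.
move=> mf f0 r12.
have -> : outside r1 = annulus r1 r2 `|` outside r2.
  apply/seteqP; split => x.
    rewrite /outside/= => x1; have [x2|x2] := leP (enorm x) r2; last by right.
    by left; rewrite /annulus/= x1.
  move=> [/andP[x1 x2]//|]; rewrite /outside/=.
  exact: le_lt_trans.
rewrite ge0_integral_setU//.
- exact: measurable_annulus.
- exact: measurable_outside.
- exact: measurable_funTS.
- rewrite disj_set2E; apply/eqP/seteqP; split => x //= -[/andP[_ x2]].
  by rewrite /outside/= ltNge x2.
Qed.

Lemma vscale_annulus (l r1 r2 : R) : 0 < l ->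
  vscale l @^-1` annulus (l * r1) (l * r2) = annulus r1 r2.
Proof.
move=> l0; apply/seteqP; split => x; rewrite /annulus/= enorm_vscale ?(ltW l0)//;
by rewrite ltr_pM2l// ler_pM2l.
Qed.

Lemma vscale_outside (l r : R) : 0 < l -> vscale l @^-1` outside (l * r) = outside r.
Proof.
move=> l0; apply/seteqP; split => x; rewrite /outside/= enorm_vscale ?(ltW l0)//;
by rewrite ltr_pM2l.
Qed.

(** The bound [c / (1 - t)] is the fixed point of the affine map in the recursion, hence is
    preserved by it. *)
Lemma geometric_bound (x : nat -> \bar R) (c t : R) : 0 <= t < 1 ->
  (x 0%N <= (c / (1 - t))%:E)%E -> (forall n, x n.+1 <= c%:E + t%:E * x n)%E ->
  forall n, (x n <= (c / (1 - t))%:E)%E.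
Proof.
move=> /andP[t0 t1] x0 xS; elim=> // n IH; apply: (le_trans (xS n)).
apply: (@le_trans _ _ (c%:E + t%:E * (c / (1 - t))%:E)%E).
  by rewrite leeD2l// lee_wpmul2l.
rewrite -EFinM -EFinD lee_fin; rewrite le_eqVlt; apply/orP; left; apply/eqP.
have : 1 - t != 0 by rewrite subr_eq0 eq_sym lt_eqF.
by move=> ?; field.
Qed.

Lemma increasing_integral_le (F : nat -> set (d.-tuple R)) (f : d.-tuple R -> \bar R) (c : \bar R) :
  {homo F : n k / (n <= k)%N >-> n `<=` k} -> (forall n, measurable (F n)) ->
  measurable_fun setT f -> (forall x, 0 <= f x)%E ->
  (forall n, \int[m]_(x in F n) f x <= c)%E ->
  (\int[m]_(x in \bigcup_n F n) f x <= c)%E.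
Proof.
move=> ndF mF mf f0 bd.
have H : {homo F : n k / (n <= k)%N >-> (n <= k)%O} by move=> n k nk; exact/subsetPset/ndF.
have cv := @ge0_nondecreasing_set_cvg_integral _ _ _ F f m H mF
  (fun i => measurable_funTS mf) (fun i x _ => f0 x).
rewrite -(cvg_lim _ cv)//; apply: lime_le; first by apply/cvg_ex; eexists; exact: cv.
by apply: nearW => n; exact: bd.
Qed.

Lemma le_2expn (x : R) : exists n, x <= 2 ^+ n.
Proof.
exists (Num.truncn `|x|).+1; apply: (le_trans (ler_norm x)).
have /andP[_ /ltW H] := truncn_itv (normr_ge0 x); apply: (le_trans H).
by rewrite -natrX ler_nat ltnW// ltn_expl.
Qed.

Lemma powR2_gt1 (a : R) : 0 < a -> 1 < 2 `^ a.
Proof. by move=> a0; rewrite -[ltLHS](@one_powR R a) gt0_ltr_powR ?nnegrE// ltr1n. Qed.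

Section far.
Variable a : R.
Hypothesis a0 : 0 < a.
Let e := - a - d%:R.
Let e0 : e <= 0. Proof. by rewrite /e; have : 0 <= d%:R :> R by []; move: a0; lra. Qed.

(** Finiteness must be known before [far_integral] can solve an equation for this integral. Cutting
    the annulus of outer radius [2^(n+1)] at radius 2 and rescaling the outer piece gives a
    recursion with ratio [2^(-a) < 1]. *)
Lemma far_lty : (\int[m]_(x in outside 1) rk e x < +oo)%E.
Proof.
pose c := ball_vol d * (2 ^+ d - 1) : R.
have t01 : 0 <= (2 `^ (- a) : R) < 1.
  by rewrite powR_ge0/= powRN invf_lt1 ?powR_gt0// powR2_gt1.
apply: (@le_lt_trans _ _ (c / (1 - 2 `^ (-a)))%:E); last exact: ltry.
rewrite (_ : outside 1 = \bigcup_n annulus 1 (2 ^+ n)); last first.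
  apply/seteqP; split => x; last by move=> [n _ /andP[]].
  rewrite /outside/= => x1; have [n xn] := le_2expn (enorm x).
  by exists n => //; rewrite /annulus/= x1.
apply: increasing_integral_le.
- move=> n k nk x /andP[x1 x2]; rewrite /annulus/= x1 (le_trans x2)//.
  by rewrite ler_weXn2l ?ler1n.
- by move=> n; exact: measurable_annulus.
- exact: measurable_rk.
- exact: rk_ge0.
apply: geometric_bound => //.
  rewrite expr0 (_ : annulus 1 1 = set0) ?integral_set0.
    rewrite lee_fin divr_ge0//.
      by rewrite mulr_ge0 ?(ltW (ball_vol_gt0 d0))// subr_ge0 exprn_ege1// ler1n.
    by rewrite subr_ge0; case/andP: t01 => _ /ltW.
  by apply/seteqP; split => x // /andP[x1]; rewrite leNgt x1.
move=> n; rewrite (@annulus_split _ 1 2); last 4 first.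
- exact: measurable_rk.
- exact: rk_ge0.
- by rewrite ler1n.
- by rewrite exprS -{1}[2]mulr1 ler_pM2l// exprn_ege1// ler1n.
apply: leeD; first by apply: annulus_rk_le => //; rewrite ltr1n.
rewrite (@int_rk_scale R d 2 (- a) _ (annulus 1 (2 ^+ n)))//.
- exact: measurable_annulus.
- exact: measurable_annulus.
- by have := vscale_annulus 1 (2 ^+ n) (ltr0n R 2); rewrite mulr1 exprS; apply.
Qed.

Lemma one_minus_lim (x y c : R) : 0 <= x -> 0 < c ->
  (forall t, 0 < t -> x * (1 - c * t) <= y) -> x <= y.
Proof.
move=> x0 c0 H; rewrite leNgt; apply/negP => yx.
have [xz|xz] := eqVneq x 0.
  by have := H 1 ltr01; rewrite xz mul0r leNgt -{1}xz yx.
have xp : 0 < x by rewrite lt_neqAle eq_sym xz.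
(* At this [t] the left side of the hypothesis is the midpoint of [x] and [y], which exceeds [y]. *)
have tp : 0 < (x - y) / (2 * x * c) by rewrite divr_gt0 ?subr_gt0// !mulr_gt0.
have := H _ tp.
have -> : x * (1 - c * ((x - y) / (2 * x * c))) = (x + y) / 2 by field; rewrite xz gt_eqF.
by move: yx; lra.
Qed.

(* Splitting [|x| > 1] at radius [exp t] gives [F (1 - exp (- a t)) = S] with the integral [S]
   over the annulus pinched between two multiples of [exp (d t) - 1]; then let [t] tend to [0]. *)
Lemma far_integral : (\int[m]_(x in outside 1) rk e x = (d%:R * ball_vol d / a)%:E)%E.
Proof.
have w0 := ball_vol_gt0 (R := R) d0.
have dR : 0 < d%:R :> R by rewrite ltr0n.
have Ffin : (\int[m]_(x in outside 1) rk e x)%E \is a fin_num.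
  by rewrite ge0_fin_numE ?far_lty//; apply: integral_ge0 => x _; exact: rk_ge0.
rewrite -(fineK Ffin); set F := fine _; congr (_%:E).
have F0 : 0 <= F by rewrite fine_ge0//; apply: integral_ge0 => x _; exact: rk_ge0.
have key t : 0 < t -> expR (t * e) * (ball_vol d * (expR (d%:R * t) - 1)) <= F * (1 - expR (- (a * t)))
     <= ball_vol d * (expR (d%:R * t) - 1).
  move=> t0; pose l := expR t.
  have l1 : 1 < l by rewrite expR_gt1.
  have lp : 0 < l by exact: expR_gt0.
  have ld : l ^+ d = expR (d%:R * t) by rewrite /l -expRM_natl mulr_natl.
  have E : F%:E = (\int[m]_(x in annulus 1 l) rk e x + (expR (- (a * t)))%:E * F%:E)%E.
    rewrite fineK// {1}(@outside_split _ 1 l); last 3 first.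
    - exact: measurable_rk.
    - exact: rk_ge0.
    - exact: ltW.
    congr (_ + _)%E; rewrite (@int_rk_scale R d l (- a) _ (outside 1))//.
    - by rewrite /l -expRM; congr ((expR _)%:E * _)%E; ring.
    - exact: measurable_outside.
    - exact: measurable_outside.
    - by have := vscale_outside 1 lp; rewrite mulr1.
  have Sl := annulus_rk_le d e0 l1; have Sg := annulus_rk_ge d e0 l1.
  have Sfin : (\int[m]_(x in annulus 1 l) rk e x)%E \is a fin_num.
    rewrite ge0_fin_numE ?(le_lt_trans Sl) ?ltry//.
    by apply: integral_ge0 => x _; exact: rk_ge0.
  move: E Sl Sg; rewrite -(fineK Sfin); set S := fine _.
  rewrite -EFinM -EFinD !lee_fin ld => -[E] Sl Sg.
  have -> : F * (1 - expR (- (a * t))) = S by rewrite mulrBr mulr1 {1}E; ring.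
  by rewrite Sl andbT (le_trans _ Sg)// /l -expRM.
have c0 : 0 < a + d%:R by rewrite addr_gt0.
apply/eqP; rewrite eq_le ler_pdivlMr// ler_pdivrMr//; apply/andP; split.
- apply: (one_minus_lim (c := a + d%:R)) => //; first by rewrite mulr_ge0// ltW.
  move=> t t0; have /andP[_ K] := key t t0.
  (* This estimate and the next are [1 + x <= exp x] multiplied by an exponential. *)
  have K1 : F * (a * t) * expR (- (a * t)) <= F * (1 - expR (- (a * t))).
    rewrite -mulrA ler_wpM2l// -ler_pdivlMr ?expR_gt0// -expRN opprK mulrBl mul1r -expRD.
    by rewrite addNr expR0 lerBrDr addrC expR_ge1Dx.
  have K2 : ball_vol d * (expR (d%:R * t) - 1) <= ball_vol d * (d%:R * t) * expR (d%:R * t).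
    rewrite -mulrA ler_wpM2l ?(ltW w0)// -ler_pdivrMr ?expR_gt0// -expRN mulrBl mul1r -expRD.
    by rewrite subrr expR0 lerBlDr -lerBlDl (le_trans _ (expR_ge1Dx _)).
  have K3 := le_trans K1 (le_trans K K2).
  have K4 : F * a * expR (- ((a + d%:R) * t)) <= d%:R * ball_vol d.
    have -> : - ((a + d%:R) * t) = - (a * t) - d%:R * t by ring.
    rewrite expRD mulrA [expR (- (d%:R * t))]expRN ler_pdivrMr ?expR_gt0// -(ler_pM2r t0).
    have -> : F * a * expR (- (a * t)) * t = F * (a * t) * expR (- (a * t)) by ring.
    by apply: (le_trans K3); rewrite le_eqVlt; apply/orP; left; apply/eqP; ring.
  apply: (le_trans _ K4); rewrite ler_wpM2l ?mulr_ge0 ?(ltW a0)//.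
  by have := expR_ge1Dx (- ((a + d%:R) * t)).
- apply: (one_minus_lim (c := a + d%:R)) => //; first by rewrite mulr_ge0// ltW.
  move=> t t0; have /andP[K _] := key t t0.
  rewrite -(ler_pM2r t0).
  apply: (@le_trans _ _ (F * (1 - expR (- (a * t))))); last first.
    rewrite -mulrA ler_wpM2l// lerBlDr -lerBlDl (le_trans _ (expR_ge1Dx _))//.
  apply: (le_trans _ K).
  apply: (@le_trans _ _ (expR (t * e) * (ball_vol d * (d%:R * t)))).
    have H1 := expR_ge1Dx (t * e).
    have -> : d%:R * ball_vol d * (1 - (a + d%:R) * t) * t = (1 + t * e) * (ball_vol d * (d%:R * t)).
      by rewrite /e; ring.
    by rewrite ler_wpM2r// !mulr_ge0// ltW.
  rewrite ler_wpM2l ?expR_ge0// ler_wpM2l ?(ltW w0)// lerBrDr addrC.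
  exact: expR_ge1Dx.
Qed.

Lemma far_integral_scaled r : 0 < r ->
  (\int[m]_(x in outside r) rk e x = (r `^ (- a) * (d%:R * ball_vol d / a))%:E)%E.
Proof.
move=> r0; rewrite (@int_rk_scale R d r (- a) _ (outside 1))//.
- by rewrite far_integral EFinM.
- exact: measurable_outside.
- exact: measurable_outside.
- by have := vscale_outside 1 r0; rewrite mulr1.
Qed.

End far.

Section near.
Variable a : R.
Hypotheses (a0 : 0 < a) (ad : a <= d%:R).
Let e := a - d%:R.
Let e0 : e <= 0. Proof. by rewrite subr_le0. Qed.

(** Mirror image of [far_lty]: the annulus is cut at radius [1/2] and its inner piece is rescaled,
    with ratio [(1/2)^a < 1]. Used at [a = 1/2], it dominates the near kernels for all small [s]
    simultaneously. *)
Lemma near_lty r : 0 < r -> (\int[m]_(x in annulus 0 r) rk e x < +oo)%E.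
Proof.
move=> r0; rewrite (@int_rk_scale R d r a _ (annulus 0 1))//; last 3 first.
- exact: measurable_annulus.
- exact: measurable_annulus.
- by have := vscale_annulus 0 1 r0; rewrite mulr0 mulr1.
apply: lte_mul_pinfty => //; first by rewrite lee_fin powR_ge0.
pose h : R := 2^-1.
have h0 : 0 < h by rewrite invr_gt0.
have hS n : h ^+ n.+1 = h * h ^+ n by rewrite exprS.
pose c := h `^ a * (ball_vol d * (2 ^+ d - 1)) : R.
have t01 : 0 <= (h `^ a : R) < 1.
  by rewrite powR_ge0/= -[ltRHS](@one_powR R a) gt0_ltr_powR ?nnegrE ?ltW// invf_lt1// ltr1n.
apply: (@le_lt_trans _ _ (c / (1 - h `^ a))%:E); last exact: ltry.
rewrite (_ : annulus 0 1 = \bigcup_n annulus (h ^+ n) 1); last first.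
  apply/seteqP; split => x.
    move=> /andP[x0 x1]; have [n xn] := le_2expn (enorm x)^-1.
    exists n.+1 => //; rewrite /annulus/= x1 andbT exprVn invf_plt ?posrE ?exprn_gt0//.
    by rewrite (le_lt_trans xn)// exprS ltr_pMl ?exprn_gt0// ltr1n.
  by move=> [n _ /andP[x1 x2]]; rewrite /annulus/= x2 andbT (lt_trans _ x1)// exprn_gt0.
apply: increasing_integral_le.
- move=> n k nk x /andP[x1 x2]; rewrite /annulus/= x2 andbT (le_lt_trans _ x1)//.
  by rewrite /h !exprVn lef_pV2 ?posrE ?exprn_gt0// ler_weXn2l ?ler1n.
- by move=> n; exact: measurable_annulus.
- exact: measurable_rk.
- exact: rk_ge0.
apply: geometric_bound => //.
  rewrite expr0 (_ : annulus 1 1 = set0) ?integral_set0.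
    rewrite lee_fin divr_ge0//.
      rewrite mulr_ge0 ?powR_ge0//.
      by rewrite mulr_ge0 ?(ltW (ball_vol_gt0 d0))// subr_ge0 exprn_ege1// ler1n.
    by rewrite subr_ge0; case/andP: t01 => _ /ltW.
  by apply/seteqP; split => x // /andP[x1]; rewrite leNgt x1.
move=> n; rewrite (@annulus_split _ _ h); last 4 first.
- exact: measurable_rk.
- exact: rk_ge0.
- by rewrite hS ler_piMr ?(ltW h0)// exprn_ile1 ?(ltW h0)// /h invf_le1// ler1n.
- by rewrite ltW// invf_lt1// ltr1n.
rewrite addeC; apply: leeD.
  rewrite (@int_rk_scale R d h a _ (annulus 1 2))//; last 3 first.
  - exact: measurable_annulus.
  - exact: measurable_annulus.
  - by have := vscale_annulus 1 2 h0; rewrite mulr1 mulVf.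
  rewrite EFinM lee_pmul2l//; last by rewrite lte_fin powR_gt0.
  by apply: annulus_rk_le => //; rewrite ltr1n.
rewrite (@int_rk_scale R d h a _ (annulus (h ^+ n) 1))//.
- exact: measurable_annulus.
- exact: measurable_annulus.
- by have := vscale_annulus (h ^+ n) 1 h0; rewrite mulr1 exprS.
Qed.
End near.

End radial.

(** * Comparison of the energies *)

Section averaging.
Context {R : realType}.

Lemma tonelli_set d1 d2 (X : measurableType d1) (Y : measurableType d2)
    (m1 : {sigma_finite_measure set X -> \bar R}) (m2 : {sigma_finite_measure set Y -> \bar R})
    (A : set X) (g : X * Y -> \bar R) :
  measurable A -> measurable_fun setT g -> (forall z, 0 <= g z)%E ->
  (\int[m1]_(x in A) \int[m2]_y g (x, y) = \int[m2]_y \int[m1]_(x in A) g (x, y))%E.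
Proof.
move=> mA mg g0.
pose h := g \_ (A `*` [set: Y]).
have mh : measurable_fun setT h.
  apply/(measurable_restrictT _ _).1; first exact: measurableX.
  exact: measurable_funTS.
have h0 z : (0 <= h z)%E by rewrite /h patchE; case: ifP.
have hE x y : h (x, y) = if x \in A then g (x, y) else 0%E.
  by rewrite /h patchE in_setX/= in_setT andbT.
rewrite integral_mkcond; transitivity (\int[m1]_x \int[m2]_y h (x, y))%E.
  apply: eq_integral => x _; rewrite patchE.
  case: ifPn => xA; first by apply: eq_integral => y _; rewrite hE xA.
  by rewrite (eq_integral (fun=> 0%E)) ?integral0// => y _; rewrite hE (negbTE xA).
rewrite fubini_tonelli//; apply: eq_integral => y _.
rewrite [RHS]integral_mkcond; apply: eq_integral => x _; rewrite patchE hE.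
by case: ifP.
Qed.

Context (d : nat).
Local Notation m := (@mu R d).

Lemma measurable_vaddf d1 (X : measurableType d1) (f g : X -> d.-tuple R) :
  measurable_fun setT f -> measurable_fun setT g -> measurable_fun setT (fun x => vadd (f x) (g x)).
Proof.
move=> mf mg; apply: measurable_mktuple => i; apply: measurable_funD.
- by apply: (measurableT_comp (measurable_tnthR i)).
- by apply: (measurableT_comp (measurable_tnthR i)).
Qed.

Lemma measurable_vsubf d1 (X : measurableType d1) (f g : X -> d.-tuple R) :
  measurable_fun setT f -> measurable_fun setT g -> measurable_fun setT (fun x => vsub (f x) (g x)).
Proof.
move=> mf mg; apply: measurable_mktuple => i; apply: measurable_funB.
- by apply: (measurableT_comp (measurable_tnthR i)).
- by apply: (measurableT_comp (measurable_tnthR i)).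
Qed.

Section avg.
Variables (T : R).
Hypothesis T0 : 0 < T.
Local Notation Q := (cube d (side T)).

Let mQ : measurable Q. Proof. exact: measurable_cube (measurable_side T). Qed.

(** Substitute [z = y - c - w]. After Tonelli, each [z] carries the integral of [f] over the
    translate of [Q] by [z + c], which by periodicity is the integral over [Q]. *)
Lemma averaging (k f : d.-tuple R -> \bar R) (c : d.-tuple R) :
  measurable_fun setT k -> (forall x, 0 <= k x)%E ->
  measurable_fun setT f -> (forall x, 0 <= f x)%E -> ae_periodic T f ->
  (\int[m]_(w in Q) \int[m]_y (f y * k (vsub (vsub y c) w)) =
   \int[m]_z k z * \int[m]_(x in Q) f x)%E.
Proof.
move=> mk k0 mf f0 pf.
have mfk (w : d.-tuple R) : measurable_fun setT (fun y => f y * k (vsub (vsub y c) w))%E.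
  apply: emeasurable_funM => //; apply: (measurableT_comp mk).
  by apply: measurable_vsubf => //; apply: measurable_vsubf.
transitivity (\int[m]_(w in Q) \int[m]_z (f (vadd z (vadd c w)) * k z))%E.
  apply: eq_integral => w _; rewrite -(@ge0_integral_vadd R d (vadd c w)) //.
    apply: eq_integral => z _; congr (_ * k _)%E.
    by apply: eq_from_tnth => i; rewrite !tnth_mktuple; ring.
  by move=> y; exact: mule_ge0.
rewrite (@tonelli_set _ _ _ _ m m Q (fun p : d.-tuple R * d.-tuple R => f (vadd p.2 (vadd c p.1)) * k p.2)%E)//=; last 2 first.
- apply: emeasurable_funM.
    apply: (measurableT_comp mf); apply: measurable_vaddf => //.
    by apply: measurable_vaddf.
  exact: (measurableT_comp mk).
- by move=> z; exact: mule_ge0.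
transitivity (\int[m]_z (k z * \int[m]_(x in Q) f x))%E.
  apply: eq_integral => z _.
  under eq_integral do rewrite muleC.
  rewrite ge0_integralZl//.
    congr (_ * _)%E; rewrite -[RHS](@ge0_integral_periodic R d T f (vadd z c))//.
    apply: eq_integral => w _; congr f.
    by apply: eq_from_tnth => i; rewrite !tnth_mktuple; ring.
  apply: measurable_funTS; apply: (measurableT_comp mf).
  by apply: measurable_vaddf => //; apply: measurable_vaddf.
under eq_integral do rewrite muleC.
by rewrite ge0_integralZl// 1?muleC// integral_ge0.
Qed.

Definition diam := Num.sqrt (d%:R * T ^+ 2).

Lemma diam_ge0 : 0 <= diam. Proof. exact: sqrtr_ge0. Qed.

Lemma enorm_cube w : Q w -> enorm w <= diam.
Proof.
move=> Qw; rewrite /enorm /diam ler_wsqrtr//.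
apply: (@le_trans _ _ (\sum_(i < d) T ^+ 2)); last by rewrite sumr_const card_ord mulr_natl.
apply: ler_sum => i _; have := Qw i; rewrite /side/= in_itv/= => /andP[w0 wT].
by rewrite ler_sqr ?nnegrE// ltW.
Qed.

Lemma enorm_vsubC (x y : d.-tuple R) : enorm (vsub x y) = enorm (vsub y x).
Proof.
by rewrite /enorm; congr Num.sqrt; apply: eq_bigr => i _; rewrite !tnth_mktuple -sqrrN opprB.
Qed.

Lemma ler_enormB (x y : d.-tuple R) : enorm (vsub x y) <= enorm x + enorm y.
Proof.
have -> : vsub x y = vadd x [tuple - tnth y i | i < d].
  by apply: eq_from_tnth => i; rewrite !tnth_mktuple.
have -> : enorm y = enorm [tuple - tnth y i | i < d].
  by rewrite /enorm; congr Num.sqrt; apply: eq_bigr => i _; rewrite !tnth_mktuple sqrrN.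
exact: ler_enormD.
Qed.

Lemma enorm_shiftl z w : Q w -> enorm (vsub z w) <= enorm z + diam.
Proof. by move=> /enorm_cube H; apply: (le_trans (ler_enormB _ _)); rewrite lerD2l. Qed.

Lemma enorm_shiftr z w : Q w -> enorm z <= enorm (vsub z w) + diam.
Proof.
move=> /enorm_cube H; have {1}-> : z = vadd (vsub z w) w.
  by apply: eq_from_tnth => i; rewrite !tnth_mktuple subrK.
by apply: (le_trans (ler_enormD _ _)); rewrite lerD2l.
Qed.

Lemma mu_Q : m Q = (T ^+ d)%:E.
Proof. by rewrite mu_cube_side ?ltW// subr0. Qed.

Section far_bounds.
Variables (a r : R) (f : d.-tuple R -> \bar R) (x : d.-tuple R).
Hypotheses (d0 : (0 < d)%N) (a0 : 0 < a) (rD : diam < r).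
Hypotheses (mf : measurable_fun setT f) (f0 : forall x, (0 <= f x)%E) (pf : ae_periodic T f).
Local Notation e := (- a - d%:R).

Let r0 : 0 < r. Proof. exact: le_lt_trans diam_ge0 rD. Qed.
Let e0 : e <= 0. Proof. by have : 0 <= d%:R :> R by []; move: a0; lra. Qed.

(** The kernel without its singular part; [C] absorbs the error made when the argument is displaced
    by a point of [Q]. *)
Let kap (C : R) : d.-tuple R -> \bar R := (fun h => C%:E * rk d e h)%E \_ (outside d r).

Let mkap C : measurable_fun setT (kap C).
Proof.
apply/(measurable_restrictT _ _).1; first exact: measurable_outside.
by apply: measurable_funTS; apply: emeasurable_funM => //; exact: measurable_rk.
Qed.

Let kap_ge0 C h : 0 <= C -> (0 <= kap C h)%E.
Proof. by move=> C0; rewrite /kap patchE; case: ifP => // _; rewrite mule_ge0// rk_ge0. Qed.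

Let int_kap C : 0 <= C -> (\int[m]_z kap C z = (C * (r `^ (- a) * (d%:R * ball_vol d / a)))%:E)%E.
Proof.
move=> C0; rewrite /kap -integral_mkcond ge0_integralZl_EFin//.
- by rewrite far_integral_scaled.
- exact: measurable_outside.
- by move=> z _; exact: rk_ge0.
- by apply: measurable_funTS; exact: measurable_rk.
Qed.

Let mrkx (h : d.-tuple R -> \bar R) : measurable_fun setT h ->
  measurable_fun setT (fun y => f y * h (vsub x y))%E.
Proof.
move=> mh; apply: emeasurable_funM => //; apply: (measurableT_comp mh); exact: measurable_vsub.
Qed.

Let int_cstQ (c : \bar R) : (\int[m]_(w in Q) c = (T ^+ d)%:E * c)%E.
Proof.
transitivity (c * m Q)%E; first exact: integral_cst.
by rewrite mu_Q muleC.
Qed.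

(** If [h = y - x - w] with [w] in [Q] and [|h| > r], then [|y - x| <= |h| + diam <= (1 + diam / r)
    |h|]. The exponent being negative, the truncated kernel at [h] times [C] is below the full
    kernel at [x - y]; averaging over [w] concludes. *)
Lemma far_lower :
  (((1 + diam / r) `^ e * (r `^ (- a) * (d%:R * ball_vol d / a)))%:E * \int[m]_(y in Q) f y
   <= (T ^+ d)%:E * \int[m]_y (f y * rk d e (vsub x y)))%E.
Proof.
set C := (1 + diam / r) `^ e; have C0 : 0 <= C by exact: powR_ge0.
rewrite -(int_kap C0) -(averaging x (mkap C) (fun h => kap_ge0 h C0) mf f0 pf) -int_cstQ.
have mk2 : measurable_fun setT (fun p : d.-tuple R * d.-tuple R => f p.2 * kap C (vsub (vsub p.2 x) p.1))%E.
  apply: emeasurable_funM; first exact: (measurableT_comp mf).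
  apply: (measurableT_comp (mkap C)); apply: measurable_vsubf => //.
  exact: measurable_vsubf.
apply: ge0_le_integral => //.
- by move=> w _; apply: integral_ge0 => y _; rewrite mule_ge0// kap_ge0.
- apply: measurable_funTS.
  apply: (measurable_fun_fubini_tonelli_F (m2 := m) _ mk2) => z.
  by rewrite mule_ge0// kap_ge0.
move=> w Qw; apply: ge0_le_integral => //.
- by move=> y _; rewrite mule_ge0// kap_ge0.
- apply: emeasurable_funM => //; apply: (measurableT_comp (mkap C)).
  by apply: measurable_vsubf => //; exact: measurable_vsubf.
- by apply: mrkx; exact: measurable_rk.
move=> y _; apply: lee_wpmul2l => //; rewrite /kap patchE.
case: ifPn => [/set_mem hr|_]; last exact: rk_ge0.
have H1 := enorm_shiftr (vsub y x) Qw; have H2 := enorm_shiftl (vsub y x) Qw.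
rewrite -EFinM lee_fin (enorm_vsubC x y); set h := enorm (vsub _ w) in hr H1 H2 *.
have hr' : r < h by exact: hr.
have h0 : 0 < h by exact: lt_trans hr'.
have C1 : 0 <= 1 + diam / r by rewrite addr_ge0// divr_ge0 ?diam_ge0// ltW.
rewrite /C -powRM ?(ltW h0)//.
apply: powR_nonpos_le => //; first by move: H2 hr' rD; lra.
apply: (le_trans H1); rewrite mulrDl mul1r lerD2l mulrAC ler_pdivlMr//.
by rewrite ler_wpM2l ?diam_ge0// ltW.
Qed.

(** The cutoff at [r + diam] ensures that every displaced point [h = y - x - w] still satisfies
    [|h| > r], whence [|y - x| >= |h| - diam >= (1 - diam / r) |h|]. *)
Lemma far_upper :
  ((T ^+ d)%:E * \int[m]_y (f y * (rk d e \_ (outside d (r + diam))) (vsub x y))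
  <= ((1 - diam / r) `^ e * (r `^ (- a) * (d%:R * ball_vol d / a)))%:E * \int[m]_(y in Q) f y)%E.
Proof.
set C := (1 - diam / r) `^ e; have C0 : 0 <= C by exact: powR_ge0.
rewrite -(int_kap C0) -(averaging x (mkap C) (fun h => kap_ge0 h C0) mf f0 pf) -int_cstQ.
have mk2 : measurable_fun setT (fun p : d.-tuple R * d.-tuple R => f p.2 * kap C (vsub (vsub p.2 x) p.1))%E.
  apply: emeasurable_funM; first exact: (measurableT_comp mf).
  apply: (measurableT_comp (mkap C)); apply: measurable_vsubf => //.
  exact: measurable_vsubf.
have mrk : measurable_fun setT (rk d e \_ (outside d (r + diam))).
  apply/(measurable_restrictT _ _).1; first exact: measurable_outside.
  by apply: measurable_funTS; exact: measurable_rk.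
have rk0 z : (0 <= (rk d e \_ (outside d (r + diam))) z)%E.
  by rewrite patchE; case: ifP => // _; exact: rk_ge0.
apply: ge0_le_integral => //.
- by move=> w _; apply: integral_ge0 => y _; rewrite mule_ge0.
- apply: measurable_funTS.
  apply: (measurable_fun_fubini_tonelli_F (m2 := m) _ mk2) => z.
  by rewrite mule_ge0// kap_ge0.
move=> w Qw; apply: ge0_le_integral => //.
- by move=> y _; rewrite mule_ge0.
- exact: mrkx.
- apply: emeasurable_funM => //; apply: (measurableT_comp (mkap C)).
  by apply: measurable_vsubf => //; exact: measurable_vsubf.
move=> y _; apply: lee_wpmul2l => //; rewrite patchE.
case: ifPn => [/set_mem hr|_]; last by rewrite kap_ge0.
have H1 := enorm_shiftr (vsub y x) Qw; have H2 := enorm_shiftl (vsub y x) Qw.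
have hr1 : r + diam < enorm (vsub y x) by rewrite enorm_vsubC; exact: hr.
have hr' : r < enorm (vsub (vsub y x) w) by move: H1 hr1; lra.
rewrite /kap patchE mem_set// -EFinM lee_fin (enorm_vsubC x y); set h := enorm (vsub _ w) in hr' H1 H2 *.
have h0 : 0 < h by exact: lt_trans hr'.
have C1 : 0 < 1 - diam / r by rewrite subr_gt0 ltr_pdivrMr// mul1r.
rewrite /C -powRM ?(ltW C1) ?(ltW h0)//; apply: powR_nonpos_le => //; first by rewrite mulr_gt0.
have H3 : diam <= diam / r * h.
  by rewrite mulrAC ler_pdivlMr// ler_wpM2l ?diam_ge0// ltW.
by rewrite mulrBl mul1r; move: H2; lra.
Qed.

End far_bounds.
End avg.
End averaging.

(** * Two-sided bounds of [s Fs] by [F0] *)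

Section energies.
Context {R : realType} (d : nat) (T : R).
Hypothesis T0 : 0 < T.
Local Notation m := (@mu R d).
Local Notation Q := (cube d (side T)).

Lemma measurable_Q : measurable Q. Proof. exact: measurable_cube (measurable_side T). Qed.
Let mQ := measurable_Q.

Lemma ae_periodicP (u : d.-tuple R -> R) : measurable_fun setT u ->
  (forall i : 'I_d, iint setT (fun x => ((u (shift T i x) != u x)%:R)%:E) = 0%E) <->
  ae_periodic T u.
Proof.
move=> muu.
have mdu i : measurable_fun setT (fun x => u (shift T i x) - u x).
  apply: measurable_funB => //; apply: (measurableT_comp muu); exact: measurable_shift.
have mN i : measurable [set x | u (shift T i x) != u x].
  rewrite (_ : [set _ | _] = (fun x => u (shift T i x) - u x) @^-1` (~` [set 0])).
    by rewrite -[X in measurable X]setTI; apply: mdu => //; exact: measurableC.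
  by apply/seteqP; split => x /=; rewrite -subr_eq0 => /eqP.
have E i : iint setT (fun x => ((u (shift T i x) != u x)%:R)%:E) =
    m [set x | u (shift T i x) != u x].
  have F x : ((u (shift T i x) != u x)%:R)%:E = (\1_[set x | u (shift T i x) != u x] x)%:E :> \bar R.
    by rewrite indicE; congr (nat_of_bool _)%:R%:E; apply/idP/idP; rewrite inE.
  rewrite iintTE; last 2 first.
  - rewrite (funext F); apply/measurable_EFinP; exact: measurable_indic.
  - by move=> x; rewrite lee_fin.
  by rewrite (eq_integral _ _ (fun x _ => F x)) -integral_indicT.
split=> H i.
  have := H i; rewrite E => N0; exists [set x | u (shift T i x) != u x]; split => //.
  by move=> x /= nx; apply/eqP.
rewrite E; have [N [mN' N0 sN]] := H i.
apply: (subset_measure0 _ _ _ N0) => // x /= nx; apply: sN => /= ux.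
by move: nx; rewrite ux eqxx.
Qed.

Definition dpow (p : R) (u : d.-tuple R -> R) (z : d.-tuple R * d.-tuple R) : \bar R :=
  (`|u z.1 - u z.2| `^ p)%:E.

Lemma dpow_ge0 p u z : (0 <= dpow p u z)%E.
Proof. by rewrite lee_fin powR_ge0. Qed.

Lemma measurable_dpow p u : measurable_fun setT u -> measurable_fun setT (dpow p u).
Proof.
move=> muu; apply/measurable_EFinP; apply: (measurableT_comp (measurable_powR _)).
apply: (measurableT_comp (@normr_measurable R setT)); apply: measurable_funB.
  exact: (measurableT_comp muu).
exact: (measurableT_comp muu).
Qed.

Lemma measurable_dpow1 p u x : measurable_fun setT u -> measurable_fun setT (fun y => dpow p u (x, y)).
Proof.
move=> muu; apply: (measurableT_comp (measurable_dpow p muu)).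
exact: measurable_fun_pair.
Qed.

Lemma measurable_kernel (h : d.-tuple R -> \bar R) p u : measurable_fun setT h -> measurable_fun setT u ->
  measurable_fun setT (fun z => dpow p u z * h (vsub z.1 z.2))%E.
Proof.
move=> mh muu; apply: emeasurable_funM; first exact: measurable_dpow.
by apply: (measurableT_comp mh); exact: measurable_vsubf.
Qed.

Lemma measurable_kernel1 (h : d.-tuple R -> \bar R) p u x : measurable_fun setT h -> measurable_fun setT u ->
  measurable_fun setT (fun y => dpow p u (x, y) * h (vsub x y))%E.
Proof.
move=> mh muu; apply: emeasurable_funM; first exact: measurable_dpow1.
by apply: (measurableT_comp mh); exact: measurable_vsub.
Qed.

Lemma FsE p s (u : d.-tuple R -> R) : measurable_fun setT u ->
  Fs T p s u = (\int[m]_(x in Q) \int[m]_y (dpow p u (x, y) * rk d (- (s * p) - d%:R) (vsub x y)))%E.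
Proof.
move=> muu; have mk := measurable_kernel p (measurable_rk (- (s * p) - d%:R)) muu.
have H x y : ((`|u x - u y| `^ p) / (enorm (vsub x y)) `^ (d%:R + s * p))%:E =
    (dpow p u (x, y) * rk d (- (s * p) - d%:R) (vsub x y))%E.
  by rewrite /dpow /rk -EFinM -powRN opprD [- d%:R - _]addrC.
have -> : Fs T p s u = iint (side T) (fun x => iint setT (fun y =>
    (dpow p u (x, y) * rk d (- (s * p) - d%:R) (vsub x y))%E)).
  by congr iint; apply/funext => x; congr iint; apply/funext => y; rewrite H.
rewrite iintE; last 3 first.
- exact: measurable_side.
- exact: (measurable_iintT mk).
- move=> x; rewrite iintTE; first by apply: integral_ge0 => y _; rewrite mule_ge0 ?dpow_ge0 ?rk_ge0.
    exact: (measurable_kernel1 _ _ (measurable_rk _)).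
  by move=> y; rewrite mule_ge0 ?dpow_ge0 ?rk_ge0.
apply: eq_integral => x _; rewrite iintTE//.
  exact: (measurable_kernel1 _ _ (measurable_rk _)).
by move=> y; rewrite mule_ge0 ?dpow_ge0 ?rk_ge0.
Qed.

Lemma F0E p (u : d.-tuple R -> R) : measurable_fun setT u ->
  F0 T p u = (\int[m]_(x in Q) \int[m]_(y in Q) dpow p u (x, y))%E.
Proof.
move=> muu; have mk := measurable_dpow p muu.
rewrite -[LHS]/(iint (side T) (fun x => iint (side T) (fun y => dpow p u (x, y)))).
have K x : iint (side T) (fun y => dpow p u (x, y)) = (\int[m]_(y in Q) dpow p u (x, y))%E.
  rewrite iintE//; first exact: measurable_side.
    exact: measurable_dpow1.
  by move=> y; exact: dpow_ge0.
rewrite iintE; last 3 first.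
- exact: measurable_side.
- exact: (measurable_iint (measurable_side T) mk).
- by move=> x; rewrite K; apply: integral_ge0 => y _; exact: dpow_ge0.
by apply: eq_integral => x _; exact: K.
Qed.

Lemma measurable_F0_inner p u : measurable_fun setT u ->
  measurable_fun setT (fun x => \int[m]_(y in Q) dpow p u (x, y))%E.
Proof.
move=> muu.
have := measurable_iint (measurable_side T) (measurable_dpow p muu).
apply: eq_measurable_fun => x _; rewrite iintE//; first exact: measurable_side.
  exact: measurable_dpow1.
by move=> y; exact: dpow_ge0.
Qed.

Lemma measurable_Fs_inner (h : d.-tuple R -> \bar R) p u : measurable_fun setT h ->
  (forall z, 0 <= h z)%E -> measurable_fun setT u ->
  measurable_fun setT (fun x => \int[m]_y (dpow p u (x, y) * h (vsub x y)))%E.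
Proof.
move=> mh h0 muu.
apply: (measurable_fun_fubini_tonelli_F (m2 := m) _ (measurable_kernel p mh muu)) => z.
by rewrite mule_ge0 ?dpow_ge0.
Qed.

Lemma ae_periodic_dpow p u x : ae_periodic T u -> ae_periodic T (fun y => dpow p u (x, y)).
Proof. by move=> pu i; apply: ae_imp (pu i) => y E; rewrite /dpow/= E. Qed.

Section bounds.
Variables (p s r : R).
Hypotheses (d0 : (0 < d)%N) (p1 : 1 <= p) (s0 : 0 < s) (rD : diam d T < r).
Let p0 : 0 < p. Proof. exact: lt_le_trans ltr01 p1. Qed.
Let sp0 : 0 < s * p. Proof. exact: mulr_gt0. Qed.
Local Notation e := (- (s * p) - d%:R).
Local Notation cst := ((d%:R * omega R d) / (p * T ^+ d)).

Lemma Fs_lower (u : d.-tuple R -> R) : measurable_fun setT u -> ae_periodic T u ->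
  (((1 + diam d T / r) `^ e * r `^ (- (s * p)) * cst)%:E * F0 T p u <= s%:E * Fs T p s u)%E.
Proof.
move=> muu pu; rewrite FsE// F0E// omegaE//.
have w0 := ball_vol_gt0 (R := R) d0.
set K := _ `^ e * _ * _.
have K0 : 0 <= K by rewrite !mulr_ge0 ?powR_ge0 ?invr_ge0 ?mulr_ge0 ?exprn_ge0 ?(ltW p0) ?(ltW T0) ?(ltW w0).
rewrite -ge0_integralZl_EFin//; last 2 first.
- by move=> x _; apply: integral_ge0 => y _; exact: dpow_ge0.
- by apply: measurable_funTS; exact: measurable_F0_inner.
have mi := measurable_Fs_inner p (measurable_rk e) (@rk_ge0 R d e) muu.
rewrite -ge0_integralZl_EFin//; last 3 first.
- by move=> x _; apply: integral_ge0 => y _; rewrite mule_ge0 ?dpow_ge0 ?rk_ge0.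
- exact: measurable_funTS.
- exact: ltW.
apply: ge0_le_integral => //.
- move=> x _; rewrite mule_ge0 ?lee_fin//; apply: integral_ge0 => y _; exact: dpow_ge0.
- by apply: measurable_funTS; apply: emeasurable_funM => //; exact: measurable_F0_inner.
- by apply: measurable_funTS; apply: emeasurable_funM.
move=> x _.
have := @far_lower R d T T0 (s * p) r (fun y => dpow p u (x, y)) x d0 sp0 rD
  (measurable_dpow1 p x muu) (fun y => dpow_ge0 p u (x, y)) (ae_periodic_dpow p x pu).
have Td : 0 < T ^+ d by exact: exprn_gt0.
(* The factor [s / T^d] removes the [T^d] of [far_lower] and turns [d omega_d / (s p)] into the
   constant of the theorem. *)
have sT : (0 <= (s / T ^+ d)%:E :> \bar R)%E by rewrite lee_fin divr_ge0// ltW.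
move=> /(lee_wpmul2l sT); rewrite !muleA -!EFinM.
congr (_ * _ <= _ * _)%E; congr _%:E.
  by rewrite /K; field; rewrite !gt_eqF.
by field; rewrite gt_eqF.
Qed.

(** The near part is at most [B] at each [x], so it contributes at most [s B T^d], which disappears
    as [s -> 0] if [B] is independent of [s]. *)
Lemma Fs_upper (u : d.-tuple R -> R) (B : R) : measurable_fun setT u -> ae_periodic T u ->
  (forall x, \int[m]_y (dpow p u (x, y) * (rk d e \_ (~` outside d (r + diam d T))) (vsub x y)) <= B%:E)%E ->
  (s%:E * Fs T p s u <= ((1 - diam d T / r) `^ e * r `^ (- (s * p)) * cst)%:E * F0 T p u
     + (s * (B * T ^+ d))%:E)%E.
Proof.
move=> muu pu HB; rewrite FsE// F0E// omegaE//.
have w0 := ball_vol_gt0 (R := R) d0.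
set K := _ `^ e * _ * _.
have K0 : 0 <= K by rewrite !mulr_ge0 ?powR_ge0 ?invr_ge0 ?mulr_ge0 ?exprn_ge0 ?(ltW p0) ?(ltW T0) ?(ltW w0).
have mi := measurable_Fs_inner p (measurable_rk e) (@rk_ge0 R d e) muu.
rewrite -ge0_integralZl_EFin//; last 3 first.
- by move=> x _; apply: integral_ge0 => y _; rewrite mule_ge0 ?dpow_ge0 ?rk_ge0.
- exact: measurable_funTS.
- exact: ltW.
rewrite -ge0_integralZl_EFin//; last 2 first.
- by move=> x _; apply: integral_ge0 => y _; exact: dpow_ge0.
- by apply: measurable_funTS; exact: measurable_F0_inner.
have B0 : 0 <= B.
  rewrite -lee_fin (le_trans _ (HB [tuple 0 | i < d]))//; apply: integral_ge0 => y _.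
  by rewrite mule_ge0 ?dpow_ge0// patchE; case: ifP => // _; exact: rk_ge0.
have -> : (s * (B * T ^+ d))%:E = (\int[m]_(x in Q) (s * B)%:E)%E.
  by have := integral_cst m mQ (s * B)%:E; rewrite /= mu_Q// => ->; rewrite -EFinM mulrA.
rewrite -ge0_integralD//; last 3 first.
- move=> x _; rewrite mule_ge0 ?lee_fin//; apply: integral_ge0 => y _; exact: dpow_ge0.
- by apply: measurable_funTS; apply: emeasurable_funM => //; exact: measurable_F0_inner.
- by move=> x _; rewrite lee_fin mulr_ge0// ltW.
apply: ge0_le_integral => //.
- move=> x _; rewrite mule_ge0 ?lee_fin ?(ltW s0)//; apply: integral_ge0 => y _.
  by rewrite mule_ge0 ?dpow_ge0 ?rk_ge0.
- by apply: measurable_funTS; apply: emeasurable_funM.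
- by apply: measurable_funTS; apply: emeasurable_funD => //; apply: emeasurable_funM => //; exact: measurable_F0_inner.
move=> x _.
have := @far_upper R d T T0 (s * p) r (fun y => dpow p u (x, y)) x d0 sp0 rD
  (measurable_dpow1 p x muu) (fun y => dpow_ge0 p u (x, y)) (ae_periodic_dpow p x pu).
have Td : 0 < T ^+ d by exact: exprn_gt0.
have sT : (0 <= (s / T ^+ d)%:E :> \bar R)%E by rewrite lee_fin divr_ge0// ltW.
move=> /(lee_wpmul2l sT); rewrite !muleA -!EFinM.
have -> : s / T ^+ d * T ^+ d = s by field; rewrite gt_eqF.
have -> : s / T ^+ d * ((1 - diam d T / r) `^ e * (r `^ (- (s * p)) * (d%:R * ball_vol d / (s * p)))) = K.
  by rewrite /K; field; rewrite !gt_eqF.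
move=> H.
have mo : measurable (outside d (r + diam d T)) by exact: measurable_outside.
have mr1 : measurable_fun setT (rk d e \_ (outside d (r + diam d T))).
  by apply/(measurable_restrictT _ _).1 => //; apply: measurable_funTS; exact: measurable_rk.
have mr2 : measurable_fun setT (rk d e \_ (~` outside d (r + diam d T))).
  apply/(measurable_restrictT _ _).1; first exact: measurableC.
  by apply: measurable_funTS; exact: measurable_rk.
have r10 z : (0 <= (rk d e \_ (outside d (r + diam d T))) z)%E.
  by rewrite patchE; case: ifP => // _; exact: rk_ge0.
have r20 z : (0 <= (rk d e \_ (~` outside d (r + diam d T))) z)%E.
  by rewrite patchE; case: ifP => // _; exact: rk_ge0.
rewrite (eq_integral (fun y => dpow p u (x, y) * (rk d e \_ (outside d (r + diam d T))) (vsub x y) +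
  dpow p u (x, y) * (rk d e \_ (~` outside d (r + diam d T))) (vsub x y))%E); last first.
  move=> y _; rewrite -ge0_muleDr//; congr (_ * _)%E.
  by rewrite !patchE in_setC; case: ifP => _ /=; rewrite ?adde0 ?add0e.
rewrite ge0_integralD//; last 4 first.
- by move=> y _; rewrite mule_ge0 ?dpow_ge0.
- exact: measurable_kernel1.
- by move=> y _; rewrite mule_ge0 ?dpow_ge0.
- exact: measurable_kernel1.
rewrite ge0_muleDr; last 2 first.
- by apply: integral_ge0 => y _; rewrite mule_ge0 ?dpow_ge0.
- by apply: integral_ge0 => y _; rewrite mule_ge0 ?dpow_ge0.
apply: leeD => //; rewrite EFinM; apply: lee_wpmul2l; last exact: HB.
by rewrite lee_fin ltW.
Qed.
End bounds.

(** Evenness of the kernel reduces the substitution to a translation. *)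
Lemma integral_reflect (h : d.-tuple R -> \bar R) x : measurable_fun setT h ->
  (forall z, 0 <= h z)%E -> (forall y, h (vsub x y) = h (vsub y x)) ->
  (\int[m]_y h (vsub x y) = \int[m]_y h y)%E.
Proof.
move=> mh h0 hs; rewrite -(@ge0_integral_vadd R d [tuple - tnth x i | i < d] h)//.
apply: eq_integral => y _; rewrite hs; congr h.
by apply: eq_from_tnth => i; rewrite !tnth_mktuple.
Qed.

(** With [t = |x - y|] the integrand is at most [L^p t^(p - sp - 1/2) t^(1/2 - d)]. Since [p >= 1]
    and [sp <= 1/2], the first exponent of [t] lies between 0 and [p], so that power is at most
    [max(1, r)^p]; the second power is integrable near 0. Hence [B] depends on neither [s] nor
    [x]. *)
Lemma near_bound (p : R) (u : d.-tuple R -> R) (L r : R) : (0 < d)%N -> 1 <= p -> 0 < r -> 0 <= L ->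
  measurable_fun setT u -> (forall x y, `|u x - u y| <= L * enorm (vsub x y)) ->
  exists B : R, forall s x, 0 < s -> s * p <= 2^-1 ->
    (\int[m]_y (dpow p u (x, y) * (rk d (- (s * p) - d%:R) \_ (~` outside d r)) (vsub x y)) <= B%:E)%E.
Proof.
move=> d0 p1 r0 L0 muu Lu.
have p0 : 0 < p by exact: lt_le_trans ltr01 p1.
have hd : 2^-1 <= d%:R :> R.
  by apply: (@le_trans _ _ 1); [rewrite invf_le1// ler1n|rewrite ler1n].
have h0 : 0 < 2^-1 :> R by rewrite invr_gt0.
have Nl := near_lty d0 h0 hd r0.
set I := (\int[_]_(x in _) _)%E in Nl.
have I0 : (0 <= I)%E by apply: integral_ge0 => x _; exact: rk_ge0.
have Ifin : I \is a fin_num by rewrite ge0_fin_numE.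
pose M := Num.max 1 r.
have M1 : 1 <= M by rewrite le_max lexx.
pose B0 := L `^ p * M `^ p.
have B00 : 0 <= B0 by rewrite mulr_ge0 ?powR_ge0.
exists (B0 * fine I) => s x s0 sp.
rewrite EFinM fineK//.
pose h := rk d (2^-1 - d%:R) \_ (annulus d 0 r).
have mh : measurable_fun setT h.
  apply/(measurable_restrictT _ _).1; first exact: measurable_annulus.
  by apply: measurable_funTS; exact: measurable_rk.
have hh0 z : (0 <= h z)%E by rewrite /h patchE; case: ifP => // _; exact: rk_ge0.
have -> : I = (\int[m]_y h (vsub x y))%E.
  rewrite (@integral_reflect h x mh hh0); first by rewrite /I integral_mkcond.
  move=> y; rewrite /h !patchE; have E := enorm_vsubC x y.
  rewrite /rk E; congr (if _ then _ else _).
  by apply/idP/idP; rewrite !inE /annulus/= E.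
have mhx : measurable_fun setT (fun y => h (vsub x y)).
  by apply: (measurableT_comp mh); exact: measurable_vsub.
rewrite -ge0_integralZl_EFin//.
have mr2 : measurable_fun setT (rk d (- (s * p) - d%:R) \_ (~` outside d r)).
  apply/(measurable_restrictT _ _).1; first by apply: measurableC; exact: measurable_outside.
  by apply: measurable_funTS; exact: measurable_rk.
apply: ge0_le_integral => //.
- by move=> y _; rewrite mule_ge0 ?dpow_ge0// patchE; case: ifP => // _; exact: rk_ge0.
- exact: measurable_kernel1.
- exact: (emeasurable_funM (measurable_cst _) mhx).
move=> y _; rewrite patchE; case: ifPn => [/set_mem zr|_]; last by rewrite mule0 mule_ge0.
have {}zr : enorm (vsub x y) <= r by rewrite leNgt; apply/negP.
have [z0|z0] := eqVneq (enorm (vsub x y)) 0.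
  have := Lu x y; rewrite z0 mulr0 normr_le0 => /eqP uxy.
  rewrite /dpow/= uxy normr0 powR0 ?gt_eqF// mul0e mule_ge0//.
set t := enorm _ in zr z0 *.
have tp : 0 < t by rewrite lt_neqAle eq_sym z0 enorm_ge0.
rewrite /h patchE mem_set; last by rewrite /annulus/= -/t tp.
rewrite /dpow /rk/= -/t -!EFinM lee_fin.
apply: (@le_trans _ _ ((L * t) `^ p * t `^ (- (s * p) - d%:R))).
  apply: ler_wpM2r; first exact: powR_ge0.
  by apply: ge0_ler_powR; rewrite ?nnegrE ?(ltW p0)// ?mulr_ge0 ?(ltW tp)// Lu.
rewrite powRM ?(ltW tp)// /B0 -!mulrA; apply: ler_wpM2l; first exact: powR_ge0.
have tD (a b : R) : t `^ (a + b) = t `^ a * t `^ b by rewrite powRD// (gt_eqF tp) implybT.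
rewrite -tD (_ : p + _ = (p - s * p - 2^-1) + (2^-1 - d%:R)); last by ring.
rewrite tD; apply: ler_wpM2r; first exact: powR_ge0.
have e0 : 0 <= p - s * p - 2^-1 by move: p1 sp; lra.
apply: (@le_trans _ _ (M `^ (p - s * p - 2^-1))).
  apply: ge0_ler_powR; rewrite ?nnegrE ?(ltW tp)//.
    by rewrite (le_trans ler01).
  by rewrite le_max zr orbT.
apply: ler_powR => //; have := mulr_gt0 s0 p0; lra.
Qed.

End energies.

(** * Limits of the comparison constants *)

Section scaling_constants.
Context {R : realType}.

Lemma bernoulli_ineq (t : R) n : 0 <= t <= 1 -> 1 - n%:R * t <= (1 - t) ^+ n.
Proof.
move=> /andP[t0 t1]; elim: n => [|n IH]; first by rewrite mul0r subr0 expr0.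
rewrite exprS; apply: (@le_trans _ _ ((1 - t) * (1 - n%:R * t))); last first.
  by rewrite ler_wpM2l// subr_ge0.
rewrite -natr1 -subr_ge0.
have -> : (1 - t) * (1 - n%:R * t) - (1 - (n%:R + 1) * t) = n%:R * t ^+ 2 by ring.
by rewrite mulr_ge0// sqr_ge0.
Qed.

Lemma powR_Nnat (b : R) n : 0 <= b -> b `^ (- n%:R) = (b ^+ n)^-1.
Proof. by move=> b0; rewrite powRN powR_mulrn. Qed.

Lemma cvg_powR_exponent (b l : R) (u : nat -> R) : 0 < b -> u @ \oo --> l ->
  (fun n => b `^ u n) @ \oo --> b `^ l.
Proof.
move=> b0 ul; have E x : b `^ x = expR (x * ln b) by rewrite /powR gt_eqF.
rewrite E (_ : (fun n => _) = (fun n => expR (u n * ln b))); last by apply/funext.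
apply: (@cvg_comp _ _ _ (fun n => u n * ln b) expR _ (nbhs (l * ln b))).
  by apply: cvgM => //; exact: cvg_cst.
exact: continuous_expR.
Qed.

Variables (p : R) (s : nat -> R) (D : R) (d : nat).
Hypotheses (p0 : 0 < p) (s0 : s @ \oo --> (0 : R)) (D0 : 0 <= D).

Let cvg_const (b r : R) : 0 < b -> 0 < r ->
  (fun n => b `^ (- (s n * p) - d%:R) * r `^ (- (s n * p))) @ \oo --> b `^ (- d%:R).
Proof.
move=> b0 r0.
have sp : (fun n => - (s n * p)) @ \oo --> (0 : R).
  rewrite -oppr0; apply: cvgN; rewrite -(mul0r p); apply: cvgM => //; exact: cvg_cst.
have -> : b `^ (- d%:R) = b `^ (0 - d%:R) * r `^ 0 by rewrite sub0r powRr0 mulr1.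
apply: cvgM.
  apply: cvg_powR_exponent => //.
  by apply: cvgB => //; exact: cvg_cst.
exact: cvg_powR_exponent.
Qed.

(* [D / r] is small enough for Bernoulli's inequality to pinch [(1 +- D / r) ^- d]. *)
Let radius (e : R) : 0 < e -> exists r, [/\ D < r, 0 < r, D / r < 1 & d%:R * (D / r) <= e / (1 + e)].
Proof.
move=> e0; have e1 : 0 < 1 + e by rewrite addr_gt0.
have c0 : 0 <= d%:R * D * (1 + e) / e by rewrite divr_ge0 ?(ltW e0)// !mulr_ge0// ltW.
set q := d%:R * D * (1 + e) / e in c0; exists (D + 1 + q).
set r := D + 1 + _.
have D1 : 0 < D + 1 by rewrite ltr_wpDl.
have r0 : 0 < r by rewrite /r (lt_le_trans D1)// lerDl.
have rD : D < r by rewrite /r -addrA ltrDl (lt_le_trans ltr01)// lerDl.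
split => //; first by rewrite ltr_pdivrMr// mul1r.
rewrite mulrA ler_pdivrMr// -ler_pdivrMl ?divr_gt0//.
have -> : (e / (1 + e))^-1 * (d%:R * D) = q by rewrite /q; field; rewrite !gt_eqF.
by rewrite /r lerDr ltW.
Qed.

(** The radius is chosen from the limit value [(1 + D / r)^(-d)] at [s = 0]; the strict inequality
    there persists for large [n]. *)
Lemma lower_constant (e : R) : 0 < e -> exists r, D < r /\
  \forall n \near \oo, 1 - e <= (1 + D / r) `^ (- (s n * p) - d%:R) * r `^ (- (s n * p)).
Proof.
move=> e0; have [r [Dr r0 Dr1 De]] := radius (divr_gt0 e0 (ltr0n R 2)).
exists r; split => //.
have t0 : 0 <= D / r by rewrite divr_ge0// ltW.
have b0 : 0 < 1 + D / r by rewrite ltr_wpDr.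
have L : 1 - e < (1 + D / r) `^ (- d%:R).
  rewrite powR_Nnat ?(ltW b0)//.
  apply: (@lt_le_trans _ _ ((1 - D / r) ^+ d)).
    apply: (@lt_le_trans _ _ (1 - d%:R * (D / r))); last by rewrite bernoulli_ineq// t0 ltW.
    rewrite ltrD2l ltrN2; apply: (le_lt_trans De).
    by rewrite ltr_pdivrMr; [nra|lra].
  (* Since [(1 - D / r) (1 + D / r) <= 1], the inverse power is bounded below by a power of
     [1 - D / r]. *)
  rewrite -[leRHS]div1r ler_pdivlMr ?exprn_gt0// -exprMn.
  rewrite exprn_ile1//; first by rewrite mulr_ge0// ?subr_ge0 ltW.
  have : 0 <= (D / r) ^+ 2 by rewrite sqr_ge0.
  have -> : (1 - D / r) * (1 + D / r) = 1 - (D / r) ^+ 2 by ring.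
  lra.
near=> n; apply: ltW; near: n.
exact: (cvgr_gt _ (cvg_const b0 r0)).
Unshelve. all: by end_near. Qed.

Lemma upper_constant (e : R) : 0 < e -> exists r, D < r /\
  \forall n \near \oo, (1 - D / r) `^ (- (s n * p) - d%:R) * r `^ (- (s n * p)) <= 1 + e.
Proof.
move=> e0; have [r [Dr r0 Dr1 De]] := radius (divr_gt0 e0 (ltr0n R 2)).
exists r; split => //.
have t0 : 0 <= D / r by rewrite divr_ge0// ltW.
have b0 : 0 < 1 - D / r by rewrite subr_gt0.
have L : (1 - D / r) `^ (- d%:R) < 1 + e.
  rewrite powR_Nnat ?(ltW b0)//.
  have B := bernoulli_ineq d (_ : 0 <= D / r <= 1).
  rewrite t0 (ltW Dr1) in B; have {}B := B isT.
  have h1 : 0 < 1 + e / 2 by lra.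
  (* The bound supplied by [radius] is exactly the complement to 1 of [1 / (1 + e / 2)]. *)
  have C : (1 + e / 2)^-1 <= 1 - d%:R * (D / r).
    apply: (@le_trans _ _ (1 - e / 2 / (1 + e / 2))); last by rewrite lerD2l lerN2.
    by rewrite le_eqVlt; apply/orP; left; apply/eqP; field; rewrite gt_eqF//; lra.
  apply: (@le_lt_trans _ _ (1 + e / 2)); last by lra.
  by rewrite -[leRHS]invrK lef_pV2 ?posrE ?invr_gt0 ?exprn_gt0// (le_trans C).
near=> n; apply: ltW; near: n.
exact: (cvgr_lt _ (cvg_const b0 r0)).
Unshelve. all: by end_near. Qed.

End scaling_constants.

(** * Abstract weak compactness *)

Section generic_subsequence.

Definition infinite (S : nat -> Prop) := forall m, exists i, (m <= i)%N /\ S i.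

Variable P : nat -> (nat -> Prop) -> Prop.
(** Inheritance by sets that are contained in [S] up to finitely many elements, since a diagonal
    sequence lies in each stage only eventually. *)
Hypothesis P_mono : forall j S S', P j S ->
  (exists m, forall i, (m <= i)%N -> S' i -> S i) -> P j S'.

(** After this stage requirement [j] is settled: either it holds, or no further infinite subset can
    make it hold. *)
Let refine j S : nat -> Prop :=
  if pselect (exists S', [/\ infinite S', forall i, S' i -> S i & P j S']) is left h
  then projT1 (cid h) else S.

Let refine_inf j S : infinite S -> infinite (refine j S).
Proof. by rewrite /refine; case: pselect => // h _; case: (cid h) => S' []. Qed.

Let refine_sub j S i : refine j S i -> S i.
Proof. by rewrite /refine; case: pselect => // h; case: (cid h) => S' q /=; case: q => _ sub _; exact: sub. Qed.

Let refineP j S : P j (refine j S) \/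
  forall S', infinite S' -> (forall i, S' i -> S i) -> ~ P j S'.
Proof.
rewrite /refine; case: pselect => h; first by left; case: (cid h) => S' [].
by right => S' iS' sub PS'; apply: h; exists S'.
Qed.

Let Sq := fix Sq j := if j is j'.+1 then refine j' (Sq j') else fun _ => True.

Let Sq_inf j : infinite (Sq j).
Proof. by elim: j => [m|j IH]; [exists m|exact: refine_inf]. Qed.

Let Sq_dec j k i : (j <= k)%N -> Sq k i -> Sq j i.
Proof.
elim: k => [|k IH]; first by rewrite leqn0 => /eqP ->.
by rewrite leq_eqVlt => /predU1P[-> //|]; rewrite ltnS => jk /refine_sub; exact: IH.
Qed.

Let pick j m : nat := projT1 (cid (Sq_inf j m)).
Let pickP j m : (m <= pick j m)%N /\ Sq j (pick j m).
Proof. by rewrite /pick; case: cid. Qed.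

Let phi := fix phi k := if k is k'.+1 then pick k (phi k').+1 else pick 0 0.

Lemma homo_ltn_nat (f : nat -> nat) : (forall k, (f k < f k.+1)%N) ->
  {homo f : a b / (a < b)%N >-> (a < b)%N}.
Proof.
move=> fS a b; elim: b => // b IH; rewrite ltnS leq_eqVlt => /predU1P[->|/IH ab]; first exact: fS.
exact: ltn_trans ab (fS _).
Qed.

Let phi_lt : {homo phi : a b / (a < b)%N >-> (a < b)%N}.
Proof. by apply: homo_ltn_nat => k; have [] := pickP k.+1 (phi k).+1. Qed.

Let phi_Sq k : Sq k (phi k).
Proof. by case: k => [|k]; [have [] := pickP 0 0|have [] := pickP k.+1 (phi k).+1]. Qed.

(* Diagonal argument: [phi] is eventually contained in each of the nested sets [Sq j], where
   [Sq j.+1] either satisfies [P j] or contains no infinite set satisfying it. *)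
Lemma generic_subsequence : exists f : nat -> nat,
  {homo f : a b / (a < b)%N >-> (a < b)%N} /\
  forall j, P j (range f) \/
    forall S', infinite S' -> (forall i, S' i -> range f i) -> ~ P j S'.
Proof.
exists phi; split => // j.
have ev k : exists m, forall i, (m <= i)%N -> range phi i -> Sq k i.
  exists (phi k) => i ki [k' _ E]; rewrite -E in ki *.
  apply: (@Sq_dec k k'); last exact: phi_Sq.
  by rewrite leqNgt; apply/negP => /phi_lt; rewrite ltnNge ki.
have [PS|nP] := refineP j (Sq j).
  by left; apply: P_mono PS _; exact: (ev j.+1).
right=> S' iS' sub PS'; have [m Hm] := ev j.
(* Dropping the elements below [m] puts the set inside stage [j], where requirement [j] has been
   refuted for infinite subsets. *)
apply: (nP (fun i => S' i /\ (m <= i)%N)).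
- by move=> k; have [i [ki Si]] := iS' (maxn k m); exists i; rewrite geq_max in ki; case/andP: ki.
- by move=> i [Si mi]; apply: Hm => //; exact: sub.
- by apply: P_mono PS' _; exists 0%N => i _ [].
Qed.

End generic_subsequence.

(** * Weak limits from uniform convexity and completeness *)

Section weak_compactness.
Context {R : realType} (V : lmodType R) (X : V -> Prop) (N : V -> R) (C : R).
Hypothesis X_lin : forall (a : R) f g, X f -> X g -> X (a *: f + g).
Hypothesis X0 : X 0.
Hypothesis N_ge0 : forall f, 0 <= N f.
Hypothesis N_opp : forall f, N (- f) = N f.
Hypothesis C1 : 1 <= C.
(** [N] models the p-th power of the norm, hence the constant [C] and the absence of homogeneity and
    definiteness. *)
Hypothesis N_quasi : forall f g, X f -> X g -> N (f + g) <= C * (N f + N g).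
(** An additive form: when [N] at the midpoint is close to the mean of the values, the two elements
    are close, up to a small fraction of their size. *)
Hypothesis uniform_convexity : forall e, 0 < e -> exists2 K, 0 <= K &
  forall f g, X f -> X g ->
  N (f - g) <= e * (N f + N g) + K * ((N f + N g) / 2 - N (2^-1 *: (f + g))).
Hypothesis complete : forall x : nat -> V, (forall n, X (x n)) ->
  (forall e, 0 < e -> exists n, forall j k, (n <= j)%N -> (n <= k)%N -> N (x j - x k) <= e) ->
  exists2 u, X u & forall e, 0 < e -> exists n, forall k, (n <= k)%N -> N (x k - u) <= e.
Variables (v : nat -> V) (M : R).
Hypotheses (Xv : forall n, X (v n)) (Nv : forall n, N (v n) <= M).

Let X_add f g : X f -> X g -> X (f + g).
Proof. by move=> Xf Xg; rewrite -[f]scale1r; exact: X_lin. Qed.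
Let X_scale a f : X f -> X (a *: f).
Proof. by move=> Xf; rewrite -[_ *: _]addr0; exact: X_lin. Qed.
Let X_sub f g : X f -> X g -> X (f - g).
Proof. by move=> Xf Xg; rewrite -scaleN1r addrC; exact: X_lin. Qed.
Let X_sum (l : seq nat) : X (\sum_(i <- l) v i).
Proof. by elim: l => [|i l IH]; rewrite ?big_nil// big_cons; exact: X_add. Qed.
Let N_sym f g : N (f - g) = N (g - f). Proof. by rewrite -N_opp opprB. Qed.

(** Lists may repeat indices, so these means are the convex combinations with rational weights: a
    countable family that is closed under midpoints. *)
Let A (l : seq nat) : V := (size l)%:R^-1 *: \sum_(i <- l) v i.
Let XA l : X (A l). Proof. exact/X_scale/X_sum. Qed.

Let rep k (l : seq nat) := flatten (nseq k l).
Let size_rep k l : size (rep k l) = (k * size l)%N.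
Proof. by elim: k => // k IH; rewrite /rep/= size_cat IH mulSn. Qed.
Let sum_rep k l : \sum_(i <- rep k l) v i = k%:R *: \sum_(i <- l) v i.
Proof.
elim: k => [|k IH]; first by rewrite big_nil scale0r.
by rewrite /rep/= big_cat/= -/(rep k l) IH -[in RHS]natr1 scalerDl scale1r addrC.
Qed.
Let mem_rep k l i : i \in rep k l -> i \in l.
Proof. by elim: k => // k IH; rewrite /rep/= mem_cat => /orP[//|]; exact: IH. Qed.

Let tail (S : nat -> Prop) m (l : seq nat) :=
  (0 < size l)%N /\ forall i, i \in l -> (m <= i)%N /\ S i.

(** Repeating each list as often as the other one is long gives both the same total weight. *)
Let A_mid S m l1 l2 : tail S m l1 -> tail S m l2 ->
  exists2 l, tail S m l & A l = 2^-1 *: (A l1 + A l2).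
Proof.
move=> [s1 t1] [s2 t2]; exists (rep (size l2) l1 ++ rep (size l1) l2).
  split; first by rewrite size_cat !size_rep addn_gt0 muln_gt0 s1 s2.
  by move=> i; rewrite mem_cat => /orP[/mem_rep/t1|/mem_rep/t2].
rewrite /A size_cat !size_rep big_cat/= !sum_rep natrD !natrM.
have a0 : (size l1)%:R != 0 :> R by rewrite pnatr_eq0 -lt0n.
have b0 : (size l2)%:R != 0 :> R by rewrite pnatr_eq0 -lt0n.
have E (a b : R) : a != 0 -> b != 0 -> (b * a + a * b)^-1 * b = 2^-1 * a^-1.
  by move=> ha hb; rewrite (_ : b * a + a * b = 2 * a * b); [field; rewrite ha hb|ring].
by rewrite !scalerDr !scalerA; congr (_ *: _ + _ *: _); rewrite ?E// addrC E.
Qed.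

(** The limits, for [N], of means of arbitrarily late terms with index in [S]. *)
Let K (S : nat -> Prop) (u : V) :=
  forall m e, 0 < e -> exists2 l, tail S m l & N (u - A l) < e.

(** The infimum [I m] of [N] over means of the [m]-th tail increases to a finite [s].
    Near-minimizers [l m] form a Cauchy sequence: the midpoint of two of them is again a mean of a
    tail, so its [N] cannot fall much below [s], and uniform convexity applies. *)
Let K_nonempty S : infinite S -> exists2 u, X u & K S u.
Proof.
move=> iS.
pose E m := [set N (A l) | l in tail S m].
have E0 m : E m !=set0.
  have [i [mi Si]] := iS m; exists (N (A [:: i])); exists [:: i] => //.
  by split => // j; rewrite inE => /eqP ->.
have El m : has_lbound (E m) by exists 0 => _ [l _ <-].
have EI m : has_inf (E m) by split.
pose I m := inf (E m).
have I0 m : 0 <= I m by apply: lb_le_inf => // _ [l _ <-].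
have IM m : I m <= M.
  have [i [mi Si]] := iS m; apply: (@le_trans _ _ (N (A [:: i]))).
    apply: ge_inf => //; exists [:: i] => //.
    by split => // j; rewrite inE => /eqP ->.
  by rewrite /A/= invr1 scale1r big_seq1.
have I_le m l : tail S m l -> I m <= N (A l) by move=> tl; apply: ge_inf => //; exists l.
have I_mono a b : (a <= b)%N -> I a <= I b.
  move=> ab; apply: lb_le_inf => // _ [l [sl tl] <-]; apply: I_le; split => // i /tl[bi Si].
  by split => //; exact: leq_trans bi.
have ex m : exists l, tail S m l /\ N (A l) < I m + m.+1%:R^-1.
  have e0 : 0 < (m.+1%:R : R)^-1 by rewrite invr_gt0.
  have [_ [l tl <-] Hl] := inf_adherent e0 (EI m).
  by exists l.
pose l m := projT1 (cid (ex m)).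
have lP m : tail S m (l m) /\ N (A (l m)) < I m + m.+1%:R^-1 by rewrite /l; case: cid.
pose s := sup (range I).
have hs : has_sup (range I).
  split; first by exists (I 0%N); exists 0%N.
  by exists M => _ [m _ <-].
have Is m : I m <= s by apply: ub_le_sup; [case: hs|exists m].
have s0 : 0 <= s by exact: le_trans (I0 0%N) (Is 0%N).
have [u Xu Hu] : exists2 u, X u & forall e, 0 < e -> exists n, forall k, (n <= k)%N -> N (A (l k) - u) <= e.
  apply: complete => // e e0.
  (* Both values of [N] will be at most [s + 1], so this coefficient contributes at most [e / 2];
     the tolerance [h] below keeps the term with [K0] under [e / 2] as well. *)
  have c0 : 0 < e / (4 * (s + 1)) by rewrite divr_gt0// mulr_gt0// ltr_wpDl.
  have [K0 K00 UC] := uniform_convexity c0.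
  pose h := e / (4 * (K0 + 1)).
  have h0 : 0 < h by rewrite divr_gt0// mulr_gt0// ltr_wpDl.
  have [_ [m1 _ <-] Hm1] := sup_adherent h0 hs.
  pose m2 := Num.truncn h^-1.
  have Hm2 : (m2.+1%:R)^-1 <= h.
    rewrite -[leRHS]invrK lef_pV2 ?posrE ?invr_gt0//.
    exact: ltW (truncnS_gt _).
  exists (maxn m1 m2) => j k; rewrite !geq_max => /andP[j1 j2] /andP[k1 k2].
  have bnd i : (m2 <= i)%N -> N (A (l i)) <= s + h.
    move=> i2; have [_ /ltW Hi] := lP i; apply: (le_trans Hi); apply: lerD => //.
    by apply: le_trans Hm2; rewrite lef_pV2 ?posrE// ler_nat.
  have tl i : (m1 <= i)%N -> tail S m1 (l i).
    move=> i1; have [[sl t] _] := lP i; split => // q /t[iq Sq]; split => //.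
    exact: leq_trans iq.
  (* The midpoint competes in the infimum [I m1], which exceeds [s - h]. *)
  have [lm tlm Elm] := A_mid (tl _ j1) (tl _ k1).
  have mid : s - h <= N (2^-1 *: (A (l j) + A (l k))).
    by rewrite -Elm (le_trans (ltW Hm1))// I_le.
  have bj1 : N (A (l j)) <= s + 1.
    have [_ /ltW Hi] := lP j; apply: (le_trans Hi); apply: lerD => //.
    by rewrite invf_le1// ler1n.
  have bk1 : N (A (l k)) <= s + 1.
    have [_ /ltW Hi] := lP k; apply: (le_trans Hi); apply: lerD => //.
    by rewrite invf_le1// ler1n.
  apply: (le_trans (UC _ _ (XA _) (XA _))).
  apply: (@le_trans _ _ (e / (4 * (s + 1)) * (2 * (s + 1)) + (K0 + 1) * (2 * h))).
    apply: lerD.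
      by rewrite ler_wpM2l ?(ltW c0)//; move: bj1 bk1; lra.
    apply: (@le_trans _ _ (K0 * (2 * h))); last by rewrite [leRHS]mulrDl mul1r lerDl mulr_ge0// ltW.
    by rewrite ler_wpM2l//; move: (bnd _ j2) (bnd _ k2) mid; lra.
  have s1 : s + 1 != 0 by rewrite gt_eqF// ltr_wpDl.
  have K1 : K0 + 1 != 0 by rewrite gt_eqF// ltr_wpDl.
  by rewrite le_eqVlt; apply/orP; left; apply/eqP; rewrite /h; field; rewrite s1 K1.
exists u => // m e e0.
have e2 : 0 < e / 2 by rewrite divr_gt0.
have [n Hn] := Hu _ e2; exists (l (maxn m n)).
  have [[sl t] _] := lP (maxn m n); split => // q /t[iq Sq]; split => //.
  by apply: leq_trans iq; exact: leq_maxl.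
rewrite N_sym (le_lt_trans (Hn _ (leq_maxr _ _)))//.
by rewrite ltr_pdivrMr// ltr_pMr// ltr1n.
Qed.

(** One requirement for each mean [A e] and each threshold [1 / (n + 1)]: means of late terms of [S]
    stay at least that far from [A e]. Codes that decode to nothing impose no condition. *)
Let P j (S : nat -> Prop) : Prop :=
  if @unpickle (seq nat * nat)%type j is Some (e, n) then
    exists m, forall l, tail S m l -> n.+1%:R^-1 <= N (A e - A l)
  else True.

Let P_mono j S S' : P j S -> (exists m, forall i, (m <= i)%N -> S' i -> S i) -> P j S'.
Proof.
rewrite /P; case: unpickle => // -[e n] [m Hm] [m' Hm']; exists (maxn m m') => l [sl tl].
apply: Hm; split => // i /tl[]; rewrite geq_max => /andP[mi m'i] S'i; split => //.
exact: Hm'.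
Qed.

(** Take a mean [A a] close to [u]. Means along [S] come close to [A a], so the requirement of
    staying away fails for [S], and genericity makes it fail for [S'] too: means along [S'] come
    close to [A a], hence to [u]. *)
Let K_sub S S' u : infinite S' -> (forall i, S' i -> S i) ->
  (forall j, P j S \/ forall S', infinite S' -> (forall i, S' i -> S i) -> ~ P j S') ->
  X u -> K S u -> K S' u.
Proof.
move=> iS' sub dec Xu KS m e e0.
have C0 : 0 < C by exact: lt_le_trans ltr01 C1.
(* The threshold [q = 1 / (n + 1)] satisfies [2 C q < e], for the last quasi-triangle inequality;
   [t = q / (2 C)] makes two errors [t] add up to [q] in the first one. *)
pose n := Num.truncn ((2 * C) / e).
pose q : R := n.+1%:R^-1.
have q0 : 0 < q by rewrite invr_gt0.
have qe : 2 * C * q < e.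
  by rewrite /q ltr_pdivrMr// [e * _]mulrC -ltr_pdivrMr// truncnS_gt.
pose t := q / (2 * C).
have t0 : 0 < t by rewrite divr_gt0// mulr_gt0.
have tq : t <= q by rewrite ler_pdivrMr ?mulr_gt0// ler_peMr ?(ltW q0)//; move: C1; lra.
have [a _ Ha] := KS 0%N t t0.
pose j := pickle (a, n).
have nPS : ~ P j S.
  rewrite /P /j pickleK => -[m' Hm']; have [l tl Hl] := KS m' t t0.
  have := Hm' l tl; apply/negP; rewrite -ltNge.
  have -> : A a - A l = (A a - u) + (u - A l) by rewrite addrA subrK.
  apply: (le_lt_trans (N_quasi (X_sub (XA _) Xu) (X_sub Xu (XA _)))).
  rewrite N_sym -ltr_pdivlMl//.
  have E (a' b : R) : b != 0 -> b^-1 * a' = a' / (2 * b) + a' / (2 * b) by move=> b0; field.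
  by rewrite (E q) ?gt_eqF//; exact: ltrD.
have nPS' : ~ P j S' by case: (dec j) => [PS|H]; [case: (nPS PS)|exact: (H S' iS' sub)].
have [l tl Hl] : exists2 l, tail S' m l & N (A a - A l) < q.
  apply: contrapT => H; apply: nPS'; rewrite /P /j pickleK; exists m => l tl.
  by rewrite leNgt; apply/negP => Hl; apply: H; exists l.
exists l => //.
have -> : u - A l = (u - A a) + (A a - A l) by rewrite addrA subrK.
apply: (le_lt_trans (N_quasi (X_sub Xu (XA _)) (X_sub (XA _) (XA _)))).
apply: (lt_trans _ qe); rewrite (_ : 2 * C * q = C * (2 * q)); last by ring.
rewrite ltr_pM2l//.
by move: Ha Hl tq; lra.
Qed.

(* Along a generic subsequence every further subsequence has the same set [K] of limits of
   averages, so no functional can separate a subsequence from a point of [K]. *)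
Theorem weak_sequential_compactness : exists phi : nat -> nat,
  {homo phi : a b / (a < b)%N >-> (a < b)%N} /\
  exists2 u, X u & forall L : V -> R,
    (forall a f g, X f -> X g -> L (a *: f + g) = a * L f + L g) ->
    (forall e, 0 < e -> exists2 t, 0 < t & forall f, X f -> N f < t -> `|L f| < e) ->
    (fun k => L (v (phi k))) @ \oo --> L u.
Proof.
have [phi [phi_lt dec]] := generic_subsequence P_mono.
have phi_ge k : (k <= phi k)%N.
  by elim: k => // k IH; exact: leq_ltn_trans IH (phi_lt _ _ (ltnSn k)).
have iS : infinite (range phi) by move=> m; exists (phi m); split => //; exists m.
exists phi; split => //; have [u Xu Ku] := K_nonempty iS.
exists u => // L Llin Lcont.
(* An eventual upper bound is enough, because it can be applied to both [L] and [- L]. *)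
suff H1 (L' : V -> R) (e : R) : (forall a f g, X f -> X g -> L' (a *: f + g) = a * L' f + L' g) ->
    (forall e, 0 < e -> exists2 t, 0 < t & forall f, X f -> N f < t -> `|L' f| < e) ->
    0 < e -> exists n, forall k, (n <= k)%N -> L' (v (phi k)) < L' u + e.
  apply/cvgrPdist_lt => e e0.
  have [n1 Hn1] := H1 L e Llin Lcont e0.
  have [n2 Hn2] : exists n, forall k, (n <= k)%N -> - L (v (phi k)) < - L u + e.
    apply: (H1 (fun f => - L f)) => //.
      by move=> a f g Xf Xg; rewrite Llin//; ring.
    by move=> e' /Lcont[t t0 Ht]; exists t => // f Xf Nf; rewrite normrN; exact: Ht.
  near=> k.
  have k1 : (n1 <= k)%N by near: k; exists n1.
  have k2 : (n2 <= k)%N by near: k; exists n2.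
  by rewrite ltr_norml; move: (Hn1 _ k1) (Hn2 _ k2); lra.
move=> lin cont e0; apply: contrapT => nH.
have often m : exists k, (m <= k)%N /\ L' u + e <= L' (v (phi k)).
  apply: contrapT => H; apply: nH; exists m => k mk.
  by rewrite ltNge; apply/negP => Hk; apply: H; exists k.
(* By linearity means over [S'] also exceed [L' u] by at least [e], whereas [K_sub] makes [u] a
   limit of such means. *)
pose S' i := range phi i /\ L' u + e <= L' (v i).
have iS' : infinite S'.
  move=> m; have [k [mk Hk]] := often m; exists (phi k); split; first exact: leq_trans (phi_ge k).
  by split => //; exists k.
have KS' : K S' u by apply: (K_sub iS' _ dec) => // i [].
have [t t0 Ht] := cont _ e0.
have [l [sl tl] Hl] := KS' 0%N t t0.
have L0 : L' 0 = 0 by have := lin 1 0 0 X0 X0; rewrite scale1r addr0 mul1r; lra.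
have Lsum (s : seq nat) : L' (\sum_(i <- s) v i) = \sum_(i <- s) L' (v i).
  elim: s => [|i s IH]; first by rewrite !big_nil.
  by rewrite !big_cons -[v i]scale1r lin// mul1r scale1r IH.
have LA : L' u + e <= L' (A l).
  have -> : L' (A l) = (size l)%:R^-1 * \sum_(i <- l) L' (v i).
    by rewrite /A -[_ *: _]addr0 lin// L0 addr0 Lsum.
  rewrite -ler_pdivrMl ?invr_gt0 ?ltr0n// invrK.
  rewrite -sum1_size natr_sum mulr_suml big_seq [leRHS]big_seq; apply: ler_sum => i il.
  by rewrite mul1r; have [_ []] := tl i il.
have := Ht _ (X_sub Xu (XA l)) Hl.
have -> : L' (u - A l) = L' u - L' (A l).
  by rewrite -scaleN1r addrC lin//; ring.
by rewrite ltr_norml => /andP[]; move: LA; lra.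
Unshelve. all: by end_near. Qed.

End weak_compactness.

(** * The space of periodic [L^p] functions *)

Section power_inequalities.
Context {R : realType}.
Implicit Types p a b x y m t : R.

Lemma powRD_gt0 x a b : 0 < x -> x `^ (a + b) = x `^ a * x `^ b.
Proof. by move=> x0; rewrite powRD// (gt_eqF x0) implybT. Qed.

Lemma powR_mulB1 p m : 0 <= m -> 1 <= p -> m `^ p = m * m `^ (p - 1).
Proof.
rewrite le_eqVlt => /predU1P[<-|m0] p1.
  by rewrite mul0r powR0// gt_eqF// (lt_le_trans ltr01).
by rewrite -{2}(powRr1 (ltW m0)) -powRD_gt0// addrC subrK.
Qed.

(** With [y = exp v] one has [y^p = y exp((p - 1) v) > y (1 + (p - 1) v)], and [y (1 - v) <= 1]
    bounds [y v] from below by [y - 1]. *)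
Lemma bernoulli_strict p y : 1 < p -> 0 < y -> y != 1 -> 1 + p * (y - 1) < y `^ p.
Proof.
move=> p1 y0 y1; pose v := ln y.
have p0 : 0 < p by exact: lt_trans p1.
have yE : y = expR v by rewrite /v lnK.
have v0 : v != 0.
  by apply: contra y1 => /eqP v0; rewrite yE v0 expR0.
have E : y `^ p = y * expR ((p - 1) * v).
  by rewrite /powR gt_eqF// -/v {1}yE -expRD; congr expR; ring.
have H1 : 1 + (p - 1) * v < expR ((p - 1) * v).
  by apply: expR_gt1Dx; rewrite mulf_neq0// subr_eq0 gt_eqF.
have H2 : 1 - v <= y^-1 by rewrite yE -expRN; exact: expR_ge1Dx.
have H3 : y * (1 - v) <= 1 by rewrite -[leRHS](mulfV (lt0r_neq0 y0)) ler_pM2l.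
rewrite E; apply: (@le_lt_trans _ _ (y * (1 + (p - 1) * v))); last by rewrite ltr_pM2l.
rewrite -subr_ge0.
have -> : y * (1 + (p - 1) * v) - (1 + p * (y - 1)) = (p - 1) * (1 - y * (1 - v)) by ring.
by rewrite mulr_ge0 ?subr_ge0// ltW.
Qed.

Lemma tangent_strict p m x : 1 < p -> 0 < m -> 0 < x -> x != m ->
  m `^ p + p * m `^ (p - 1) * (x - m) < x `^ p.
Proof.
move=> p1 m0 x0 xm.
have B : 1 + p * (x / m - 1) < (x / m) `^ p.
  apply: bernoulli_strict => //; first exact: divr_gt0.
  by apply: contra xm => /eqP E; rewrite -(divfK (lt0r_neq0 m0) x) E mul1r.
have mp : 0 < m `^ p by exact: powR_gt0.
have -> : x `^ p = m `^ p * (x / m) `^ p.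
  have {1}-> : x = m * (x / m) by rewrite mulrC divfK// gt_eqF.
  by rewrite powRM ?divr_ge0// ltW.
have -> : m `^ p + p * m `^ (p - 1) * (x - m) = m `^ p * (1 + p * (x / m - 1)).
  rewrite (powR_mulB1 (ltW m0) (ltW p1)); field; by rewrite gt_eqF.
by rewrite ltr_pM2l.
Qed.

Lemma tangent_nonneg p m x : 1 <= p -> 0 <= m -> 0 <= x ->
  m `^ p + p * m `^ (p - 1) * (x - m) <= x `^ p.
Proof.
move=> p1 m0 x0.
have p0 : 0 < p by exact: lt_le_trans p1.
(* The case [p = 1] is set apart because the slope at [m = 0] is then [0^0 = 1] instead of 0. *)
move: p1; rewrite le_eqVlt => /predU1P[<-|p1].
  by rewrite subrr powRr0 !powRr1//; lra.
move: m0; rewrite le_eqVlt => /predU1P[<-|m0].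
  rewrite powR0 ?gt_eqF// powR0 ?subr_eq0 ?gt_eqF//.
  by rewrite mulr0 mul0r addr0 powR_ge0.
move: x0; rewrite le_eqVlt => /predU1P[<-|x0].
  rewrite powR0 ?gt_eqF// sub0r mulrN -mulrA [_ `^ (p - 1) * m]mulrC -powR_mulB1 ?(ltW m0) ?(ltW p1)//.
  by rewrite subr_le0 ler_peMl ?powR_ge0// ltW.
have [->|xm] := eqVneq x m; first by rewrite subrr mulr0 addr0.
by apply: ltW; exact: tangent_strict.
Qed.

Lemma subgradient p a b : 1 <= p ->
  `|a| `^ p + p * (Num.sg a * `|a| `^ (p - 1)) * (b - a) <= `|b| `^ p.
Proof.
move=> p1; apply: (le_trans _ (tangent_nonneg p1 (normr_ge0 a) (normr_ge0 b))).
have p0 : 0 <= p by exact: le_trans ler01 p1.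
rewrite lerD2l -!mulrA ler_wpM2l// [leLHS]mulrCA ler_wpM2l ?powR_ge0//.
rewrite mulrBr -normrEsg lerD2r.
by apply: (le_trans (ler_norm _)); rewrite normrM normr_sg; case: (a != 0); rewrite ?mul1r ?mul0r.
Qed.

(** Convexity applied to [x + y = (1 - t) (x / (1 - t)) + t (y / t)], via tangents at [x + y]. For
    small [t] the first coefficient is near 1, which makes [F0] continuous. *)
Lemma powR_conv p x y t : 1 <= p -> 0 <= x -> 0 <= y -> 0 < t < 1 ->
  (x + y) `^ p <= (1 - t) `^ (1 - p) * x `^ p + t `^ (1 - p) * y `^ p.
Proof.
move=> p1 x0 y0 /andP[t0 t1].
have s0 : 0 < 1 - t by rewrite subr_gt0.
set m := x + y; have m0 : 0 <= m by rewrite addr_ge0.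
have H1 := tangent_nonneg p1 m0 (divr_ge0 x0 (ltW s0)).
have H2 := tangent_nonneg p1 m0 (divr_ge0 y0 (ltW t0)).
have E q z : 0 < q -> 0 <= z -> q `^ (1 - p) * z `^ p = q * (z / q) `^ p.
  move=> q0 z0; rewrite powRM ?invr_ge0 ?(ltW q0)// powRD_gt0// powRr1 ?(ltW q0)//.
  have -> : q^-1 `^ p = q `^ (- p) by rewrite -powR_inv1 ?(ltW q0)// -powRrM mulN1r.
  by ring.
rewrite !E//.
have := lerD (ler_wpM2l (ltW s0) H1) (ler_wpM2l (ltW t0) H2); apply: le_trans.
rewrite le_eqVlt; apply/orP; left; apply/eqP; rewrite /m; field.
by rewrite !gt_eqF.
Qed.

Lemma powRD_le p x y : 1 <= p -> 0 <= x -> 0 <= y ->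
  (x + y) `^ p <= 2 `^ p * (x `^ p + y `^ p).
Proof.
move=> p1 x0 y0; have h01 : 0 < (2^-1 : R) < 1 by rewrite invr_gt0 ltr0n invf_lt1// ltr1n.
apply: (le_trans (powR_conv p1 x0 y0 h01)).
have -> : 1 - 2^-1 = 2^-1 :> R by lra.
rewrite -mulrDr ler_wpM2r ?addr_ge0 ?powR_ge0//.
rewrite -powR_inv1// -powRrM mulN1r opprB ler_powR ?ler1n//; lra.
Qed.

Lemma powR_lip p a b M : 1 <= p -> `|a| <= M -> `|b| <= M ->
  `| `|a| `^ p - `|b| `^ p | <= p * M `^ (p - 1) * `|a - b|.
Proof.
move=> p1 aM bM.
have p0 : 0 <= p by exact: le_trans ler01 p1.
have M0 : 0 <= M by exact: le_trans (normr_ge0 _) aM.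
have main (c e : R) : `|c| <= M -> `|c| `^ p - `|e| `^ p <= p * M `^ (p - 1) * `|c - e|.
  move=> cM; have := tangent_nonneg p1 (normr_ge0 c) (normr_ge0 e).
  have K : p * `|c| `^ (p - 1) <= p * M `^ (p - 1).
    by rewrite ler_wpM2l// ge0_ler_powR ?nnegrE ?subr_ge0.
  have K0 : 0 <= p * `|c| `^ (p - 1) by rewrite mulr_ge0// powR_ge0.
  have D : `|c| - `|e| <= `|c - e| by exact: lerB_dist.
  have := ler_pM K0 (normr_ge0 _) K (lexx `|c - e|).
  have := ler_wpM2l K0 D.
  lra.
have H1 := main a b aM; have H2 := main b a bM.
by rewrite distrC in H2; rewrite ler_norml; move: H1 H2; lra.
Qed.

Lemma continuous_normpow p : 1 <= p -> continuous (fun t : R => `|t| `^ p).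
Proof.
move=> p1 a; apply/cvgrPdist_lt => e e0.
have p0 : 0 < p by exact: lt_le_trans ltr01 p1.
pose K := p * (`|a| + 1) `^ (p - 1).
have K0 : 0 < K by rewrite mulr_gt0// powR_gt0// ltr_wpDl.
near=> b.
have ab1 : `|a - b| < 1 by near: b; exact: (nbhsx_ballx a 1 ltr01).
have abe : `|a - b| < e / K by near: b; exact: (nbhsx_ballx a (e / K) (divr_gt0 e0 K0)).
have bM : `|b| <= `|a| + 1.
  have : `|b| - `|a| <= `|b - a| by exact: lerB_dist.
  by rewrite distrC; move: ab1; lra.
apply: (le_lt_trans (powR_lip p1 (_ : `|a| <= `|a| + 1) bM)); first by rewrite lerDl.
by rewrite -/K mulrC -ltr_pdivlMr.
Unshelve. all: by end_near. Qed.

(** Tangent at the midpoint [m]: strict inequality at 1, weak inequality at [t], and the two linear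
    terms cancel. *)
Lemma midpoint_gap p t : 1 < p -> -1 <= t < 1 -> 0 < (1 + `|t| `^ p) / 2 - `|(1 + t) / 2| `^ p.
Proof.
move=> p1 /andP[tl tu]; set m := (1 + t) / 2.
have m0 : 0 <= m by rewrite /m; lra.
have p0 : 0 < p by exact: lt_trans p1.
rewrite (ger0_norm m0).
move: m0; rewrite le_eqVlt => /predU1P[<-|m0].
  by rewrite powR0 ?gt_eqF// subr0 divr_gt0// ltr_pwDl// powR_ge0.
have m1 : 1 != m by rewrite gt_eqF// /m; lra.
have H1 := tangent_strict p1 m0 ltr01 m1; rewrite powR1 in H1.
have H2 := subgradient m t (ltW p1).
rewrite (gtr0_norm m0) gtr0_sg// mul1r in H2.
set c := p * _ in H1 H2.
have E : c * (1 - m) + c * (t - m) = 0 by rewrite /m; field.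
by move: H1 H2 E; set A := c * (1 - m); set B := c * (t - m); lra.
Qed.

(** Close to [t = 1] the left side is at most [dl^p <= dl <= e]. On the rest of the interval the gap
    is continuous and positive, so it has a positive minimum, and a large multiple of it beats the
    bound [2^p]. *)
Lemma uniform_convexity_unit p e : 1 < p -> 0 < e -> exists2 K, 0 <= K &
  forall t, -1 <= t <= 1 ->
  `|1 - t| `^ p <= e + K * ((1 + `|t| `^ p) / 2 - `|(1 + t) / 2| `^ p).
Proof.
move=> p1 e0; have p0 : 0 < p by exact: lt_trans p1.
pose dl := Num.min 1 e.
have dl0 : 0 < dl by rewrite lt_min ltr01.
have dl1 : dl <= 1 by rewrite ge_min lexx.
have dle : dl <= e by rewrite ge_min lexx orbT.
pose F t := (1 + `|t| `^ p) / 2 - `|(1 + t) / 2| `^ p.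
have cF : continuous F.
  move=> t; apply: cvgB.
    apply: cvgM; last exact: cvg_cst.
    by apply: cvgD; [exact: cvg_cst|apply: continuous_normpow; exact: ltW].
  apply: (@cvg_comp _ _ _ (fun t : R => (1 + t) / 2) (fun t : R => `|t| `^ p) _ (nbhs ((1 + t) / 2))).
    by apply: cvgM; [apply: cvgD; [exact: cvg_cst|exact: cvg_id]|exact: cvg_cst].
  by apply: continuous_normpow; exact: ltW.
have [c cI Hc] : exists2 c, c \in `[-1, 1 - dl] & forall t, t \in `[-1, 1 - dl] -> F c <= F t.
  by apply: EVT_min; [move: dl1; lra|exact: continuous_subspaceT].
have Fc : 0 < F c.
  by apply: midpoint_gap => //; move: cI; rewrite in_itv/= => /andP[-> ?]/=; move: dl0; lra.
exists (2 `^ p / F c); first by rewrite divr_ge0 ?powR_ge0// ltW.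
move=> t /andP[t1 t2]; rewrite -/(F t).
have [td|td] := leP t (1 - dl).
  have Ft := Hc t; rewrite in_itv/= t1 td in Ft; have {}Ft := Ft isT.
  apply: (@le_trans _ _ (2 `^ p)).
    rewrite ge0_ler_powR ?nnegrE ?(ltW p0)//.
    by rewrite ger0_norm ?subr_ge0//; lra.
  apply: (@le_trans _ _ (2 `^ p / F c * F t)); last by rewrite lerDr ltW.
  by rewrite mulrAC ler_pdivlMr// ler_wpM2l// powR_ge0.
have F0 : 0 <= F t.
  move: t2; rewrite le_eqVlt => /predU1P[->|t2].
    by rewrite /F normr1 powR1 -[1 + 1]/(2 : R) divff// normr1 powR1; lra.
  by apply: ltW; apply: midpoint_gap => //; rewrite t1.
apply: (@le_trans _ _ e); last by rewrite lerDl mulr_ge0// divr_ge0 ?powR_ge0// ltW.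
apply: le_trans dle; rewrite ger0_norm ?subr_ge0//.
apply: (@le_trans _ _ (dl `^ p)).
  by rewrite ge0_ler_powR ?nnegrE ?subr_ge0 ?(ltW p0) ?(ltW dl0)//; move: td; lra.
by rewrite -[leRHS](powRr1 (ltW dl0)) ger_powR ?dl0 ?dl1// ltW.
Qed.

(** Homogeneity and symmetry reduce this to the pair [1], [t = b / a] with [|t| <= 1]. *)
Lemma uniform_convexity_real p e : 1 < p -> 0 < e -> exists2 K, 0 <= K &
  forall a b, `|a - b| `^ p <= e * (`|a| `^ p + `|b| `^ p) +
    K * ((`|a| `^ p + `|b| `^ p) / 2 - `|2^-1 * (a + b)| `^ p).
Proof.
move=> p1 e0; have [K K0 HK] := uniform_convexity_unit p1 e0.
have p0 : 0 < p by exact: lt_trans p1.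
exists K => //.
suff main a b : `|b| <= `|a| -> `|a - b| `^ p <= e * (`|a| `^ p + `|b| `^ p) +
    K * ((`|a| `^ p + `|b| `^ p) / 2 - `|2^-1 * (a + b)| `^ p).
  move=> a b; have [ba|ab] := leP `|b| `|a|; first exact: main.
  have := main b a (ltW ab); rewrite distrC [b + a]addrC [`|b| `^ p + _]addrC.
  exact.
move=> ba; have [a0|a0] := eqVneq a 0.
  move: ba; rewrite a0 normr0 normr_le0 => /eqP ->.
  by rewrite addr0 mulr0 subr0 normr0 powR0 ?gt_eqF// addr0 mulr0 mul0r subr0 mulr0 addr0.
pose t := b / a.
have na : 0 < `|a| by rewrite normr_gt0.
have t1 : -1 <= t <= 1 by rewrite -ler_norml normrM normfV ler_pdivrMr// mul1r.
have bE : b = a * t by rewrite /t mulrC divfK.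
have E z : `|a * z| `^ p = `|a| `^ p * `|z| `^ p by rewrite normrM powRM.
have -> : a - b = a * (1 - t) by rewrite bE; ring.
have -> : 2^-1 * (a + b) = a * ((1 + t) / 2) by rewrite bE; ring.
rewrite [in `|b|]bE !E.
set P := `|a| `^ p; have P0 : 0 <= P by exact: powR_ge0.
have := ler_wpM2l P0 (HK t t1); move/le_trans; apply.
rewrite -subr_ge0.
set X := `|t| `^ p; set Y := `|_ / 2| `^ p.
have -> : e * (P + P * X) + K * ((P + P * X) / 2 - P * Y) - P * (e + K * ((1 + X) / 2 - Y)) = e * (P * X) by ring.
by rewrite !mulr_ge0 ?powR_ge0// ltW.
Qed.

Lemma norm_le_pow p x l : 1 <= p -> 0 < l -> `|x| <= l `^ (1 - p) * `|x| `^ p + l.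
Proof.
move=> p1 l0; have [xl|lx] := leP `|x| l.
  by apply: (le_trans xl); rewrite lerDr mulr_ge0 ?powR_ge0.
have x0 : 0 < `|x| by exact: lt_trans lx.
apply: (@le_trans _ _ (l `^ (1 - p) * `|x| `^ p)); last by rewrite lerDl ltW.
rewrite (powR_mulB1 (ltW x0) p1) mulrCA ler_peMr//.
rewrite -(opprB p 1) powRN mulrC ler_pdivlMr ?powR_gt0// mul1r.
by rewrite ge0_ler_powR ?nnegrE ?subr_ge0 ?(ltW l0) ?(ltW x0) ?(ltW lx).
Qed.

End power_inequalities.

(** * Norm, mean value and Poincare inequality *)

Section Lp.
Context {R : realType} (d : nat) (T p : R).
Hypotheses (T0 : 0 < T) (p1 : 1 <= p).
Local Notation m := (@mu R d).
Local Notation Q := (cube d (side T)).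
Local Notation fct := (d.-tuple R -> R).
Implicit Types u v f g : fct.

Let p0 : 0 < p. Proof. exact: lt_le_trans ltr01 p1. Qed.
Let mQ : measurable Q. Proof. exact: measurable_Q. Qed.

(** The p-th power of the norm, kept without the root so that pointwise inequalities integrate
    directly. *)
Definition eN u : \bar R := (\int[m]_(x in Q) (`|u x| `^ p)%:E)%E.
Definition rN u : R := fine (eN u).

Lemma measurable_npow u : measurable_fun setT u -> measurable_fun setT (fun x => (`|u x| `^ p)%:E).
Proof.
move=> muu; apply/measurable_EFinP; apply: (measurableT_comp (measurable_powR _)).
exact: (measurableT_comp (@normr_measurable R setT)).
Qed.

Lemma eN_ge0 u : (0 <= eN u)%E.
Proof. by apply: integral_ge0 => x _; rewrite lee_fin powR_ge0. Qed.

Lemma rN_ge0 u : 0 <= rN u. Proof. by rewrite fine_ge0// eN_ge0. Qed.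

Lemma iint_eN u : measurable_fun setT u -> iint (side T) (fun x => (`|u x| `^ p)%:E) = eN u.
Proof.
move=> muu; rewrite iintE//.
- exact: measurable_side.
- exact: measurable_npow.
Qed.

Lemma inLpP u : inLp T p u <-> [/\ measurable_fun setT u, ae_periodic T u & (eN u < +oo)%E].
Proof.
split=> [[muu [pu Nu]]|[muu pu Nu]].
  by split => //; [exact/ae_periodicP|rewrite -iint_eN].
by split => //; split; [exact/ae_periodicP|rewrite iint_eN].
Qed.

Lemma inLp_meas u : inLp T p u -> measurable_fun setT u. Proof. by case. Qed.
Lemma inLp_per u : inLp T p u -> ae_periodic T u. Proof. by case/inLpP. Qed.

Lemma eN_fin u : inLp T p u -> eN u = (rN u)%:E.
Proof. by case/inLpP => _ _ Nu; rewrite fineK// ge0_fin_numE// eN_ge0. Qed.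

Lemma Lpnorm_rN u : inLp T p u -> Lpnorm T p u = rN u `^ p^-1.
Proof. by move=> uL; rewrite /Lpnorm iint_eN//; exact: inLp_meas. Qed.

Lemma eN_lin (a : R) f g : measurable_fun setT f -> measurable_fun setT g ->
  (eN (fun x => (a * f x + g x)%R) <= (2 `^ p)%:E * ((`|a| `^ p)%:E * eN f + eN g))%E.
Proof.
move=> mf mg; have mf' := measurable_npow mf; have mg' := measurable_npow mg.
rewrite /eN -ge0_integralZl_EFin ?powR_ge0//; try first [by move=> x _; rewrite lee_fin powR_ge0 | by exact: measurable_funTS].
rewrite -ge0_integralD//; try first [by move=> x _; rewrite -EFinM lee_fin mulr_ge0// powR_ge0 | by apply: measurable_funTS; apply: emeasurable_funM | by move=> x _; rewrite lee_fin powR_ge0 | by exact: measurable_funTS].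
rewrite -ge0_integralZl_EFin ?powR_ge0//; try first [by move=> x _; rewrite -EFinM -EFinD lee_fin addr_ge0 ?mulr_ge0 ?powR_ge0 | by apply: measurable_funTS; apply: emeasurable_funD => //; apply: emeasurable_funM].
apply: ge0_le_integral => //.
- apply: measurable_funTS; apply: measurable_npow.
  by apply: measurable_funD => //; apply: measurable_funM.
- apply: measurable_funTS; apply: emeasurable_funM => //; apply: emeasurable_funD => //.
  by apply: emeasurable_funM.
move=> x _; rewrite -EFinM lee_fin.
have := powRD_le p1 (normr_ge0 (a * f x)) (normr_ge0 (g x)).
rewrite {2}normrM powRM//; apply: le_trans.
by rewrite ge0_ler_powR ?nnegrE ?(ltW p0) ?addr_ge0 ?ler_normD.
Qed.

Lemma inLp_lin (a : R) f g : inLp T p f -> inLp T p g -> inLp T p (fun x => a * f x + g x).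
Proof.
move=> fL gL; have [mf pf Nf] := (inLpP f).1 fL; have [mg pg Ng] := (inLpP g).1 gL.
apply/inLpP; split.
- by apply: measurable_funD => //; apply: measurable_funM.
- move=> i; apply: ae_imp (ae_and (pf i) (pg i)) => x [-> ->]//.
- apply: (le_lt_trans (eN_lin a mf mg)).
  by rewrite (eN_fin fL) (eN_fin gL) -EFinM ltry.
Qed.

Lemma inLp_cst (c : R) : inLp T p (fun _ : d.-tuple R => c).
Proof.
apply/inLpP; split => //.
- by move=> i; exact: aeW.
- rewrite /eN (_ : (\int[m]_(x in Q) _ = (`|c| `^ p)%:E * m Q)%E).
    by rewrite mu_Q// -EFinM ltry.
  exact: integral_cst.
Qed.

Lemma inLp_sub f g : inLp T p f -> inLp T p g -> inLp T p (fun x => f x - g x).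
Proof.
move=> fL gL; have := inLp_lin (-1) gL fL.
by congr inLp; apply/funext => x; rewrite mulN1r addrC.
Qed.

Lemma inLp_scale a f : inLp T p f -> inLp T p (fun x => a * f x).
Proof.
move=> fL; have := inLp_lin a fL (inLp_cst 0).
by congr inLp; apply/funext => x; rewrite addr0.
Qed.

Lemma inLp_add f g : inLp T p f -> inLp T p g -> inLp T p (fun x => f x + g x).
Proof.
move=> fL gL; have := inLp_lin 1 fL gL.
by congr inLp; apply/funext => x; rewrite mul1r.
Qed.

Lemma rN_opp f : rN (fun x => - f x) = rN f.
Proof. by rewrite /rN /eN; congr fine; apply: eq_integral => x _; rewrite normrN. Qed.

Lemma rN_add f g : inLp T p f -> inLp T p g -> rN (fun x => f x + g x) <= 2 `^ p * (rN f + rN g).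
Proof.
move=> fL gL; have := eN_lin 1 (inLp_meas fL) (inLp_meas gL).
rewrite (_ : (fun x => 1 * f x + g x) = (fun x => f x + g x)); last by apply/funext => x; rewrite mul1r.
rewrite (eN_fin fL) (eN_fin gL) (eN_fin (inLp_add fL gL)) normr1 powR1 mul1e.
by rewrite -EFinD -EFinM lee_fin.
Qed.

Lemma eN_ball_le (l : R) f : measurable_fun setT f -> 0 < l ->
  (\int[m]_(x in Q) `|f x|%:E <= (l `^ (1 - p))%:E * eN f + (l * T ^+ d)%:E)%E.
Proof.
move=> mf l0; have mf' := measurable_npow mf.
have -> : (l * T ^+ d)%:E = (\int[m]_(x in Q) l%:E)%E.
  by have := integral_cst m mQ l%:E; rewrite /= mu_Q// => ->; rewrite -EFinM.
rewrite /eN -ge0_integralZl_EFin ?powR_ge0//; try first [by move=> x _; rewrite lee_fin powR_ge0 | by exact: measurable_funTS].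
rewrite -ge0_integralD//; try first [by move=> x _; rewrite -EFinM lee_fin mulr_ge0// powR_ge0 | by apply: measurable_funTS; apply: emeasurable_funM | by move=> x _; rewrite lee_fin ltW].
apply: ge0_le_integral => //.
- by apply/measurable_EFinP; apply: measurable_funTS; exact: (measurableT_comp (@normr_measurable R setT)).
- by apply: measurable_funTS; apply: emeasurable_funD => //; apply: emeasurable_funM.
by move=> x _; rewrite -EFinM -EFinD lee_fin norm_le_pow.
Qed.

(** The summands are the coefficients of the two terms of [eN_ball_le] at [l = (rN f)^(1/p)]. *)
Definition volc : R := 1 + T ^+ d.
Lemma volc_gt0 : 0 < volc. Proof. by rewrite addr_gt0// exprn_gt0. Qed.

(* Young's inequality [|v| <= l^(1-p) |v|^p + l] with the optimal [l = (rN f)^(1/p)]. *)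
Lemma integral_norm_le f : measurable_fun setT f -> (eN f < +oo)%E ->
  (\int[m]_(x in Q) `|f x|%:E <= (volc * rN f `^ p^-1)%:E)%E.
Proof.
move=> mf Nf; have Nfin : eN f = (rN f)%:E by rewrite fineK// ge0_fin_numE// eN_ge0.
have Td : 0 < T ^+ d by exact: exprn_gt0.
have [N0|N0] := eqVneq (rN f) 0.
  rewrite N0 powR0 ?invr_eq0 ?gt_eqF// mulr0; apply/lee_addgt0Pr => e e0.
  rewrite add0e; have l0 : 0 < e / T ^+ d by exact: divr_gt0.
  apply: (le_trans (eN_ball_le mf l0)).
  by rewrite Nfin N0 mule0 add0e divfK// gt_eqF.
have Np : 0 < rN f by rewrite lt_neqAle eq_sym N0 rN_ge0.
have l0 : 0 < rN f `^ p^-1 by exact: powR_gt0.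
apply: (le_trans (eN_ball_le mf l0)); rewrite Nfin -EFinM -EFinD lee_fin.
rewrite -powRrM -{2}(powRr1 (ltW Np)) -powRD_gt0// /volc.
rewrite (_ : p^-1 * (1 - p) + 1 = p^-1); first by rewrite mulrDl mul1r [T ^+ d * _]mulrC.
by rewrite mulrBr mulr1 mulVf ?subrK// gt_eqF.
Qed.

Lemma inLp_integrable f : inLp T p f -> m.-integrable Q (EFin \o f).
Proof.
move=> fL; have [mf _ Nf] := (inLpP f).1 fL.
apply/integrableP; split; first by apply/measurable_EFinP; exact: measurable_funTS.
exact: le_lt_trans (integral_norm_le mf Nf) (ltry _).
Qed.

Definition Iq f : R := fine (\int[m]_(x in Q) (f x)%:E)%E.

Lemma avgE f : inLp T p f -> avg T f = Iq f / T ^+ d.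
Proof.
move=> fL; rewrite /avg /Iq integrable_iintE//; first exact: measurable_side.
exact: inLp_integrable.
Qed.

Lemma EFin_Iq f : inLp T p f -> (\int[m]_(x in Q) (f x)%:E)%E = (Iq f)%:E.
Proof. by move=> fL; rewrite fineK//; apply: integrable_fin_num => //; exact: inLp_integrable. Qed.

Lemma Iq_lin a f g : inLp T p f -> inLp T p g -> Iq (fun x => a * f x + g x) = a * Iq f + Iq g.
Proof.
move=> fL gL; have If := inLp_integrable fL; have Ig := inLp_integrable gL.
rewrite /Iq; rewrite (eq_integral (fun x => a%:E * (f x)%:E + (g x)%:E)%E); last first.
  by move=> x _; rewrite EFinD EFinM.
rewrite integralD//; last exact: integrableZl.
by rewrite integralZl// !EFin_Iq// -EFinM -EFinD.
Qed.

Lemma Iq_bound f : inLp T p f -> `|Iq f| <= volc * rN f `^ p^-1.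
Proof.
move=> fL; have [mf _ Nf] := (inLpP f).1 fL.
rewrite -lee_fin -abse_EFin -EFin_Iq//.
apply: (le_trans _ (integral_norm_le mf Nf)).
have := le_abse_integral m mQ (_ : measurable_fun Q (EFin \o f)).
by apply; apply/measurable_EFinP; exact: measurable_funTS.
Qed.

Lemma avg_dual : Lp_dual T p (@avg R d T).
Proof.
have Td : 0 < T ^+ d by exact: exprn_gt0.
split => [a f g fL gL|].
  by rewrite !avgE//; [rewrite Iq_lin// mulrDl mulrA|exact: inLp_lin].
exists (volc / T ^+ d) => f fL; rewrite avgE// Lpnorm_rN// normrM normfV (gtr0_norm Td).
by rewrite mulrAC ler_pM2r ?invr_gt0// Iq_bound.
Qed.

Lemma dual_continuous L : Lp_dual T p L -> forall e, 0 < e ->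
  exists2 t, 0 < t & forall f, inLp T p f -> rN f < t -> `|L f| < e.
Proof.
move=> [_ [C HC]] e e0; pose C' := `|C| + 1.
have C'0 : 0 < C' by rewrite ltr_wpDl.
exists ((e / C') `^ p); first by rewrite powR_gt0// divr_gt0.
move=> f fL Nf; apply: (le_lt_trans (HC f fL)); rewrite Lpnorm_rN//.
apply: (@le_lt_trans _ _ (C' * rN f `^ p^-1)).
  by rewrite ler_wpM2r ?powR_ge0// /C' (le_trans (ler_norm C))// lerDl.
rewrite mulrC -ltr_pdivlMr//.
have -> : e / C' = ((e / C') `^ p) `^ p^-1.
  by rewrite -powRrM mulfV ?gt_eqF// powRr1// divr_ge0// ltW.
by rewrite gt0_ltr_powR ?nnegrE ?invr_gt0 ?rN_ge0 ?powR_ge0.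
Qed.

Lemma Lp_uniform_convexity e : 1 < p -> 0 < e -> exists2 K, 0 <= K &
  forall f g, inLp T p f -> inLp T p g ->
  rN (fun x => f x - g x) <= e * (rN f + rN g) +
    K * ((rN f + rN g) / 2 - rN (fun x => 2^-1 * (f x + g x))).
Proof.
move=> p1' e0; have [K K0 HK] := uniform_convexity_real p1' e0.
exists K => // f g fL gL.
have fgL := inLp_scale 2^-1 (inLp_add fL gL); have fg := inLp_sub fL gL.
have mf' := measurable_npow (inLp_meas fL); have mg' := measurable_npow (inLp_meas gL).
have mfg' := measurable_npow (inLp_meas fgL).
pose c := e + K / 2; have c0 : 0 <= c by rewrite addr_ge0 ?(ltW e0)// divr_ge0.
(* Moving the subtracted term to the left leaves nonnegative integrands on both sides. *)
suff : (eN (fun x => (f x - g x)%R) + K%:E * eN (fun x => (2^-1 * (f x + g x))%R) <= c%:E * (eN f + eN g))%E.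
  rewrite (eN_fin fg) (eN_fin fgL) (eN_fin fL) (eN_fin gL) /c.
  set a := rN (fun x => _ - _); set b := rN (fun x => _ * _); set N1 := rN f; set N2 := rN g.
  move=> H; have {}H : a + K * b <= (e + K / 2) * (N1 + N2) by rewrite -lee_fin.
  rewrite -subr_ge0.
  have -> : e * (N1 + N2) + K * ((N1 + N2) / 2 - b) - a = (e + K / 2) * (N1 + N2) - (a + K * b) by field.
  by rewrite subr_ge0.
rewrite /eN -ge0_integralZl_EFin//; try first [by move=> x _; rewrite lee_fin powR_ge0 | by exact: measurable_funTS].
rewrite -ge0_integralD//; try first [by move=> x _; rewrite lee_fin powR_ge0 | by apply: measurable_funTS; apply: measurable_npow; exact: inLp_meas fg | by move=> x _; rewrite -EFinM lee_fin mulr_ge0// powR_ge0 | by apply: measurable_funTS; apply: emeasurable_funM].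
rewrite -ge0_integralD//; try first [by move=> x _; rewrite lee_fin powR_ge0 | by exact: measurable_funTS | by move=> x _; rewrite lee_fin powR_ge0 | by exact: measurable_funTS].
rewrite -ge0_integralZl_EFin//; try first [by move=> x _; rewrite -EFinD lee_fin addr_ge0 ?powR_ge0 | by apply: measurable_funTS; apply: emeasurable_funD].
apply: ge0_le_integral => //.
- by move=> x _; rewrite -EFinM -EFinD lee_fin addr_ge0 ?mulr_ge0 ?powR_ge0.
- apply: measurable_funTS; apply: emeasurable_funD; last by apply: emeasurable_funM.
  by apply: measurable_npow; exact: inLp_meas fg.
- by apply: measurable_funTS; apply: emeasurable_funM => //; apply: emeasurable_funD.
move=> x _.
have := HK (f x) (g x); set a := `|f x| `^ p; set b := `|g x| `^ p.
set A := `|f x - g x| `^ p; set B := `|2^-1 * _| `^ p => H.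
suff : A + K * B <= c * (a + b) by rewrite -lee_fin.
rewrite -subr_ge0.
have -> : c * (a + b) - (A + K * B) = e * (a + b) + K * ((a + b) / 2 - B) - A by rewrite /c; field.
by rewrite subr_ge0.
Qed.

(** For fixed [x], the number [f x - avg f] is the mean over [y] of [f x - f y]; the bound of a mean
    by the norm, raised to the power [p], is then integrated in [x]. *)
Lemma poincare f : inLp T p f ->
  (eN (fun x => (f x - avg T f)%R) <= ((volc / T ^+ d) `^ p)%:E * F0 T p f)%E.
Proof.
move=> fL; have [mf _ Nf] := (inLpP f).1 fL.
have Td : 0 < T ^+ d by exact: exprn_gt0.
have v0 := volc_gt0.
rewrite F0E// -ge0_integralZl_EFin ?powR_ge0//; try first [by move=> x _; apply: integral_ge0 => y _; exact: dpow_ge0 | by apply: measurable_funTS; exact: measurable_F0_inner].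
apply: ge0_le_integral => //.
- by apply: measurable_funTS; apply: measurable_npow; apply: measurable_funB.
- by apply: measurable_funTS; apply: emeasurable_funM => //; exact: measurable_F0_inner.
move=> x _; pose g := fun y => f x - f y.
have gL : inLp T p g by apply: inLp_sub => //; exact: inLp_cst.
have -> : (\int[m]_(y in Q) dpow p f (x, y))%E = eN g by [].
have E : f x - avg T f = Iq g / T ^+ d.
  have : Iq g = -1 * Iq f + Iq (fun=> f x).
    rewrite -Iq_lin//; last exact: inLp_cst.
    by congr Iq; apply/funext => y; rewrite /g; ring.
  move=> ->; rewrite avgE//.
  have -> : Iq (fun=> f x) = f x * T ^+ d.
    by rewrite /Iq; have := integral_cst m mQ (f x)%:E; rewrite /= mu_Q// => ->.
  by field; rewrite gt_eqF.
rewrite (eN_fin gL) -EFinM lee_fin E normrM normfV (gtr0_norm Td).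
apply: (@le_trans _ _ ((volc * rN g `^ p^-1 / T ^+ d) `^ p)).
  rewrite ge0_ler_powR ?nnegrE ?(ltW p0)// ?divr_ge0 ?mulr_ge0 ?powR_ge0 ?(ltW v0) ?(ltW Td)//.
  by rewrite ler_pM2r ?invr_gt0// Iq_bound.
have vT : 0 <= volc / T ^+ d by rewrite divr_ge0// ltW.
rewrite mulrAC (powRM _ vT (powR_ge0 _ _)).
by rewrite -powRrM mulVf ?gt_eqF// powRr1// rN_ge0.
Qed.

End Lp.

Section sequences.
Context {R : realType}.

Lemma limn_einf_le_bound (v : nat -> \bar R) (c : \bar R) :
  (forall n, v n <= c)%E -> (limn_einf v <= c)%E.
Proof.
move=> vc; rewrite limn_einf_lim; apply: lime_le; first exact: is_cvg_einfs.
apply: nearW => n; apply: (le_trans _ (vc n)).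
by apply: ereal_inf_lbound; exists n => /=.
Qed.

Lemma limn_einf_ge_near (v : nat -> \bar R) (c : \bar R) :
  (\forall n \near \oo, c <= v n)%E -> (c <= limn_einf v)%E.
Proof.
move=> [N _ vc]; rewrite limn_einf_lim; apply: lime_ge; first exact: is_cvg_einfs.
exists N => // n Nn; apply: le_ereal_inf_tmp => _ [k /= nk <-].
by apply: vc; exact: (leq_trans Nn nk).
Qed.

Lemma limn_esup_le_near (v : nat -> \bar R) (c : \bar R) :
  (\forall n \near \oo, v n <= c)%E -> (limn_esup v <= c)%E.
Proof.
move=> vc; rewrite -leeN2 -limn_einfN; apply: limn_einf_ge_near.
by apply: filterS vc => n; rewrite /= leeN2.
Qed.

Lemma measurable_fun_limn_einf d (X : measurableType d) (D : set X) (f : nat -> X -> \bar R) :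
  (forall n, measurable_fun D (f n)) -> measurable_fun D (fun x => limn_einf (f^~ x)).
Proof.
move=> mf; rewrite (_ : (fun x => _) = (fun x => - limn_esup (fun n => - f n x))%E); last first.
  by apply/funext => x; rewrite (limn_esupN (f^~ x)) oppeK.
apply: measurableT_comp => //.
by apply: measurable_fun_limn_esup => n; exact: measurableT_comp.
Qed.

Lemma cvg_of_summable (y : nat -> R) :
  (\sum_(0 <= j <oo) `|y j.+1 - y j|%:E < +oo)%E -> cvgn y.
Proof.
set S := (\sum_(0 <= j <oo) _)%E => Sfin.
have S0 : (0 <= S)%E by apply: nneseries_ge0 => n _ _; rewrite lee_fin.
have cn : cvgn (series (fun j => `|y j.+1 - y j|)).
  apply: nondecreasing_is_cvgn.
    by apply: nondecreasing_series => n _ _.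
  exists (fine S) => _ [n _ <-].
  rewrite -lee_fin fineK ?ge0_fin_numE// /series/= -sumEFin.
  by apply: nneseries_lim_ge => k _ _; rewrite lee_fin.
have := normed_cvg cn; rewrite /series/= => -/cvg_ex[l cl].
apply/cvg_ex; exists (y 0%N + l).
have : (fun n => y 0%N + \sum_(0 <= k < n) (y k.+1 - y k)) @ \oo --> y 0%N + l.
  by apply: cvgD; [exact: cvg_cst|exact: cl].
rewrite (_ : (fun n => _) = y)//; apply/funext => n.
by rewrite telescope_sumr// addrC subrK.
Qed.

Lemma sum_half (n : nat) : \sum_(0 <= j < n) (2^-1 : R) ^+ j = 2 - 2 * (2^-1) ^+ n.
Proof.
elim: n => [|n IH]; first by rewrite big_nil expr0; lra.
by rewrite big_nat_recr//= IH exprS; field.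
Qed.

End sequences.

(** * Completeness of the space and bounded sequences *)

Section completeness.
Context {R : realType} (d : nat) (T p : R).
Hypotheses (T0 : 0 < T) (p1 : 1 <= p).
Local Notation m := (@mu R d).
Local Notation Q := (cube d (side T)).
Local Notation fct := (d.-tuple R -> R).
Local Notation rN := (@rN R d T p).
Local Notation eN := (@eN R d T p).

Let p0 : 0 < p. Proof. exact: lt_le_trans ltr01 p1. Qed.
Let mQ : measurable Q. Proof. exact: measurable_Q. Qed.

(** The increments have geometrically decreasing [L^1] norms on [Q], so their series converges
    absolutely at almost every point of [Q]. *)
Lemma inLp_ae_cvg (y : nat -> fct) : (forall n, inLp T p (y n)) ->
  (forall j, rN (fun z => y j.+1 z - y j z) <= ((2^-1) ^+ j) `^ p) ->
  {ae m, forall z, Q z -> cvgn (fun j => y j z)}.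
Proof.
move=> yL Hy.
pose w j z := `|y j.+1 z - y j z|%:E.
have mw j : measurable_fun setT (w j).
  apply/measurable_EFinP; apply: (measurableT_comp (@normr_measurable R setT)).
  by apply: measurable_funB; exact: inLp_meas (yL _).
have w0 j z : (0 <= w j z)%E by rewrite lee_fin.
have Ib j : (\int[m]_(z in Q) w j z <= (volc d T * (2^-1) ^+ j)%:E)%E.
  have dL := inLp_sub p1 (yL j.+1) (yL j).
  have [mdl _ Ndl] := (inLpP _ _ _).1 dL.
  apply: (le_trans (integral_norm_le T0 p1 mdl Ndl)); rewrite lee_fin ler_wpM2l ?(ltW (volc_gt0 _ _))//.
  apply: (@le_trans _ _ ((((2^-1) ^+ j) `^ p) `^ p^-1)).
    by rewrite ge0_ler_powR ?nnegrE ?invr_ge0 ?(ltW p0) ?rN_ge0 ?powR_ge0.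
  by rewrite -powRrM mulfV ?gt_eqF// powRr1// exprn_ge0// invr_ge0.
have mS : measurable_fun Q (fun z => \sum_(0 <= j <oo) w j z)%E.
  apply: ge0_emeasurable_sum => // j _; exact: measurable_funTS.
have IS : (\int[m]_(z in Q) (\sum_(0 <= j <oo) w j z) < +oo)%E.
  rewrite integral_nneseries//; last by move=> j; exact: measurable_funTS.
  apply: (@le_lt_trans _ _ (volc d T * 2)%:E); last exact: ltry.
  apply: lime_le; first by apply: is_cvg_nneseries => j _ _; exact: integral_ge0.
  apply: nearW => n; apply: (@le_trans _ _ (\sum_(0 <= j < n) (volc d T * (2^-1) ^+ j)%:E)%E).
    by apply: lee_sum.
  rewrite sumEFin lee_fin -mulr_sumr ler_wpM2l ?(ltW (volc_gt0 _ _))// sum_half lerBlDr lerDl.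
  by rewrite mulr_ge0// exprn_ge0// invr_ge0.
have : m.-integrable Q (fun z => \sum_(0 <= j <oo) w j z)%E.
  apply/integrableP; split => //.
  under eq_integral do rewrite gee0_abs ?nneseries_ge0//.
  exact: IS.
move=> /(integrable_ae mQ); apply: ae_imp => z Hz Qz.
apply: cvg_of_summable.
by have := Hz Qz; rewrite ge0_fin_numE//; apply: nneseries_ge0.
Qed.

Lemma inLp_complete (x : nat -> fct) : (forall n, inLp T p (x n)) ->
  (forall e, 0 < e -> exists n, forall j k, (n <= j)%N -> (n <= k)%N ->
     rN (fun z => x j z - x k z) <= e) ->
  exists2 u, inLp T p u & forall e, 0 < e -> exists n, forall k, (n <= k)%N ->
     rN (fun z => x k z - u z) <= e.
Proof.
move=> xL cauchy.
have ej j : exists n, forall a b, (n <= a)%N -> (n <= b)%N ->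
    rN (fun z => x a z - x b z) <= ((2^-1) ^+ j) `^ p.
  by apply: cauchy; rewrite powR_gt0// exprn_gt0// invr_gt0.
have [kap Hkap] := choice ej.
(* The maximum puts [K j] beyond all of [kap 0, ..., kap j], and the summand [j] sends it to
   infinity. *)
pose K j := (\max_(i < j.+1) kap i + j)%N.
have K_ge i j : (i <= j)%N -> (kap i <= K j)%N.
  move=> ij; apply: leq_trans (leq_addr _ _).
  exact: (@leq_bigmax _ (fun i : 'I_j.+1 => kap i) (Ordinal (ij : i < j.+1)%N)).
pose y j := x (K j).
have yL j : inLp T p (y j) by exact: xL.
have aec : {ae m, forall z, Q z -> cvgn (fun j => y j z)}.
  by apply: inLp_ae_cvg => // j; apply: Hkap; apply: K_ge => //; exact: leqW.
(* Convergence is known only on [Q]; an upper limit is defined everywhere, measurable, and inherits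
   periodicity from the sequence. *)
pose u z : R := fine (limn_esup (fun j => (y j z)%:E)).
have muu : measurable_fun setT u.
  apply: (measurableT_comp (@fine_measurable _ setT measurableT)).
  by apply: measurable_fun_limn_esup => n; apply/measurable_EFinP; exact: inLp_meas (yL n).
have uE z : cvgn (fun j => y j z) -> (fun j => y j z) @ \oo --> u z.
  move=> /cvg_ex[l cl]; suff -> : u z = l by [].
  rewrite /u; have : (fun j => (y j z)%:E) @ \oo --> l%:E by apply: cvg_EFin => //; exact: nearW.
  by move=> /cvg_limn_einf_sup[_ ->].
have pu : ae_periodic T u.
  move=> i; have : {ae m, forall z, forall j, y j (shift T i z) = y j z}.
    by apply/ae_foralln => j; exact: (inLp_per (yL j)).
  by apply: ae_imp => z Hz; rewrite /u; congr (fine (limn_esup _)); apply/funext => j; rewrite Hz.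
have main e : 0 < e -> exists n, forall k, (n <= k)%N -> (eN (fun z => (x k z - u z)%R) <= e%:E)%E.
  move=> e0; have [n Hn] := cauchy e e0.
  pose N := n; have HN j : (n <= K (j + N))%N.
    exact: leq_trans (leq_addl j n) (leq_addl _ _).
  exists n => k nk.
  have xkL := xL k.
  pose g j z := (`|x k z - y (j + N)%N z| `^ p)%:E.
  have mg j : measurable_fun setT (g j).
    by apply: measurable_npow; apply: measurable_funB; [exact: inLp_meas xkL|exact: inLp_meas (yL _)].
  have g0 j z : (0 <= g j z)%E by rewrite lee_fin powR_ge0.
  (* Fatou's lemma transfers the Cauchy estimate to the limit. *)
  apply: (@le_trans _ _ (\int[m]_(z in Q) limn_einf (g^~ z))%E).
    apply: ae_ge0_le_integral => //.
    - by apply: measurable_funTS; apply: measurable_npow; apply: measurable_funB => //; exact: inLp_meas xkL.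
    - by move=> z _; apply: limn_einf_ge_near; exact: nearW.
    - apply: measurable_funTS; apply: measurable_fun_limn_einf => j; exact: mg.
    apply: ae_imp aec => z Hz Qz.
    have c1 : (fun j => y (j + N)%N z) @ \oo --> u z by rewrite (cvg_shiftn N (fun j => y j z)); exact: uE (Hz Qz).
    have c2 : (fun j => g j z) @ \oo --> (`|x k z - u z| `^ p)%:E.
      apply: cvg_EFin; first exact: nearW.
      apply: (@cvg_comp _ _ _ (fun j => x k z - y (j + N)%N z) (fun t : R => `|t| `^ p) _ (nbhs (x k z - u z))).
        by apply: cvgB => //; exact: cvg_cst.
      exact: continuous_normpow.
    by have [-> _] := cvg_limn_einf_sup c2.
  apply: (le_trans (fatou m mQ (fun j => measurable_funTS (mg j)) (fun j z _ => g0 j z))).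
  apply: limn_einf_le_bound => j.
  have dL := inLp_sub p1 xkL (yL (j + N)%N).
  by rewrite -/(eN (fun z => (x k z - y (j + N)%N z)%R)) (eN_fin dL) lee_fin Hn.
have uL : inLp T p u.
  apply/inLpP; split => //.
  have [n Hn] := main 1 ltr01.
  have := eN_lin T p1 (-1) (_ : measurable_fun setT (fun z => x n z - u z)) (inLp_meas (xL n)).
  have mxu : measurable_fun setT (fun z => x n z - u z).
    by apply: measurable_funB => //; exact: inLp_meas (xL n).
  move=> /(_ mxu).
  rewrite (_ : (fun z => -1 * (x n z - u z) + x n z) = u); last by apply/funext => z; ring.
  move=> H; apply: (le_lt_trans H); rewrite (eN_fin (xL n)).
  have F : eN (fun z => x n z - u z) \is a fin_num.
    by rewrite ge0_fin_numE ?eN_ge0// (le_lt_trans (Hn n (leqnn n)))// ltry.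
  by rewrite -(fineK F) -EFinM ltry.
exists u => // e e0; have [n Hn] := main e e0; exists n => k nk.
by rewrite -lee_fin -(eN_fin (inLp_sub p1 (xL k) uL)); exact: Hn.
Qed.

Lemma bounded_weak_subsequence (v : nat -> fct) (M : R) : 1 < p ->
  (forall n, inLp T p (v n)) -> (forall n, rN (v n) <= M) ->
  exists phi : nat -> nat, {homo phi : a b / (a < b)%N >-> (a < b)%N} /\
  exists2 u, inLp T p u & weak_conv T p (fun k => v (phi k)) u.
Proof.
move=> p1' vL vM.
have [||||||||phi [phi_lt [u uL Hu]]] := @weak_sequential_compactness R
   (fct : lmodType R) (inLp T p) rN (2 `^ p) _ _ _ _ _ _ _ _ v M vL vM.
- by move=> a f g fL gL; exact: (inLp_lin p1 a fL gL).
- exact: (@inLp_cst R d T p T0 0).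
- by move=> f; exact: rN_ge0.
- by move=> f; exact: rN_opp.
- by rewrite -[leLHS](@one_powR R p) ge0_ler_powR ?nnegrE ?(ltW p0)// ler1n.
- by move=> f g fL gL; exact: (rN_add p1 fL gL).
- move=> e e0; have [K K0 HK] := @Lp_uniform_convexity R d T p T0 p1 e p1' e0.
  by exists K => // f g fL gL; exact: HK.
- by move=> x xL cx; exact: inLp_complete.
exists phi; split => //; exists u => // L LD; apply: Hu.
  by move=> a f g fL gL; exact: (LD.1 a f g fL gL).
by move=> e e0; exact: (dual_continuous p1 LD e0).
Qed.

End completeness.

(** * Lower semicontinuity *)

Lemma measurable_sg (R : realType) : measurable_fun setT (fun x : measurableTypeR R => Num.sg x : measurableTypeR R).
Proof.
rewrite (_ : (fun x => _) = (fun x : R => \1_(`]0, +oo[%classic) x - \1_(`]-oo, 0[%classic) x)).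
  by apply: measurable_funB; apply: measurable_indic.
apply/funext => x; rewrite !indicE !mem_setE !in_itv/= andbT.
by case: (ltgtP x 0) => [x0|x0|->]; rewrite ?sgr0 ?subr0 ?sub0r ?(ltr0_sg x0) ?(gtr0_sg x0).
Qed.

Section lower_semicontinuity.
Context {R : realType} (d : nat) (T p : R).
Hypotheses (T0 : 0 < T) (p1 : 1 <= p).
Local Notation m := (@mu R d).
Local Notation Q := (cube d (side T)).
Local Notation fct := (d.-tuple R -> R).
Local Notation mm := (m \x m)%E.
Local Notation QQ := (Q `*` Q).
Local Notation pair := (d.-tuple R * d.-tuple R)%type.

Let p0 : 0 < p. Proof. exact: lt_le_trans ltr01 p1. Qed.
Let mQ : measurable Q. Proof. exact: measurable_Q. Qed.
Let mQQ : measurable QQ. Proof. exact: measurableX. Qed.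

Lemma integral_QQ (f : pair -> \bar R) : measurable_fun setT f -> (forall z, 0 <= f z)%E ->
  (\int[mm]_(z in QQ) f z = \int[m]_(x in Q) \int[m]_(y in Q) f (x, y))%E.
Proof.
move=> mf f0; rewrite integral_mkcond.
have mh : measurable_fun setT (f \_ QQ).
  by apply/(measurable_restrictT _ _).1 => //; exact: measurable_funTS.
have h0 z : (0 <= (f \_ QQ) z)%E by rewrite patchE; case: ifP.
rewrite fubini_tonelli1// [RHS]integral_mkcond; apply: eq_integral => x _.
rewrite /fubini_F patchE; case: ifPn => xQ.
  rewrite [RHS]integral_mkcond; apply: eq_integral => y _.
  by rewrite !patchE in_setX/= xQ.
rewrite (eq_integral (fun=> 0%E)) ?integral0// => y _.
by rewrite patchE in_setX/= (negbTE xQ).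
Qed.

Lemma F0_QQ (u : fct) : measurable_fun setT u -> F0 T p u = (\int[mm]_(z in QQ) dpow p u z)%E.
Proof.
by move=> muu; rewrite F0E// integral_QQ//; [exact: measurable_dpow|exact: dpow_ge0].
Qed.

Lemma mm_QQ : mm QQ = (T ^+ d * T ^+ d)%:E.
Proof.
have E : (m Q * m Q)%E = (T ^+ d * T ^+ d)%:E :> \bar R by rewrite !mu_Q// EFinM.
by rewrite -E; exact: product_measure1E.
Qed.

Lemma integral_QQ_fst (g : fct) : measurable_fun setT g ->
  (\int[mm]_(z in QQ) `|g z.1|%:E = (T ^+ d)%:E * \int[m]_(x in Q) `|g x|%:E)%E.
Proof.
move=> mg; have mg' : measurable_fun setT (fun x => `|g x|%:E).
  by apply/measurable_EFinP; exact: (measurableT_comp (@normr_measurable R setT)).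
rewrite integral_QQ//; last by apply: (measurableT_comp mg').
rewrite -ge0_integralZl_EFin//; [|exact: measurable_funTS|by rewrite exprn_ge0// ltW].
apply: eq_integral => x _ /=.
by have := integral_cst m mQ `|g x|%:E; rewrite /= mu_Q// => ->; rewrite muleC.
Qed.

Lemma integral_QQ_snd (g : fct) : measurable_fun setT g ->
  (\int[mm]_(z in QQ) `|g z.2|%:E = (T ^+ d)%:E * \int[m]_(x in Q) `|g x|%:E)%E.
Proof.
move=> mg; have mg' : measurable_fun setT (fun x => `|g x|%:E).
  by apply/measurable_EFinP; exact: (measurableT_comp (@normr_measurable R setT)).
rewrite integral_QQ//; last by apply: (measurableT_comp mg').
rewrite /= (_ : (\int[m]_(x in Q) \int[m]_(y in Q) _)%E = (\int[m]_(x in Q) (fun=> \int[m]_(y in Q) `|g y|%:E) x)%E)//.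
rewrite muleC -mu_Q//.
exact: integral_cst.
Qed.

Section bounded_kernel.
Variables (h : pair -> R) (H : R).
Hypotheses (mh : measurable_fun setT h) (hH : forall z, `|h z| <= H).

Let H0 : 0 <= H. Proof. exact: le_trans (normr_ge0 _) (hH (nseq_tuple d 0, nseq_tuple d 0)). Qed.

Let mhg (g : fct) : measurable_fun setT g ->
  measurable_fun setT (fun z : pair => (h z * (g z.1 - g z.2))%:E).
Proof.
move=> mg; apply/measurable_EFinP; apply: measurable_funM => //; apply: measurable_funB.
  by apply: (measurableT_comp mg).
by apply: (measurableT_comp mg).
Qed.

Let hg_bound (g : fct) : inLp T p g ->
  (\int[mm]_(z in QQ) `|(h z * (g z.1 - g z.2))%R|%:E <=
     (H * (2 * T ^+ d * volc d T) * rN T p g `^ p^-1)%:E)%E.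
Proof.
move=> gL; have mg := inLp_meas gL; have [_ _ Ng] := (inLpP _ _ _).1 gL.
have mg1 : measurable_fun setT (fun z : pair => `|g z.1|%:E).
  apply/measurable_EFinP; apply: (measurableT_comp (@normr_measurable R setT)).
  by apply: (measurableT_comp mg).
have mg2 : measurable_fun setT (fun z : pair => `|g z.2|%:E).
  apply/measurable_EFinP; apply: (measurableT_comp (@normr_measurable R setT)).
  by apply: (measurableT_comp mg).
apply: (@le_trans _ _ (\int[mm]_(z in QQ) (H%:E * (`|g z.1|%:E + `|g z.2|%:E)))%E).
  apply: ge0_le_integral => //.
  - apply: measurable_funTS; apply/measurable_EFinP; apply: (measurableT_comp (@normr_measurable R setT)).
    by apply/measurable_EFinP; exact: mhg.
  - by apply: measurable_funTS; apply: emeasurable_funM => //; exact: emeasurable_funD.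
  move=> z _; rewrite -EFinD -EFinM lee_fin normrM.
  by apply: ler_pM => //; exact: ler_normB.
rewrite ge0_integralZl_EFin//; try first [by apply: measurable_funTS; exact: emeasurable_funD | by move=> z _; rewrite -EFinD lee_fin addr_ge0].
rewrite ge0_integralD//; [|exact: measurable_funTS|exact: measurable_funTS].
rewrite integral_QQ_fst// integral_QQ_snd//.
have Ig := integral_norm_le T0 p1 mg Ng.
have Td : 0 <= T ^+ d by rewrite exprn_ge0// ltW.
set I := (\int[m]_(x in Q) _)%E in Ig *.
have I0 : (0 <= I)%E by exact: integral_ge0.
have If : I \is a fin_num by rewrite ge0_fin_numE// (le_lt_trans Ig)// ltry.
move: Ig; rewrite -(fineK If) lee_fin => Ig.
suff : H * (T ^+ d * fine I + T ^+ d * fine I) <= H * (2 * T ^+ d * volc d T) * rN T p g `^ p^-1.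
  by rewrite -lee_fin.
rewrite -mulrA ler_wpM2l//.
rewrite (_ : _ + _ = 2 * T ^+ d * fine I); last by ring.
by rewrite -[leRHS]mulrA ler_wpM2l// mulr_ge0.
Qed.

Let hg_int (g : fct) : inLp T p g -> mm.-integrable QQ (fun z => (h z * (g z.1 - g z.2))%:E).
Proof.
move=> gL; apply/integrableP; split; first by apply: measurable_funTS; apply: mhg; exact: inLp_meas gL.
exact: le_lt_trans (hg_bound gL) (ltry _).
Qed.

(** The linear part of the affine functionals below [F0]; a bounded [h] makes it continuous for the
    [L^p] norm. *)
Definition pairing (g : fct) : R := fine (\int[mm]_(z in QQ) (h z * (g z.1 - g z.2))%:E)%E.

Lemma EFin_pairing (g : fct) : inLp T p g ->
  (\int[mm]_(z in QQ) (h z * (g z.1 - g z.2))%:E)%E = (pairing g)%:E.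
Proof. by move=> gL; rewrite fineK//; apply: integrable_fin_num => //; exact: hg_int. Qed.

Lemma pairing_integrable (g : fct) : inLp T p g ->
  mm.-integrable QQ (fun z => (h z * (g z.1 - g z.2))%:E).
Proof. exact: hg_int. Qed.

Lemma pairing_dual : Lp_dual T p pairing.
Proof.
split => [a f g fL gL|].
  have If := hg_int fL; have Ig := hg_int gL.
  rewrite {1}/pairing (eq_integral (fun z => a%:E * (h z * (f z.1 - f z.2))%:E + (h z * (g z.1 - g z.2))%:E)%E); last first.
    by move=> z _; rewrite -EFinM -EFinD; congr EFin; ring.
  rewrite integralD//; last exact: integrableZl.
  by rewrite integralZl// !EFin_pairing// -EFinM -EFinD.
exists (H * (2 * T ^+ d * volc d T)) => g gL; rewrite Lpnorm_rN//.
rewrite -lee_fin -abse_EFin -EFin_pairing//.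
apply: (le_trans _ (hg_bound gL)).
apply: (le_abse_integral mm mQQ).
by apply: measurable_funTS; apply: mhg; exact: inLp_meas gL.
Qed.

End bounded_kernel.

Section truncation.
Variables (u : fct).
Hypothesis uL : inLp T p u.

Let mu' : measurable_fun setT u. Proof. exact: inLp_meas uL. Qed.

Definition low (M : R) : set pair := [set z | `|u z.1 - u z.2| <= M].

Lemma measurable_du : measurable_fun setT (fun z : pair => u z.1 - u z.2).
Proof. by apply: measurable_funB; apply: (measurableT_comp mu'). Qed.

Lemma measurable_low M : measurable (low M).
Proof.
rewrite (_ : low M = (fun z : pair => `|u z.1 - u z.2|) @^-1` `]-oo, M]); last first.
  by apply/seteqP; split => z /=; rewrite in_itv.
rewrite -[X in measurable X]setTI.
have : measurable_fun setT (fun z : pair => `|u z.1 - u z.2|).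
  apply: (measurableT_comp (@normr_measurable R setT)); exact: measurable_du.
by apply.
Qed.

Definition trunc (M : R) (z : pair) : R := \1_(low M) z * `|u z.1 - u z.2| `^ p.
(** The derivative of the p-th power at [u x - u y], cut off on the same set as [trunc]: bounded by
    [p M^(p-1)], and still paired with the right constant term. *)
Definition slope (M : R) (z : pair) : R :=
  \1_(low M) z * (p * (Num.sg (u z.1 - u z.2) * `|u z.1 - u z.2| `^ (p - 1))).

Lemma measurable_trunc M : measurable_fun setT (trunc M).
Proof.
apply: measurable_funM; first exact: measurable_indic (measurable_low M).
by apply/measurable_EFinP; exact: (measurable_dpow p mu').
Qed.

Lemma measurable_slope M : measurable_fun setT (slope M).
Proof.
have md := measurable_du.
apply: measurable_funM; first exact: measurable_indic (measurable_low M).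
apply: measurable_funM => //; apply: measurable_funM.
  by apply: (measurableT_comp _ md); exact: measurable_sg.
apply: (measurableT_comp (measurable_powR _)).
exact: (measurableT_comp (@normr_measurable R setT)).
Qed.

Lemma slope_bound M : 0 <= M -> forall z, `|slope M z| <= p * M `^ (p - 1).
Proof.
move=> M0 z; rewrite /slope normrM indicE.
case: (boolP (z \in low M)) => [|_]; last by rewrite normr0 mul0r mulr_ge0 ?(ltW p0) ?powR_ge0.
rewrite inE /low /= => zM; rewrite normr1 mul1r normrM (gtr0_norm p0) ler_wpM2l ?(ltW p0)//.
rewrite normrM [X in _ * X]ger0_norm ?powR_ge0//.
apply: (@le_trans _ _ (1 * `|u z.1 - u z.2| `^ (p - 1))).
  by rewrite ler_wpM2r ?powR_ge0// normr_sg; case: eqP.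
by rewrite mul1r ge0_ler_powR ?nnegrE ?subr_ge0.
Qed.

Lemma trunc_bound M : 0 <= M -> forall z, 0 <= trunc M z <= M `^ p.
Proof.
move=> M0 z; rewrite /trunc indicE.
case: (boolP (z \in low M)) => [|_]; last by rewrite mul0r lexx powR_ge0.
by rewrite inE /low /= => zM; rewrite mul1r powR_ge0 ge0_ler_powR ?nnegrE ?(ltW p0).
Qed.

Lemma trunc_integrable M : 0 <= M -> mm.-integrable QQ (EFin \o trunc M).
Proof.
move=> M0; apply/integrableP; split.
  by apply/measurable_EFinP; apply: measurable_funTS; exact: measurable_trunc.
apply: (@le_lt_trans _ _ (\int[mm]_(z in QQ) (M `^ p)%:E)%E).
  apply: ge0_le_integral => //.
  - apply: measurableT_comp => //; apply/measurable_EFinP; apply: measurable_funTS; exact: measurable_trunc.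
  - by move=> z _; rewrite /= lee_fin; case/andP: (trunc_bound M0 z) => t0 tM; rewrite ger0_norm.
by have := integral_cst mm mQQ (M `^ p)%:E; rewrite /= mm_QQ => ->; rewrite -EFinM ltry.
Qed.

Definition F0_trunc (M : R) : R := fine (\int[mm]_(z in QQ) (trunc M z)%:E)%E.

Lemma F0_subgradient M v : 0 <= M -> inLp T p v ->
  ((F0_trunc M + (pairing (slope M) v - pairing (slope M) u))%:E <= F0 T p v)%E.
Proof.
move=> M0 vL; have mv := inLp_meas vL.
rewrite F0_QQ//; have [->|Foo] := eqVneq (\int[mm]_(z in QQ) dpow p v z)%E +oo%E; first exact: leey.
have vuL := inLp_sub p1 vL uL.
have sb := slope_bound M0; have ms := measurable_slope M.
have If := pairing_integrable ms sb vuL.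
have It := trunc_integrable M0.
have Id : mm.-integrable QQ (dpow p v).
  apply/integrableP; split; first by apply: measurable_funTS; exact: measurable_dpow.
  rewrite (eq_integral (dpow p v)); first by rewrite ltey.
  by move=> z _; rewrite gee0_abs// dpow_ge0.
have -> : pairing (slope M) v - pairing (slope M) u = pairing (slope M) (fun x => v x - u x).
  have [Hlin _] := pairing_dual ms sb.
  rewrite (_ : (fun x => v x - u x) = (fun x => -1 * u x + v x)); last by apply/funext => x; ring.
  by rewrite Hlin//; ring.
have -> : (F0_trunc M + pairing (slope M) (fun x => v x - u x))%:E =
    (\int[mm]_(z in QQ) ((trunc M z)%:E + (slope M z * ((v z.1 - u z.1) - (v z.2 - u z.2)))%:E))%E.
  rewrite integralD// EFinD; congr (_ + _)%E; last by rewrite (EFin_pairing ms sb vuL).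
  by rewrite fineK//; apply: integrable_fin_num.
apply: le_integral => //; first exact: integrableD.
move=> z _; rewrite -EFinD lee_fin /trunc /slope indicE.
(* Off [low M] both the truncated value and the slope vanish, leaving a nonnegative right side. *)
case: (z \in low M); last by rewrite !mul0r addr0 powR_ge0.
rewrite !mul1r (_ : v z.1 - u z.1 - (v z.2 - u z.2) = (v z.1 - v z.2) - (u z.1 - u z.2)); last by ring.
exact: subgradient.
Qed.

Lemma F0_weak_lower M un : 0 <= M -> (forall n, inLp T p (un n)) -> weak_conv T p un u ->
  forall e, 0 < e -> \forall n \near \oo, ((F0_trunc M - e)%:E <= F0 T p (un n))%E.
Proof.
move=> M0 unL wc e e0.
have := wc _ (pairing_dual (measurable_slope M) (slope_bound M0)).
move=> /cvgrPdist_lt/(_ e e0); apply: filterS => n Hn.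
apply: (le_trans _ (F0_subgradient M0 (unL n))); rewrite lee_fin lerD2l.
by move: Hn; rewrite distrC ltr_norml => /andP[/ltW].
Qed.

Lemma F0_trunc_cvg : (fun k : nat => (F0_trunc k%:R)%:E) @ \oo --> F0 T p u.
Proof.
have E k : (F0_trunc k%:R)%:E = (\int[mm]_(z in QQ) (trunc k%:R z)%:E)%E.
  by rewrite fineK//; apply: integrable_fin_num => //; exact: trunc_integrable.
rewrite (funext E) F0_QQ//.
rewrite (_ : (\int[mm]_(z in QQ) dpow p u z)%E =
   (\int[mm]_(z in QQ) limn (fun k : nat => (trunc k%:R z)%:E))%E); last first.
  apply: eq_integral => z _; apply/esym/cvg_lim => //; apply: cvg_near_cst.
  exists (Num.trunc `|u z.1 - u z.2|).+1 => // k /= Hk.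
  rewrite /trunc indicE mem_set ?mul1r//= /low /=.
  apply: (le_trans (ltW (truncnS_gt _))); by rewrite ler_nat.
apply: cvg_monotone_convergence => //.
- by move=> k; apply: measurable_funTS; apply/measurable_EFinP; exact: measurable_trunc.
- by move=> k z _; rewrite lee_fin; case/andP: (trunc_bound (ler0n R k) z).
- move=> z _ i j ij; rewrite lee_fin /trunc ler_wpM2r ?powR_ge0// !indicE.
  case: (boolP (z \in low i%:R)) => // /set_mem zi; rewrite mem_set//.
  by apply: (le_trans zi); rewrite ler_nat.
Qed.

End truncation.

Lemma Gamma_liminf (s : nat -> R) (u : fct) (un : nat -> fct) : (0 < d)%N ->
  (forall n, 0 < s n < 1) -> s @ \oo --> 0 ->
  inLp T p u -> (forall n, inLp T p (un n)) -> weak_conv T p un u ->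
  (((d%:R * omega R d) / (p * T ^+ d))%:E * F0 T p u
      <= limn_einf (fun n => (s n)%:E * Fs T p (s n) (un n)))%E.
Proof.
move=> d0 s01 s0 uL unL wc; set c := _ / _; set X := limn_einf _.
have c0 : 0 < c.
  by rewrite divr_gt0// mulr_gt0 ?exprn_gt0 ?ltr0n// (@omegaE R d) ball_vol_gt0.
suff H k : (c%:E * (F0_trunc u k%:R)%:E <= X)%E.
  have cv : (fun k => c%:E * (F0_trunc u k%:R)%:E)%E @ \oo --> (c%:E * F0 T p u)%E.
    by apply: cvgeZl => //; exact: F0_trunc_cvg.
  rewrite -(cvg_lim _ cv)//; apply: lime_le; first by apply/cvg_ex; eexists; exact: cv.
  exact: nearW.
set a := F0_trunc u k%:R.
have a0 : 0 <= a.
  by rewrite fine_ge0//; apply: integral_ge0 => z _; rewrite lee_fin; case/andP: (trunc_bound u (ler0n R k) z).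
apply/lee_addgt0Pr => e e0.
(* Expanding, [(1 - t) c (a - t) >= c a - c (1 + a) t >= c a - e]; the bound [1/2] keeps [1 - t]
   positive. *)
pose t := Num.min 2^-1 (e / (c * (1 + a))).
have ca : 0 < c * (1 + a) by rewrite mulr_gt0// ltr_pwDl.
have t0 : 0 < t by rewrite lt_min invr_gt0 ltr0n/= divr_gt0.
have t1 : t <= 2^-1 by rewrite ge_min lexx.
have te : c * (1 + a) * t <= e.
  by rewrite mulrC -ler_pdivlMr// ge_min lexx orbT.
have [r [rD Hr]] := lower_constant p d s0 (diam_ge0 d T) t0.
suff : (((1 - t) * c * (a - t))%:E <= X)%E.
  move=> HX; apply: (le_trans _ (leeD2r e%:E HX)); rewrite -EFinM -EFinD lee_fin.
  have := mulr_ge0 (ltW c0) (mulr_ge0 (ltW t0) (ltW t0)).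
  by move: te; lra.
apply: limn_einf_ge_near.
near=> n.
have /andP[sn0 sn1] := s01 n.
have Hl : 1 - t <= (1 + diam d T / r) `^ (- (s n * p) - d%:R) * r `^ (- (s n * p)) by near: n.
have HF : ((a - t)%:E <= F0 T p (un n))%E.
  by near: n; exact: (F0_weak_lower uL (ler0n R k) unL wc t0).
have [mn pn _] := (inLpP _ _ _).1 (unL n).
have F00 : (0 <= F0 T p (un n))%E.
  by rewrite F0_QQ//; apply: integral_ge0 => z _; exact: dpow_ge0.
apply: (le_trans _ (Fs_lower T0 d0 p1 sn0 rD mn pn)).
apply: (@le_trans _ _ (((1 - t) * c)%:E * F0 T p (un n))%E).
  rewrite EFinM; apply: lee_wpmul2l => //; rewrite lee_fin mulr_ge0 ?(ltW c0)// subr_ge0.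
  by apply: (le_trans t1); lra.
apply: lee_wpmul2r => //; rewrite lee_fin ler_wpM2r//; exact: ltW.
Unshelve. all: by end_near. Qed.

End lower_semicontinuity.

(** * Compactness of sequences with bounded energy *)

Section compactness.
Context {R : realType} (d : nat) (T p : R).
Hypotheses (T0 : 0 < T) (p1 : 1 <= p).
Local Notation m := (@mu R d).
Local Notation Q := (cube d (side T)).
Local Notation fct := (d.-tuple R -> R).

Let p0 : 0 < p. Proof. exact: lt_le_trans ltr01 p1. Qed.
Let mQ : measurable Q. Proof. exact: measurable_Q. Qed.

Lemma avg_cst (c : R) : avg T (fun _ : d.-tuple R => c) = c.
Proof.
have Td : 0 < T ^+ d by exact: exprn_gt0.
rewrite (avgE T0 p1 (@inLp_cst R d T p T0 c)) /Iq.
by have := integral_cst m mQ c%:E; rewrite /= mu_Q// => ->; rewrite -EFinM/= mulfK// gt_eqF.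
Qed.

Lemma avg_sub_avg (f : fct) : inLp T p f -> avg T (fun x => f x - avg T f) = 0.
Proof.
move=> fL; have [lin _] := @avg_dual R d T p T0 p1.
rewrite (_ : (fun x => _) = (fun x => -1 * (fun=> avg T f) x + f x)); last by apply/funext => x; ring.
by rewrite lin//; [rewrite avg_cst; ring|exact: inLp_cst].
Qed.

Lemma compactness (s : nat -> R) (un : nat -> fct) (C : R) : (0 < d)%N ->
  (forall n, 0 < s n < 1) -> s @ \oo --> 0 -> p != 1 ->
  (forall n, inLp T p (un n)) ->
  (forall n, ((s n)%:E * Fs T p (s n) (un n) <= C%:E)%E) ->
  exists phi : nat -> nat, {homo phi : m n / (m < n)%N >-> (m < n)%N} /\
  exists u : fct, inLp T p u /\ avg T u = 0 /\
     weak_conv T p (fun k x => un (phi k) x - avg T (un (phi k))) u.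
Proof.
move=> d0 s01 s0 pn1 unL HC; set c := (d%:R * omega R d) / (p * T ^+ d).
have c0 : 0 < c.
  by rewrite divr_gt0// mulr_gt0 ?exprn_gt0 ?ltr0n// (@omegaE R d) ball_vol_gt0.
have p1' : 1 < p by rewrite lt_neqAle eq_sym pn1.
have h0 : 0 < 2^-1 :> R by rewrite invr_gt0.
have [r [rD [n0 _ Hr]]] := lower_constant p d s0 (diam_ge0 d T) h0.
pose A := 2^-1 * c; have A0 : 0 < A by exact: mulr_gt0.
have FB n : (n0 <= n)%N -> (F0 T p (un n) <= (C / A)%:E)%E.
  move=> nn; have /andP[sn0 _] := s01 n.
  have [mn pn _] := (inLpP _ _ _).1 (unL n).
  have F00 : (0 <= F0 T p (un n))%E.
    by rewrite F0_QQ//; apply: integral_ge0 => z _; exact: dpow_ge0.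
  have : (A%:E * F0 T p (un n) <= C%:E)%E.
    apply: (le_trans _ (HC n)); apply: (le_trans _ (Fs_lower T0 d0 p1 sn0 rD mn pn)).
    apply: lee_wpmul2r => //; rewrite lee_fin ler_wpM2r ?(ltW c0)//.
    by apply: (le_trans _ (Hr n nn)); lra.
  by rewrite -lee_pdivlMl// -EFinM mulrC.
(* The energy bound controls [F0] only from index [n0] on, so the first terms are dropped and the
   subsequence is shifted back at the end. *)
pose v k x := un (n0 + k)%N x - avg T (un (n0 + k)%N).
have vL k : inLp T p (v k) by apply: inLp_sub => //; exact: inLp_cst.
have vM k : rN T p (v k) <= (volc d T / T ^+ d) `^ p * (C / A).
  rewrite -lee_fin -(eN_fin (vL k)); apply: (le_trans (poincare T0 p1 (unL _))).
  by rewrite EFinM; apply: lee_wpmul2l; [rewrite lee_fin powR_ge0|apply: FB; exact: leq_addr].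
have [phi [phi_lt [u uL Hu]]] := bounded_weak_subsequence T0 p1 p1' vL vM.
exists (fun k => n0 + phi k)%N; split; first by move=> a b ab; rewrite ltn_add2l; exact: phi_lt.
exists u; split => //; split => //.
(* The mean is itself a bounded functional, so the weak limit inherits mean zero. *)
have := Hu _ (@avg_dual R d T p T0 p1).
rewrite (_ : (fun k => _) = fun=> 0); last by apply/funext => k; exact: (avg_sub_avg (unL _)).
by move=> H; have := cvg_unique _ H (cvg_cst (0 : R)); apply.
Qed.

End compactness.

(** * Density of Lipschitz functions *)

Section real_functions.
Context {R : realType}.
Implicit Types x y t a T : R.

Lemma sin_lip x y : `|sin x - sin y| <= `|x - y|.
Proof.
wlog xy : x y / x < y => [H|].
  by case: (ltgtP x y) => [|xy|->]; [exact: H|rewrite distrC [leRHS]distrC; exact: H|rewrite !subrr].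
rewrite distrC [leRHS]distrC.
have dS z : z \in `]x, y[%R -> is_derive z 1 (@sin R) (cos z) by move=> _; exact: is_derive_sin.
have cS : {within `[x, y], continuous (@sin R)}.
  by apply: continuous_subspaceT => z; exact: continuous_sin.
have [c _ ->] := MVT xy dS cS.
by rewrite normrM ler_piMl// cos_max.
Qed.

Lemma clamp_lip x y : `|Num.min 1 (Num.max 0 x) - Num.min 1 (Num.max 0 y)| <= `|x - y|.
Proof.
rewrite ler_norml; apply/andP.
have := ler_norm (x - y); have := ler_norm (- (x - y)); rewrite normrN.
by rewrite /Num.min /Num.max; do 4 (try case: ifPn); rewrite -?leNgt => *; split; lra.
Qed.

Lemma max_lip x y x' y' : `|Num.max x y - Num.max x' y'| <= `|x - x'| + `|y - y'|.
Proof.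
have := ler_norm (x - x'); have := ler_norm (- (x - x')); rewrite normrN.
have := ler_norm (y - y'); have := ler_norm (- (y - y')); rewrite normrN.
rewrite ler_norml => *; apply/andP.
by rewrite /Num.max; do 2 (case: ifPn); rewrite -?leNgt => *; split; lra.
Qed.

(* Positive exactly on [(a, T)] within [[0, T]], and [T]-periodic since both factors are [T]-antiperiodic. *)
Definition bump T a t := sin (pi * t / T) * sin (pi * (t - a) / T).

Lemma bump_periodic T a t : 0 < T -> bump T a (t + T) = bump T a t.
Proof.
move=> T0; have Tn : T != 0 by rewrite gt_eqF.
rewrite /bump (_ : pi * (t + T) / T = pi * t / T + pi); last by field.
rewrite (_ : pi * (t + T - a) / T = pi * (t - a) / T + pi); last by field.
by rewrite !sinDpi mulrNN.
Qed.

Lemma bump_lip T a t t' : 0 < T -> `|bump T a t - bump T a t'| <= (2 * pi / T) * `|t - t'|.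
Proof.
move=> T0; have Tn : T != 0 by rewrite gt_eqF.
have pT : 0 <= pi / T :> R by rewrite divr_ge0 ?pi_ge0 ?(ltW T0).
have H b : `|sin (pi * (t - b) / T) - sin (pi * (t' - b) / T)| <= pi / T * `|t - t'|.
  apply: (le_trans (sin_lip _ _)).
  rewrite (_ : _ - _ = pi / T * (t - t')); last by field.
  by rewrite normrM ger0_norm.
have H0 := H 0; rewrite !subr0 in H0.
rewrite /bump; set s1 := sin _; set s2 := sin _; set s1' := sin (pi * t' / T); set s2' := sin (pi * (t' - a) / T).
rewrite (_ : s1 * s2 - s1' * s2' = (s1 - s1') * s2 + s1' * (s2 - s2')); last by ring.
apply: (le_trans (ler_normD _ _)).
rewrite (_ : 2 * pi / T * _ = pi / T * `|t - t'| + pi / T * `|t - t'|); last by field.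
rewrite !normrM; apply: lerD.
  by apply: le_trans H0; rewrite ler_piMr// sin_max.
by apply: le_trans (H a); rewrite ler_piMl// sin_max.
Qed.

Lemma bump_gt0 T a t : 0 <= a -> a < t < T -> 0 < bump T a t.
Proof.
move=> a0 /andP[at' tT]; have T0 : 0 < T by apply: lt_trans tT; exact: le_lt_trans at'.
have pi0 : 0 < pi :> R by exact: pi_gt0.
have t0 : 0 < t by exact: le_lt_trans at'.
apply: mulr_gt0; apply: sin_gt0_pi.
  by rewrite divr_gt0 ?mulr_gt0//= ltr_pdivrMr// ltr_pM2l.
rewrite divr_gt0 ?mulr_gt0 ?subr_gt0//= ltr_pdivrMr// ltr_pM2l//.
by apply: le_lt_trans tT; rewrite gerBl.
Qed.

Lemma bump_le0 T a t : 0 <= t -> t <= a -> a < T -> bump T a t <= 0.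
Proof.
move=> t0 ta aT; have T0 : 0 < T by apply: le_lt_trans aT; exact: le_trans ta.
have pi0 : 0 < pi :> R by exact: pi_gt0.
have H z : 0 <= z < T -> 0 <= sin (pi * z / T).
  move=> /andP[z0 zT]; move: z0; rewrite le_eqVlt => /orP[/eqP <-|z0].
    by rewrite mulr0 mul0r sin0.
  by apply/ltW/sin_gt0_pi; rewrite divr_gt0 ?mulr_gt0//= ltr_pdivrMr// ltr_pM2l.
apply: mulr_ge0_le0; first by apply: H; rewrite t0 (le_lt_trans ta).
rewrite -[t - a]opprB mulrN mulNr sinN oppr_le0; apply: H.
by rewrite subr_ge0 ta/= (le_lt_trans _ aT)// gerBl.
Qed.

(** Clamping large multiples of [bump] keeps them periodic and Lipschitz, while on [[0, T[] they
    tend to the indicator of the set where [bump] is positive. *)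
Definition ray_approx T a (k : nat) t := Num.min 1 (Num.max 0 (k%:R * bump T a t)).

Lemma ray_approx_bound T a k t : 0 <= ray_approx T a k t <= 1.
Proof. by rewrite /ray_approx le_min ler01 le_max lexx ge_min lexx. Qed.

Lemma ray_approx_cvg T a t : 0 <= a < T -> 0 <= t < T ->
  (fun k => ray_approx T a k t) @ \oo --> ((a < t)%R%:R : R).
Proof.
move=> /andP[a0 aT] /andP[t0 tT]; apply: cvg_near_cst.
case: (ltP a t) => at'.
  have b0 : 0 < bump T a t by apply: bump_gt0 => //; rewrite at'.
  exists (Num.trunc (bump T a t)^-1).+1 => // k /= Hk.
  have : 1 <= k%:R * bump T a t.
    rewrite -ler_pdivrMr// mul1r; apply: (le_trans (ltW (truncnS_gt _))); by rewrite ler_nat.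
  by move=> H; rewrite /ray_approx max_r ?(le_trans _ H)// min_l.
have b0 : bump T a t <= 0 by exact: bump_le0.
apply: nearW => k; rewrite /ray_approx max_l ?min_r//.
by rewrite mulr_ge0_le0.
Qed.

Lemma continuous_lip (f : R -> R) (L : R) : 0 <= L -> (forall t t', `|f t - f t'| <= L * `|t - t'|) -> continuous f.
Proof.
move=> L0 H t; apply/cvgrPdist_le => e e0.
have d0 : 0 < e / (L + 1) by rewrite divr_gt0// ltr_wpDl.
exists (e / (L + 1)) => //= z Hz; apply: (le_trans (H _ _)).
apply: (@le_trans _ _ ((L + 1) * `|t - z|)); first by rewrite ler_wpM2r// lerDl.
rewrite mulrC -ler_pdivlMr ?ltr_wpDl//.
exact: ltW.
Qed.

End real_functions.

Section nice_functions.
Context {R : realType} (d : nat) (T p : R).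
Hypotheses (T0 : 0 < T) (p1 : 1 <= p).
Local Notation m := (@mu R d).
Local Notation Q := (cube d (side T)).
Local Notation fct := (d.-tuple R -> R).
Local Notation rN := (@rN R d T p).
Local Notation eN := (@eN R d T p).

Let p0 : 0 < p. Proof. exact: lt_le_trans ltr01 p1. Qed.
Let mQ : measurable Q. Proof. exact: measurable_Q. Qed.

Definition nice (g : fct) : Prop := [/\ measurable_fun setT g,
  forall i x, g (shift T i x) = g x,
  exists M, forall x, `|g x| <= M &
  exists2 L, 0 <= L & forall x y, `|g x - g y| <= L * enorm (vsub x y)].

Lemma nice_cst (c : R) : nice (fun=> c).
Proof.
split => //; first by exists `|c|.
by exists 0 => // x y; rewrite subrr normr0 mul0r.
Qed.

Lemma nice_lin (a : R) f g : nice f -> nice g -> nice (fun x => a * f x + g x).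
Proof.
move=> [mf pf [M fM] [L L0 fL]] [mg pg [N gN] [K K0 gK]]; split.
- by apply: measurable_funD => //; exact: measurable_funM.
- by move=> i x; rewrite pf pg.
- exists (`|a| * M + N) => x; apply: (le_trans (ler_normD _ _)).
  by rewrite normrM lerD// ler_wpM2l.
- exists (`|a| * L + K) => [|x y]; first by rewrite addr_ge0// mulr_ge0.
  rewrite (_ : _ - _ = a * (f x - f y) + (g x - g y)); last by ring.
  by rewrite (le_trans (ler_normD _ _))// mulrDl normrM lerD// -mulrA ler_wpM2l.
Qed.

Lemma nice_max f g : nice f -> nice g -> nice (fun x => Num.max (f x) (g x)).
Proof.
move=> [mf pf [M fM] [L L0 fL]] [mg pg [N gN] [K K0 gK]]; split.
- exact: measurable_maxr.
- by move=> i x; rewrite pf pg.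
- exists (M + N) => x; have := max_lip (f x) (g x) 0 0; rewrite maxxx !subr0 => H.
  by rewrite (le_trans H)// lerD.
- exists (L + K) => [|x y]; first by rewrite addr_ge0.
  by rewrite (le_trans (max_lip _ _ _ _))// mulrDl lerD.
Qed.

Lemma nice_ray a k (i : 'I_d) : nice (fun x => ray_approx T a k (tnth x i)).
Proof.
have H t t' : `|ray_approx T a k t - ray_approx T a k t'| <= (k%:R * (2 * pi / T)) * `|t - t'|.
  rewrite (le_trans (clamp_lip _ _))// -mulrBr normrM ger0_norm// -mulrA ler_wpM2l//.
  exact: bump_lip.
have L0 : 0 <= k%:R * (2 * pi / T) :> R by rewrite mulr_ge0// divr_ge0 ?mulr_ge0 ?pi_ge0 ?(ltW T0).
split.
- apply: (measurableT_comp _ (measurable_tnthR i)).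
  by apply: continuous_measurable_fun; exact: continuous_lip L0 H.
- move=> j x; rewrite /shift tnth_mktuple; case: eqP => _; last by rewrite addr0.
  by rewrite /ray_approx bump_periodic.
- by exists 1 => x; case/andP: (ray_approx_bound T a k (tnth x i)) => r0 r1; rewrite ger0_norm.
- exists (k%:R * (2 * pi / T)) => // x y; rewrite (le_trans (H _ _))// ler_wpM2l//.
  by have := ler_enorm_coord (vsub x y) i; rewrite tnth_mktuple.
Qed.

Lemma nice_inLp g : nice g -> inLp T p g.
Proof.
move=> [mg pg [M gM] _]; apply/inLpP; split => //; first by move=> i; apply: aeW => x; exact: pg.
have : (eN g <= \int[m]_(x in Q) (M `^ p)%:E)%E.
  apply: ge0_le_integral => //.
  - by apply: measurable_funTS; exact: measurable_npow.
  - by move=> x _; rewrite lee_fin ge0_ler_powR ?nnegrE ?(ltW p0)// (le_trans (normr_ge0 _) (gM x)).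
move=> H; apply: (le_lt_trans H).
by have := integral_cst m mQ (M `^ p)%:E; rewrite /= mu_Q// => ->; rewrite -EFinM ltry.
Qed.

End nice_functions.

Lemma mu_hyperplane {R : realType} (c : R) n (i : 'I_n) : mu n [set x : n.-tuple R | tnth x i = c] = 0%E.
Proof.
elim: n i => [|n IH] i; first by case: i.
have mN k (j : 'I_k) : measurable [set x : k.-tuple R | tnth x j = c].
  rewrite (_ : [set _ | _] = (fun x => tnth x j) @^-1` [set c])//.
  by rewrite -[X in measurable X]setTI; apply: measurable_tnthR.
rewrite integral_indicT; last exact: mN.
have mI : measurable_fun setT (fun x : n.+1.-tuple R => (\1_[set x | tnth x i = c] x)%:E : \bar R).
  by apply/measurable_EFinP; apply: measurable_indic; exact: mN.
rewrite ge0_integral_muS//.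
case: (unliftP ord0 i) mI => [j ->|->] mI.
  rewrite (eq_integral (fun=> 0%E)) ?integral0// => t _.
  transitivity (mu n [set x : n.-tuple R | tnth x j = c]); last exact: IH.
  rewrite integral_indicT; last exact: mN.
  apply: eq_integral => x _; congr (_%:E); rewrite !indicE; congr (_%:R); congr nat_of_bool.
  by apply/idP/idP; rewrite !inE /= tnthS.
rewrite (ae_eq_integral (fun=> 0%E)) ?integral0//.
- by apply: (measurable_int_slice measurableT mI).
exists [set c]; split => //; first exact: lebesgue_measure_set1.
move=> t /= H; apply: contrapT => tc; apply: H => _.
rewrite (eq_integral (fun=> 0%E)) ?integral0// => x _.
rewrite indicE memNset//= tnth0 => E; exact: tc.
Qed.

Import HBNNSimple.

(** * Approximation of indicators, simple functions and [L^p] functions *)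

Section density.
Context {R : realType} (d : nat) (T p : R).
Hypotheses (T0 : 0 < T) (p1 : 1 <= p).
Local Notation m := (@mu R d).
Local Notation Q := (cube d (side T)).
Local Notation fct := (d.-tuple R -> R).
Local Notation rN := (@rN R d T p).
Local Notation eN := (@eN R d T p).
Implicit Types f g h : fct.

Let p0 : 0 < p. Proof. exact: lt_le_trans ltr01 p1. Qed.
Let mQ : measurable Q. Proof. exact: measurable_Q. Qed.
Let two_p0 : 0 < 2 `^ p :> R. Proof. exact: powR_gt0. Qed.

Lemma eN_dominated f g h : measurable_fun setT f -> measurable_fun setT g -> measurable_fun setT h ->
  (forall x, `|f x| <= `|g x| + `|h x|) -> (eN f <= (2 `^ p)%:E * (eN g + eN h))%E.
Proof.
move=> mf mg mh H.
have abs k : eN (fun x => `|k x|) = eN k by apply: eq_integral => x _; rewrite normr_id.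
have mn (k : fct) : measurable_fun setT k -> measurable_fun setT (fun x => `|k x|).
  exact: (measurableT_comp (@normr_measurable R setT)).
have := eN_lin T p1 1 (mn _ mg) (mn _ mh); rewrite !abs normr1 powR1 mul1e.
apply: le_trans; apply: ge0_le_integral => //.
- by apply: measurable_funTS; exact: measurable_npow.
- apply: measurable_funTS; apply: measurable_npow.
  by apply: measurable_funD; [apply: measurable_funM => //|]; exact: mn.
move=> x _; rewrite lee_fin mul1r ge0_ler_powR ?nnegrE ?(ltW p0)//.
by rewrite (le_trans (H x))// ler_norm.
Qed.

(** Only the distance over [Q] matters, so [f] need not be periodic; half-space indicators can thus
    be approximated by periodic functions. *)
Definition approximable f := measurable_fun setT f /\
  forall e, 0 < e -> exists2 g, nice T g & (eN (fun x => (f x - g x)%R) <= e%:E)%E.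

Lemma approximable_nice g : nice T g -> approximable g.
Proof.
move=> gn; split; first by case: gn.
move=> e e0; exists g => //; rewrite (_ : eN _ = 0)%E ?lee_fin ?(ltW e0)//.
rewrite /eN (eq_integral (fun=> 0%E)) ?integral0// => x _.
by rewrite subrr normr0 powR0// gt_eqF.
Qed.

Lemma approximable_cst (c : R) : approximable (fun=> c).
Proof. exact: approximable_nice (@nice_cst R d T c). Qed.

Lemma approximable_of_near f : measurable_fun setT f ->
  (forall e, 0 < e -> exists2 g, approximable g & (eN (fun x => (f x - g x)%R) <= e%:E)%E) ->
  approximable f.
Proof.
move=> mf H; split=> // e e0.
have e'0 : 0 < e / (2 `^ p * 2) by rewrite divr_gt0// mulr_gt0.
have [g [mg Hg] fg] := H _ e'0; have [h hn gh] := Hg _ e'0; exists h => //.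
have mh : measurable_fun setT h by case: hn.
have := eN_dominated (measurable_funB mf mh) (measurable_funB mf mg) (measurable_funB mg mh).
move=> H'; apply: (le_trans (H' _)) => [x|].
  by rewrite (le_trans _ (ler_normD _ _))// addrA subrK.
apply: (le_trans (lee_wpmul2l _ (leeD fg gh))); first by rewrite lee_fin ltW.
by rewrite -EFinD -EFinM lee_fin le_eqVlt; apply/orP; left; apply/eqP; field; rewrite gt_eqF.
Qed.

Lemma approximable_lin (a : R) f g : approximable f -> approximable g ->
  approximable (fun x => a * f x + g x).
Proof.
move=> [mf Hf] [mg Hg]; split; first by apply: measurable_funD => //; exact: measurable_funM.
move=> e e0; pose c := 2 `^ p * (`|a| `^ p + 1).
have c0 : 0 < c by rewrite mulr_gt0// ltr_wpDl// powR_ge0.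
have e'0 : 0 < e / c by rewrite divr_gt0.
have [f' f'n ff] := Hf _ e'0; have [g' g'n gg] := Hg _ e'0.
exists (fun x => a * f' x + g' x); first exact: nice_lin.
have mf' : measurable_fun setT f' by case: f'n.
have mg' : measurable_fun setT g' by case: g'n.
have := eN_lin T p1 a (measurable_funB mf mf') (measurable_funB mg mg').
rewrite (_ : (fun x => _) = (fun x => a * f x + g x - (a * f' x + g' x))); last by apply/funext => x /=; ring.
move=> H; apply: (le_trans H).
have ap0 : (0 <= (`|a| `^ p)%:E)%E by rewrite lee_fin powR_ge0.
have tp0 : (0 <= (2 `^ p)%:E :> \bar R)%E by rewrite lee_fin ltW.
apply: (le_trans (lee_wpmul2l tp0 (leeD (lee_wpmul2l ap0 ff) gg))).
suff : 2 `^ p * (`|a| `^ p * (e / c) + e / c) <= e by rewrite -lee_fin.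
rewrite (_ : 2 `^ p * _ = c * (e / c)); last by rewrite /c; ring.
by rewrite mulrC divfK// gt_eqF.
Qed.

Lemma approximable_max f g : approximable f -> approximable g ->
  approximable (fun x => Num.max (f x) (g x)).
Proof.
move=> [mf Hf] [mg Hg]; split; first exact: measurable_maxr.
move=> e e0; have e'0 : 0 < e / (2 `^ p * 2) by rewrite divr_gt0// mulr_gt0.
have [f' f'n ff] := Hf _ e'0; have [g' g'n gg] := Hg _ e'0.
exists (fun x => Num.max (f' x) (g' x)); first exact: nice_max.
have mf' : measurable_fun setT f' by case: f'n.
have mg' : measurable_fun setT g' by case: g'n.
have H := eN_dominated (measurable_funB (measurable_maxr mf mg) (measurable_maxr mf' mg'))
  (measurable_funB mf mf') (measurable_funB mg mg').
apply: (le_trans (H _)) => [x|]; first exact: max_lip.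
apply: (le_trans (lee_wpmul2l _ (leeD ff gg))); first by rewrite lee_fin ltW.
by rewrite -EFinD -EFinM lee_fin le_eqVlt; apply/orP; left; apply/eqP; field; rewrite gt_eqF.
Qed.

Lemma approximable_dominated f (fn : nat -> fct) (G : d.-tuple R -> \bar R) :
  measurable_fun setT f -> (forall n, approximable (fn n)) -> m.-integrable Q G ->
  (forall x, Q x -> forall n, ((`|f x - fn n x| `^ p)%:E <= G x)%E) ->
  {ae m, forall x, Q x -> (fn n x) @[n --> \oo] --> f x} -> approximable f.
Proof.
move=> mf fnA GI domG cvgf; apply: approximable_of_near => // e e0.
pose w n x := (`|f x - fn n x| `^ p)%:E.
have mw n : measurable_fun Q (w n).
  by apply: measurable_funTS; apply: measurable_npow; apply: measurable_funB => //; case: (fnA n).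
have [||||_ _ H] := @dominated_convergence _ _ R m Q mQ w (fun=> 0%E) G mw.
- exact: measurable_cst.
- apply: ae_imp cvgf => x Hx Qx.
  have c1 : (fun n => `|f x - fn n x| `^ p) @ \oo --> `|f x - f x| `^ p.
    apply: (@cvg_comp _ _ _ (fun n => f x - fn n x) (fun t : R => `|t| `^ p) _ (nbhs (f x - f x))).
      by apply: cvgB; [exact: cvg_cst|exact: Hx].
    exact: continuous_normpow.
  move: c1; rewrite subrr normr0 powR0 ?gt_eqF// => c1.
  by apply: cvg_EFin => //; exact: nearW.
- exact: GI.
- apply: aeW => x n Qx; rewrite gee0_abs ?lee_fin ?powR_ge0//; exact: domG.
move: H; rewrite integral0 => /fine_cvgP[fw /cvgrPdist_lt/(_ e e0)] Hn.
have [N _ HN] : \forall n \near \oo, (eN (fun x => (f x - fn n x)%R) <= e%:E)%E.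
  near=> n; have /fineK <- : eN (fun x => f x - fn n x) \is a fin_num by near: n.
  rewrite lee_fin; have : `|0 - fine (eN (fun x => f x - fn n x))| < e by near: n.
  by rewrite sub0r normrN => /ltW; apply: le_trans; exact: ler_norm.
by exists (fn N) => //; exact: HN (leqnn N).
Unshelve. all: by end_near. Qed.

Let integrable_cst (c : R) : m.-integrable Q (fun=> c%:E).
Proof. exact: (inLp_integrable T0 p1 (@inLp_cst R d T p T0 c)). Qed.

Let bool_dist (b b' : bool) : `|(b%:R : R) - b'%:R| `^ p <= 1.
Proof.
by case: b; case: b'; rewrite ?subrr ?subr0 ?sub0r ?normrN ?normr0 ?normr1 ?powR1 ?powR0 ?gt_eqF.
Qed.

Lemma approximable_ray (i : 'I_d) (a : R) : approximable (\1_[set x | a < tnth x i] : fct).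
Proof.
have mr : measurable [set x : d.-tuple R | a < tnth x i].
  rewrite (_ : [set _ | _] = (fun x => tnth x i) @^-1` `]a, +oo[); last first.
    by apply/seteqP; split => x /=; rewrite in_itv/= andbT.
  by rewrite -[X in measurable X]setTI; apply: measurable_tnthR.
have mf : measurable_fun setT (\1_[set x | a < tnth x i] : fct) by exact: measurable_indic.
have E (x : d.-tuple R) : \1_[set x : d.-tuple R | a < tnth x i] x = (a < tnth x i)%R%:R :> R.
  by rewrite indicE; congr (_%:R); congr nat_of_bool; apply/idP/idP; rewrite inE.
(* On the face [tnth x i = T] periodicity forces the approximants to vanish, whereas the indicator
   is 1 when [a < T]; the face is discarded as a null set. *)
have ae_lt : {ae m, forall x, tnth x i != T}.
  exists [set x | tnth x i = T]; split => //; last by move=> x /= /negP; rewrite negbK => /eqP.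
    rewrite (_ : [set _ | _] = (fun x => tnth x i) @^-1` [set T])//.
    by rewrite -[X in measurable X]setTI; apply: measurable_tnthR.
  exact: mu_hyperplane.
have Qi x : Q x -> tnth x i != T -> 0 <= tnth x i < T.
  by move=> /(_ i); rewrite /side/= in_itv/= => /andP[-> h] /negbTE nT; rewrite lt_neqAle nT.
(* Unless [0 <= a < T], the indicator is almost everywhere constant on [Q]. *)
have [aT|Ta] := ltP a T; last first.
  apply: (@approximable_dominated _ (fun _ _ => 0) (fun=> 1%:E)) => //.
  - by move=> n; exact: approximable_cst.
  - by move=> x Qx n; rewrite E lee_fin; exact: (bool_dist _ false).
  apply: ae_imp ae_lt => x xT Qx; rewrite E ltNge.
  have /andP[_ /ltW xlT] := Qi _ Qx xT.
  by rewrite (le_trans xlT Ta); exact: cvg_cst.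
have [a0|a0] := ltP a 0.
  apply: (@approximable_dominated _ (fun _ _ => 1) (fun=> 1%:E)) => //.
  - by move=> n; exact: approximable_cst.
  - by move=> x Qx n; rewrite E lee_fin; exact: (bool_dist _ true).
  apply: ae_imp ae_lt => x xT Qx; rewrite E.
  have /andP[x0 _] := Qi _ Qx xT.
  by rewrite (lt_le_trans a0 x0); exact: cvg_cst.
apply: (@approximable_dominated _ (fun n x => ray_approx T a n (tnth x i)) (fun=> 1%:E)) => //.
- by move=> n; apply: approximable_nice; exact: nice_ray.
- move=> x Qx n; rewrite E lee_fin.
  rewrite -[leRHS](one_powR p) ge0_ler_powR ?nnegrE ?(ltW p0)//.
  have /andP[r0 r1] := ray_approx_bound T a n (tnth x i).
  have /andP[b0 b1] : 0 <= ((a < tnth x i)%R%:R : R) <= 1 by case: (a < _); rewrite ?lexx ?ler01.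
  by rewrite ler_norml; apply/andP; split; lra.
apply: ae_imp ae_lt => x xT Qx; rewrite E; apply: ray_approx_cvg; first by rewrite a0.
exact: Qi.
Qed.

Lemma approximable_setC A : approximable (\1_A : fct) -> approximable (\1_(~` A) : fct).
Proof.
move=> HA; have := approximable_lin (-1) HA (approximable_cst 1).
congr approximable; apply/funext => x; rewrite !indicE in_setC.
by case: (x \in A) => /=; ring.
Qed.

(** Indicators of finite unions are maxima of indicators; the countable union is their dominated
    limit. *)
Lemma approximable_bigcup (A : nat -> set (d.-tuple R)) : (forall n, measurable (A n)) ->
  (forall n, approximable (\1_(A n) : fct)) -> approximable (\1_(\bigcup_n A n) : fct).
Proof.
move=> mA HA; pose B n := \big[setU/set0]_(i < n) A i.
have HB n : approximable (\1_(B n) : fct).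
  elim: n => [|n IH].
    rewrite /B big_ord0 (_ : \1_set0 = fun=> 0); first exact: approximable_cst.
    by apply/funext => x; rewrite indicE in_set0.
  have := approximable_max IH (HA n); congr approximable; apply/funext => x.
  rewrite /B big_ord_recr/= !indicE in_setU.
  by case: (x \in \big[_/_]_(_ < _) _); case: (x \in A n); rewrite /= ?maxxx ?(max_l ler01) ?(max_r ler01).
apply: (@approximable_dominated _ (fun n => \1_(B n)) (fun=> 1%:E)) => //.
- by apply: measurable_indic; exact: bigcup_measurable.
- by move=> x Qx n; rewrite lee_fin !indicE bool_dist.
apply: aeW => x Qx; apply: cvg_near_cst; rewrite !indicE.
have [[k _ Akx]|nA] := pselect ((\bigcup_n A n) x).
  have Ux : (\bigcup_n A n) x by exists k.
  exists k.+1 => // n /= kn; have Bx : B n x by exact: (@bigsetU_sup _ k).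
  by rewrite indicE (mem_set Ux) (mem_set Bx).
apply: nearW => n; rewrite !indicE !memNset//.
by rewrite /B -bigcup_mkord => -[k /= kn Akx]; apply: nA; exists k.
Qed.

Lemma approximable_measurable A : measurable A -> approximable (\1_A : fct).
Proof.
pose S : set (set (d.-tuple R)) := [set A | measurable A /\ approximable (\1_A : fct)].
suff H : measurable `<=` S by move=> mA; case: (H A mA).
have S0 : S set0.
  split => //; rewrite (_ : \1_set0 = fun=> 0); first exact: approximable_cst.
  by apply/funext => x; rewrite indicE in_set0.
have SC B : S B -> S (~` B) by move=> [mB HB]; split; [exact: measurableC|exact: approximable_setC].
have SU (B : nat -> set (d.-tuple R)) : (forall n, S (B n)) -> S (\bigcup_n B n).
  move=> HB; split; first by apply: bigcup_measurable => k _; case: (HB k).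
  by apply: approximable_bigcup => n; case: (HB n).
have SS : sigma_algebra setT S.
  by split; [exact: S0|move=> B SB; rewrite setTD; exact: SC|exact: SU].
(* Measurable sets of tuples are generated by coordinate preimages of Borel sets, and those of the
   line by open rays, so [approximable_ray] is the only generator to check. *)
apply: (smallest_sub SS) => B; rewrite -bigcup_seq => -[i _ [C mC <-]]; rewrite setTI.
pose Si : set (set R) := [set C | S ((fun x => tnth x i) @^-1` C)].
have : (@ocitv R).-sigma.-measurable C by exact: mC.
rewrite RGenOInfty.measurableE; move: C {mC}; change ((@RGenOInfty.G R).-sigma.-measurable `<=` Si).
apply: smallest_sub.
  split; first by rewrite /Si /= preimage_set0.
    by move=> C SC'; rewrite setTD /Si /= preimage_setC; exact: SC.
  by move=> C HC; rewrite /Si /= preimage_bigcup; exact: SU.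
move=> _ [a ->]; rewrite /Si /=.
rewrite (_ : _ @^-1` _ = [set x : d.-tuple R | a < tnth x i]); last first.
  by apply/seteqP; split => x /=; rewrite in_itv/= andbT.
split; last exact: approximable_ray.
rewrite (_ : [set _ | _] = (fun x => tnth x i) @^-1` `]a, +oo[); last first.
  by apply/seteqP; split => x /=; rewrite in_itv/= andbT.
by rewrite -[X in measurable X]setTI; apply: measurable_tnthR.
Qed.

Lemma approximable_sum (r : seq R) (A : R -> set (d.-tuple R)) : (forall c, measurable (A c)) ->
  approximable (fun x => \sum_(c <- r) c * \1_(A c) x).
Proof.
move=> mA; elim: r => [|c r IH].
  rewrite (_ : (fun x => _) = fun=> 0); first exact: approximable_cst.
  by apply/funext => x; rewrite big_nil.
have := approximable_lin c (approximable_measurable (mA c)) IH; congr approximable.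
by apply/funext => x; rewrite big_cons.
Qed.

Lemma approximable_ge0 f : measurable_fun setT f -> (forall x, 0 <= f x) -> (eN f < +oo)%E -> approximable f.
Proof.
move=> mf f0 Nf; have mf' : measurable_fun setT (EFin \o f) by exact/measurable_EFinP.
have f0' x : setT x -> (0 <= (EFin \o f) x)%E by move=> _; rewrite lee_fin.
pose h n := nnsfun_approx measurableT mf' n.
have hf n x : h n x <= f x.
  by rewrite /h nnsfun_approxE -lee_fin; exact: (@le_approx _ _ _ setT (EFin \o f)).
apply: (@approximable_dominated _ (fun n => h n) (fun x => (`|f x| `^ p)%:E)) => //.
- move=> n; rewrite (_ : (h n : fct) = fun x => \sum_(c <- finmap.enum_fset (fset_set (range (h n)))) c * \1_(h n @^-1` [set c]) x).
    by apply: approximable_sum => c; exact: measurable_sfunP.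
  by apply/funext => x; rewrite fimfunE fsbig_finite.
- apply/integrableP; split; first by apply: measurable_funTS; exact: measurable_npow.
  by rewrite (eq_integral (fun x => (`|f x| `^ p)%:E)) => [//|x _]; rewrite gee0_abs// lee_fin powR_ge0.
- move=> x _ n; rewrite lee_fin ge0_ler_powR ?nnegrE ?(ltW p0)//.
  by rewrite !ger0_norm ?subr_ge0// gerBl.
apply: aeW => x _; have := @cvg_nnsfun_approx _ _ _ setT measurableT _ mf' f0' x I.
by move=> /fine_cvgP[_].
Qed.

Lemma inLp_approximable f : inLp T p f -> approximable f.
Proof.
case/inLpP => mf _ Nf.
have mN : measurable_fun setT (fun x => - f x) by exact: measurableT_comp.
have Hp (k : fct) : measurable_fun setT k -> (forall x, `|k x| = `|f x|) -> approximable (fun x => Num.max (k x) 0).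
  move=> mk kf; apply: approximable_ge0; [exact: measurable_maxr|by move=> x; rewrite le_max lexx orbT|].
  apply: le_lt_trans Nf; apply: ge0_le_integral => //.
  - by apply: measurable_funTS; apply: measurable_npow; exact: measurable_maxr.
  - by apply: measurable_funTS; exact: measurable_npow.
  move=> x _; rewrite lee_fin ge0_ler_powR ?nnegrE ?(ltW p0)// -kf.
  have := max_lip (k x) 0 0 0; by rewrite maxxx !subr0 normr0 addr0.
have Hpos := Hp f mf (fun x => erefl); have Hneg := Hp _ mN (fun x => normrN _).
have := approximable_lin (-1) Hneg Hpos; congr approximable; apply/funext => x.
by rewrite /Num.max; case: ifPn; case: ifPn; rewrite -?leNgt => *; lra.
Qed.

End density.

(** * Recovery sequences *)

Section limsup.
Context {R : realType} (d : nat) (T p : R).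
Hypotheses (T0 : 0 < T) (p1 : 1 <= p).
Local Notation m := (@mu R d).
Local Notation Q := (cube d (side T)).
Local Notation fct := (d.-tuple R -> R).
Local Notation mm := (m \x m)%E.
Local Notation QQ := (Q `*` Q).
Local Notation rN := (@rN R d T p).
Local Notation eN := (@eN R d T p).
Implicit Types f g u w : fct.

Let p0 : 0 < p. Proof. exact: lt_le_trans ltr01 p1. Qed.
Let mQ : measurable Q. Proof. exact: measurable_Q. Qed.
Let mQQ : measurable QQ. Proof. exact: measurableX. Qed.
Let Td : 0 < T ^+ d. Proof. exact: exprn_gt0. Qed.

Lemma F0_ge0 u : measurable_fun setT u -> (0 <= F0 T p u)%E.
Proof. by move=> muu; rewrite F0_QQ//; apply: integral_ge0 => z _; exact: dpow_ge0. Qed.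

Lemma F0_le_eN w : measurable_fun setT w ->
  (F0 T p w <= (2 `^ p * (2 * T ^+ d))%:E * eN w)%E.
Proof.
move=> mw; have mw' := measurable_npow p mw.
have abs x : `| `|w x| `^ p | = `|w x| `^ p by rewrite ger0_norm ?powR_ge0.
have mg : measurable_fun setT (fun x => `|w x| `^ p) by exact/measurable_EFinP.
have m1 : measurable_fun setT (fun z : d.-tuple R * d.-tuple R => (`|w z.1| `^ p)%:E).
  by apply: (measurableT_comp mw').
have m2 : measurable_fun setT (fun z : d.-tuple R * d.-tuple R => (`|w z.2| `^ p)%:E).
  by apply: (measurableT_comp mw').
have I1 : (\int[mm]_(z in QQ) (`|w z.1| `^ p)%:E = (T ^+ d)%:E * eN w)%E.
  have := integral_QQ_fst T0 mg; rewrite /eN; under eq_integral do rewrite abs.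
  by under [X in (_ * X)%E]eq_integral do rewrite abs.
have I2 : (\int[mm]_(z in QQ) (`|w z.2| `^ p)%:E = (T ^+ d)%:E * eN w)%E.
  have := integral_QQ_snd T0 mg; rewrite /eN; under eq_integral do rewrite abs.
  by under [X in (_ * X)%E]eq_integral do rewrite abs.
apply: (@le_trans _ _ (\int[mm]_(z in QQ) ((2 `^ p)%:E * ((`|w z.1| `^ p)%:E + (`|w z.2| `^ p)%:E)))%E).
  rewrite F0_QQ//; apply: ge0_le_integral => //.
  - by move=> z _; exact: dpow_ge0.
  - by apply: measurable_funTS; exact: measurable_dpow.
  - by apply: measurable_funTS; apply: emeasurable_funM => //; exact: emeasurable_funD.
  move=> z _; rewrite -EFinD -EFinM lee_fin.
  apply: (le_trans _ (powRD_le p1 (normr_ge0 _) (normr_ge0 _))).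
  by rewrite ge0_ler_powR ?nnegrE ?(ltW p0) ?addr_ge0// ler_normB.
rewrite ge0_integralZl_EFin ?powR_ge0//; try first [by apply: measurable_funTS; exact: emeasurable_funD | by move=> z _; rewrite -EFinD lee_fin addr_ge0 ?powR_ge0].
rewrite ge0_integralD//; try first [by exact: measurable_funTS | by move=> z _; rewrite lee_fin powR_ge0].
have T0' : (0 <= (T ^+ d)%:E :> \bar R)%E by rewrite lee_fin ltW.
rewrite I1 I2 -(ge0_muleDl _ T0' T0').
by rewrite muleA -EFinD -EFinM mulrDl mul1r.
Qed.

(** Fixing [th] small makes the first coefficient nearly 1; the second may be large, but multiplies
    an energy that vanishes as [g] approaches [u] in norm. *)
Lemma F0_perturb u g th : measurable_fun setT u -> measurable_fun setT g -> 0 < th < 1 ->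
  (F0 T p g <= ((1 - th) `^ (1 - p))%:E * F0 T p u + (th `^ (1 - p))%:E * F0 T p (fun x => (g x - u x)%R))%E.
Proof.
move=> muu mg th01; have mw : measurable_fun setT (fun x => g x - u x) by exact: measurable_funB.
have mdu := measurable_dpow p muu; have mdg := measurable_dpow p mg; have mdw := measurable_dpow p mw.
rewrite !F0_QQ//.
rewrite -ge0_integralZl_EFin ?powR_ge0//; try first [by exact: measurable_funTS | by move=> z _; exact: dpow_ge0].
rewrite -ge0_integralZl_EFin ?powR_ge0//; try first [by exact: measurable_funTS | by move=> z _; exact: dpow_ge0].
rewrite -ge0_integralD//; try first [by move=> z _; rewrite mule_ge0 ?dpow_ge0 ?lee_fin ?powR_ge0 | by apply: measurable_funTS; exact: emeasurable_funM].
apply: ge0_le_integral => //.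
- by move=> z _; exact: dpow_ge0.
- exact: measurable_funTS.
- by apply: measurable_funTS; apply: emeasurable_funD; exact: emeasurable_funM.
move=> z _; rewrite /dpow -!EFinM -EFinD lee_fin.
apply: (le_trans _ (powR_conv p1 (normr_ge0 _) (normr_ge0 _) th01)).
rewrite ge0_ler_powR ?nnegrE ?(ltW p0) ?addr_ge0//.
rewrite (_ : g z.1 - g z.2 = (u z.1 - u z.2) + (g z.1 - u z.1 - (g z.2 - u z.2))); last by ring.
exact: ler_normD.
Qed.

Lemma small_theta e : 0 < e -> exists2 th, 0 < th < 1 & (1 - th) `^ (1 - p) <= 1 + e.
Proof.
(* For [x = (1 + e)^(-1/p)] one gets [x^(1-p) = x (1 + e) <= 1 + e]; the exponent [1/p], unlike
   [1/(p-1)], also makes sense at [p = 1]. *)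
move=> e0; pose x := (1 + e) `^ (- p^-1).
have e1 : 0 < 1 + e by rewrite addr_gt0.
have x0 : 0 < x by exact: powR_gt0.
have x1 : x < 1.
  rewrite /x powRN invf_lt1 ?powR_gt0// -[ltLHS](one_powR p^-1).
  by rewrite gt0_ltr_powR ?nnegrE ?invr_gt0 ?(ltW e1)// ltrDl.
exists (1 - x); first by rewrite subr_gt0 x1 gtrBl x0.
rewrite subKr powRD_gt0// powRr1 ?(ltW x0)//.
rewrite -powRrM mulrNN mulVf ?gt_eqF// powRr1 ?(ltW e1)//.
by rewrite ler_piMl ?(ltW e1)// ltW.
Qed.

Lemma F0_fin u : inLp T p u -> F0 T p u \is a fin_num.
Proof.
move=> uL; have muu := inLp_meas uL; rewrite ge0_fin_numE ?F0_ge0//.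
by apply: (le_lt_trans (F0_le_eN muu)); rewrite (eN_fin uL) -EFinM ltry.
Qed.

Lemma nice_dense u e : inLp T p u -> 0 < e ->
  exists2 g, nice T g & rN (fun x => g x - u x) <= e /\ (F0 T p g <= F0 T p u + e%:E)%E.
Proof.
move=> uL e0; have muu := inLp_meas uL; have Ffin := F0_fin uL.
set F := fine (F0 T p u); have F_ge0 : 0 <= F by rewrite fine_ge0// F0_ge0.
(* The relative error on [F0 u] then costs at most [e / 2]; the threshold [t] below, divided by the
   constant [c] of the perturbation term, leaves [e / 2] for that term. *)
have e1 : 0 < e / 2 / (F + 1) by rewrite !divr_gt0// ltr_wpDl.
have [th th01 Hth] := small_theta e1.
have /andP[th0 _] := th01.
pose c := th `^ (1 - p) * (2 `^ p * (2 * T ^+ d)).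
have c0 : 0 < c by rewrite !mulr_gt0 ?powR_gt0.
pose t := Num.min e (e / 2 / c).
have t0 : 0 < t by rewrite lt_min e0 !divr_gt0.
have [_ Happ] := inLp_approximable T0 p1 uL.
have [g gn ug] := Happ _ t0; exists g => //.
have gL := nice_inLp T0 p1 gn; have mg := inLp_meas gL.
have Hrn : rN (fun x => g x - u x) <= t.
  rewrite -rN_opp (_ : (fun x => _) = (fun x => u x - g x)); last by apply/funext => x; rewrite opprB.
  by rewrite -lee_fin -(eN_fin (inLp_sub p1 uL gL)).
split; first by rewrite (le_trans Hrn)// ge_min lexx.
apply: (le_trans (F0_perturb muu mg th01)).
have guL := inLp_sub p1 gL uL.
have H1 : ((th `^ (1 - p))%:E * F0 T p (fun x => (g x - u x)%R) <= (e / 2)%:E)%E.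
  apply: (@le_trans _ _ ((th `^ (1 - p))%:E * ((2 `^ p * (2 * T ^+ d))%:E * (t)%:E))%E).
    apply: lee_wpmul2l; first by rewrite lee_fin powR_ge0.
    apply: (le_trans (F0_le_eN (inLp_meas guL))); apply: lee_wpmul2l.
      by rewrite lee_fin ltW// !mulr_gt0 ?powR_gt0.
    by rewrite (eN_fin guL) lee_fin.
  rewrite muleA -!EFinM -/c lee_fin mulrC -ler_pdivlMr//.
  by rewrite ge_min lexx orbT.
apply: (@le_trans _ _ ((F + e / 2)%:E + (e / 2)%:E)%E).
  apply: leeD => //; rewrite -(fineK Ffin) -/F -EFinM lee_fin.
  apply: (@le_trans _ _ ((1 + e / 2 / (F + 1)) * F)); first by rewrite ler_wpM2r.
  rewrite mulrDl mul1r lerD2l -mulrA ler_piMr ?divr_ge0 ?(ltW e0)//.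
  by rewrite mulrC ler_pdivrMr ?ltr_wpDl// mul1r lerDl.
rewrite -(fineK Ffin) -/F -!EFinD lee_fin le_eqVlt; apply/orP; left; apply/eqP.
by field.
Qed.

Section recovery.
Variable s : nat -> R.
Hypotheses (d0 : (0 < d)%N) (s01 : forall n, 0 < s n < 1) (s_cvg : s @ \oo --> 0).
Local Notation cst := ((d%:R * omega R d) / (p * T ^+ d)).

Let cst0 : 0 < cst.
Proof. by rewrite divr_gt0// mulr_gt0 ?ltr0n// (@omegaE R d) ball_vol_gt0. Qed.

Lemma nice_energy_limsup g e : nice T g -> 0 < e ->
  \forall n \near \oo, ((s n)%:E * Fs T p (s n) g <= cst%:E * F0 T p g + e%:E)%E.
Proof.
move=> gn e0; have gL := nice_inLp T0 p1 gn; have Ffin := F0_fin gL.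
have [mg pg _] := (inLpP _ _ _).1 gL.
set F := fine (F0 T p g); have F_ge0 : 0 <= F by rewrite fine_ge0// F0_ge0.
case: (gn) => _ _ _ [L L0 HL].
(* Adding 1 here and in [B'] makes the divisors positive; each of the two error terms is allotted
   [e / 2]. *)
pose A := cst * F + 1; have A0 : 0 < A by rewrite ltr_wpDl// mulr_ge0// ltW.
have e1 : 0 < e / 2 / A by rewrite !divr_gt0.
have [r [rD Hr]] := upper_constant p d s_cvg (diam_ge0 d T) e1.
have r0 : 0 < r + diam d T.
  by rewrite ltr_pwDl ?diam_ge0// (le_lt_trans (diam_ge0 d T) rD).
have [B HB] := near_bound d0 p1 r0 L0 mg HL.
pose B' := `|B| * T ^+ d + 1; have B'0 : 0 < B' by rewrite ltr_wpDl// mulr_ge0// ltW.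
have sb c : 0 < c -> \forall n \near \oo, s n <= c.
  move=> c0; move/cvgrPdist_le : s_cvg => /(_ c c0); apply: filterS => n.
  by rewrite sub0r normrN; apply: le_trans; exact: ler_norm.
have h1 : 0 < 2^-1 / p by rewrite divr_gt0// invr_gt0.
have h2 : 0 < e / 2 / B' by rewrite !divr_gt0.
near=> n; have /andP[sn0 sn1] := s01 n.
have snp : s n * p <= 2^-1 by rewrite -ler_pdivlMr//; near: n; exact: sb.
have snB : s n * B' <= e / 2 by rewrite -ler_pdivlMr//; near: n; exact: sb.
have Hn : (1 - diam d T / r) `^ (- (s n * p) - d%:R) * r `^ (- (s n * p)) <= 1 + e / 2 / A by near: n.
apply: (le_trans (Fs_upper T0 d0 p1 sn0 rD mg pg (fun x => HB _ x sn0 snp))).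
rewrite -(fineK Ffin) -/F -!EFinM -!EFinD lee_fin.
have a1 : (1 - diam d T / r) `^ (- (s n * p) - d%:R) * r `^ (- (s n * p)) * cst * F <= cst * F + e / 2.
  rewrite -[X in X <= _]mulrA; apply: (@le_trans _ _ ((1 + e / 2 / A) * (cst * F))).
    by rewrite ler_wpM2r// mulr_ge0// ltW.
  rewrite mulrDl mul1r lerD2l -mulrA ler_piMr ?divr_ge0 ?(ltW e0)//.
  by rewrite mulrC ler_pdivrMr// mul1r /A lerDl.
have a2 : s n * (B * T ^+ d) <= e / 2.
  apply: le_trans snB; rewrite ler_wpM2l ?(ltW sn0)// /B'.
  have : B * T ^+ d <= `|B| * T ^+ d by rewrite ler_wpM2r ?(ltW Td)// ler_norm.
  by move=> H; rewrite (le_trans H)// lerDl.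
by rewrite [e in leRHS](_ : e = e / 2 + e / 2) ?addrA ?lerD//; field.
Unshelve. all: by end_near. Qed.

Lemma Gamma_limsup u : inLp T p u ->
   exists un : nat -> fct,
     (forall n, inLp T p (un n)) /\ weak_conv T p un u /\
     (limn_esup (fun n => (s n)%:E * Fs T p (s n) (un n)) <= cst%:E * F0 T p u)%E.
Proof.
move=> uL; have Ffin := F0_fin uL.
have inv0 k : 0 < k.+1%:R^-1 :> R by rewrite invr_gt0.
have Hex k : exists g, nice T g /\ (rN (fun x => g x - u x) <= k.+1%:R^-1 /\
    (F0 T p g <= F0 T p u + (k.+1%:R^-1)%:E)%E).
  by have [g gn gu] := nice_dense uL (inv0 k); exists g.
have [g Hg] := choice Hex.
have gn k : nice T (g k) by case: (Hg k).
have gL k : inLp T p (g k) by exact: (nice_inLp T0 p1 (gn k)).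
have HN k : exists N, forall n, (N <= n)%N ->
    ((s n)%:E * Fs T p (s n) (g k) <= cst%:E * F0 T p (g k) + (k.+1%:R^-1)%:E)%E.
  by have [N _ H] := nice_energy_limsup (gn k) (inv0 k); exists N.
have [N {}HN] := choice HN.
(* Diagonal choice: the largest [k <= n] with [N k <= n], with 0 as default value. The default
   itself satisfies [N k <= n] only once [N 0 <= n], hence the premise. *)
have Hk n : exists k, ((N 0 <= n)%N -> (N k <= n)%N) /\ forall j, (j <= n)%N -> (N j <= n)%N -> (j <= k)%N.
  pose P k := (k == 0)%N || (k <= n)%N && (N k <= n)%N.
  have Pub k : P k -> (k <= n)%N by case/orP => [/eqP ->|/andP[]].
  have [k Pk Hmax] := ex_maxnP (ex_intro (fun k => P k) 0%N isT) Pub.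
  exists k; split; first by move: Pk => /orP[/eqP ->|/andP[]].
  by move=> j jn Nj; apply: Hmax; rewrite /P jn Nj orbT.
have [K {}HK] := choice Hk.
have K_ge j : \forall n \near \oo, (j <= K n)%N.
  exists (maxn j (N j)) => // n /=; rewrite geq_max => /andP[jn Nj].
  by case: (HK n) => _; apply.
have small (t : R) : 0 < t -> \forall n \near \oo, (K n).+1%:R^-1 <= t.
  move=> t0; near=> n.
  rewrite invf_ple ?posrE// ltW// (lt_le_trans (truncnS_gt _))// ler_nat.
  by rewrite ltnS; near: n; exact: K_ge.
exists (fun n => g (K n)); split => //; split.
  (* The diagonal sequence converges to [u] in norm, and [L] is norm continuous. *)
  move=> L LD; apply/cvgrPdist_lt => e e0.
  have [t t0 Ht] := dual_continuous p1 LD e0.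
  have t20 : 0 < t / 2 by rewrite divr_gt0.
  near=> n; have [_ [gk _]] := Hg (K n).
  have gu := inLp_sub p1 (gL (K n)) uL.
  rewrite distrC (_ : L (g (K n)) - L u = L (fun x => g (K n) x - u x)).
    apply: Ht => //; apply: (le_lt_trans gk); apply: (@le_lt_trans _ _ (t / 2)).
      by near: n; exact: small.
    by rewrite ltr_pdivrMr// ltr_pMr// ltr1n.
  rewrite (_ : (fun x => _ - _) = (fun x => -1 * u x + g (K n) x)); last by apply/funext => x; ring.
  by case: LD => lin _; rewrite lin//; ring.
apply/lee_addgt0Pr => e e0; apply: limn_esup_le_near.
have e1 : 0 < e / (cst + 1) by rewrite divr_gt0// ltr_wpDl// ltW.
near=> n; have [_ [_ Fk]] := Hg (K n).
have N0n : (N 0 <= n)%N by near: n; exact: nbhs_infty_ge.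
have [/(_ N0n) Nk _] := HK n.
apply: (le_trans (HN _ _ Nk)).
apply: (@le_trans _ _ (cst%:E * (F0 T p u + ((K n).+1%:R^-1)%:E) + ((K n).+1%:R^-1)%:E)%E).
  by apply: leeD2r; apply: lee_wpmul2l => //; rewrite lee_fin ltW.
rewrite -(fineK Ffin) -EFinD -!EFinM -!EFinD lee_fin.
have Hq : (K n).+1%:R^-1 <= e / (cst + 1) by near: n; exact: small.
move: Hq; set q := (K n).+1%:R^-1 => Hq.
rewrite mulrDr -addrA lerD2l.
rewrite (_ : cst * q + q = q * (cst + 1)); last by ring.
by rewrite -ler_pdivlMr// ltr_wpDl// ltW.
Unshelve. all: by end_near. Qed.

End recovery.
End limsup.

Theorem mainTheorem3 (R : realType) (d : nat) (T p : R) (s : nat -> R) :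
  (0 < d)%N -> 0 < T -> 1 <= p ->
  (forall n, 0 < s n < 1) -> s @ \oo --> 0 ->
  (* (1) compactness *)
  (p != 1 ->
   forall (un : nat -> d.-tuple R -> R) (C : R),
   (forall n, inLp T p (un n)) ->
   (forall n, ((s n)%:E * Fs T p (s n) (un n) <= C%:E)%E) ->
   exists phi : nat -> nat, {homo phi : m n / (m < n)%N >-> (m < n)%N} /\
   exists u : d.-tuple R -> R, inLp T p u /\ avg T u = 0 /\
     weak_conv T p (fun k x => un (phi k) x - avg T (un (phi k))) u) /\
  (* (2) Gamma-liminf *)
  (forall (u : d.-tuple R -> R) (un : nat -> d.-tuple R -> R),
   inLp T p u -> (forall n, inLp T p (un n)) -> weak_conv T p un u ->
   (((d%:R * omega R d) / (p * T ^+ d))%:E * F0 T p u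
      <= limn_einf (fun n => (s n)%:E * Fs T p (s n) (un n)))%E) /\
  (* (3) Gamma-limsup *)
  (forall u : d.-tuple R -> R, inLp T p u ->
   exists un : nat -> d.-tuple R -> R,
     (forall n, inLp T p (un n)) /\ weak_conv T p un u /\
     (limn_esup (fun n => (s n)%:E * Fs T p (s n) (un n))
        <= ((d%:R * omega R d) / (p * T ^+ d))%:E * F0 T p u)%E).
Proof.
move=> d0 T0 p1 s01 s0; split; last split.
- by move=> pn1 un C; exact: (compactness T0 p1 d0 s01 s0 pn1).
- by move=> u un; exact: (Gamma_liminf T0 p1 d0 s01 s0).
- by move=> u; exact: (Gamma_limsup T0 p1 d0 s01 s0).
Qed.
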